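(* Let $E_1=\mathbb{C}/\Gamma_1$ and $E_2=\mathbb{C}/\Gamma_2$ be elliptic curves and $X=E_1\times E_2$, equipped with the Hermitian form $\omega$ induced by the Euclidean form $\frac{\sqrt{-1}}{2}(dz_1\wedge d\bar z_1+dz_2\wedge d\bar z_2)$ on $\mathbb{C}^2$. There exists an entire curve $g:\mathbb{C}\to X$ such that for every $e_1\in E_1$ there is an increasing sequence of radii $r_\ell\nearrow\infty$ for which the concentric discs $g\restriction_{\mathbb{D}_{r_\ell}}$ produce Nevanlinna currents and Ahlfors currents (along subsequences), and every such current is a positive multiple of the current of integration $[\{e_1\}\times E_2]$; and likewise for every $e_2\in E_2$ there is an increasing sequence of radii $r'_\ell\nearrow\infty$ for which the discs $g\restriction_{\mathbb{D}_{r'_\ell}}$ produce Nevanlinna and Ahlfors currents, each a positive multiple of $[E_1\times\{e_2\}]$.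
   Context: $\mathbb{D}_r$ denotes the open disc of radius $r$ centered at $0$ in $\mathbb{C}$. For a nonconstant holomorphic disc $f:\mathbb{D}_R\to X$ that is the restriction of a holomorphic map on a neighborhood of $\overline{\mathbb{D}}_R$, set $T_f(\eta)=\int_0^R\frac{dt}{t}\int_{\mathbb{D}_t}f^*\eta$ for smooth $(1,1)$-forms $\eta$ and $L_f(\omega)=\int_0^R\mathrm{Length}_\omega(f(\partial\mathbb{D}_t))\frac{dt}{t}$. A sequence of such discs $f_i:\mathbb{D}_{r_i}\to X$ produces Nevanlinna currents if $L_{f_i}(\omega)/T_{f_i}(\omega)\to0$; the Nevanlinna currents are the weak limits of subsequences of $T_{f_i}/T_{f_i}(\omega)$. It produces Ahlfors currents if $\mathrm{Length}_\omega(f_i(\partial\mathbb{D}_{r_i}))/\mathrm{Area}_\omega(f_i(\mathbb{D}_{r_i}))\to0$; the Ahlfors currents are the weak limits of subsequences of $[f_i(\mathbb{D}_{r_i})]/\mathrm{Area}_\omega(f_i(\mathbb{D}_{r_i}))$, where $[f_i(\mathbb{D}_{r_i})](\eta)=\int_{\mathbb{D}_{r_i}}f_i^*\eta$. *)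

(* Defs.v *)
From Stdlib Require Import Reals.
From Coquelicot Require Import Coquelicot.
Open Scope R_scope.

Definition lattice (a b : C) (g : C) : Prop :=
  exists m n : Z, g = (RtoC (IZR m) * a + RtoC (IZR n) * b)%C.
(* a, b are R-linearly independent *)
Definition nondeg (a b : C) : Prop := Im (Cconj a * b) <> 0.

Definition shiftR (p v : C * C) (t : R) : C * C :=
  ((fst p + RtoC t * fst v)%C, (snd p + RtoC t * snd v)%C).
Definition coord_dir (v : C * C) : Prop :=
  v = (RtoC 1, RtoC 0) \/ v = ((0, 1) : C, RtoC 0) \/
  v = (RtoC 0, RtoC 1) \/ v = (RtoC 0, (0, 1) : C).
Definition pderiv (v : C * C) (f : C * C -> R) (p : C * C) : R :=
  Derive (fun t => f (shiftR p v t)) 0.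
Fixpoint Ck (k : nat) (f : C * C -> R) : Prop :=
  (forall p : C * C, continuous f p) /\
  match k with
  | O => True
  | S k' => forall v, coord_dir v ->
      (forall p, ex_derive (fun t => f (shiftR p v t)) 0) /\ Ck k' (pderiv v f)
  end.
Definition smoothC (f : C * C -> C) : Prop :=
  forall k, Ck k (fun p => Re (f p)) /\ Ck k (fun p => Im (f p)).

(** * (1,1)-forms on X = E1 x E2
   eta = (i/2) sum_{j,k} c_jk dz_j /\ dz_k-bar, with coefficients on C^2;
   forms on X = Gamma1 x Gamma2 - periodic forms on C^2. *)
Record form11 := Form11 {
  c11 : C * C -> C; c12 : C * C -> C; c21 : C * C -> C; c22 : C * C -> C }.

Definition periodic (a1 b1 a2 b2 : C) (f : C * C -> C) : Prop :=
  forall (p : C * C) (g1 g2 : C), lattice a1 b1 g1 -> lattice a2 b2 g2 ->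
    f ((fst p + g1)%C, (snd p + g2)%C) = f p.

Definition test_form (a1 b1 a2 b2 : C) (eta : form11) : Prop :=
  smoothC (c11 eta) /\ smoothC (c12 eta) /\ smoothC (c21 eta) /\ smoothC (c22 eta) /\
  periodic a1 b1 a2 b2 (c11 eta) /\ periodic a1 b1 a2 b2 (c12 eta) /\
  periodic a1 b1 a2 b2 (c21 eta) /\ periodic a1 b1 a2 b2 (c22 eta).

Definition omega : form11 :=
  Form11 (fun _ => RtoC 1) (fun _ => RtoC 0) (fun _ => RtoC 0) (fun _ => RtoC 1).

(** * Entire curves C -> X, given by a holomorphic lift (g1, g2) : C -> C^2
   together with its complex derivative (dg1, dg2). *)
Record curve := Curve { g1 : C -> C; g2 : C -> C; dg1 : C -> C; dg2 : C -> C }.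

Definition entire (g : curve) : Prop :=
  (forall z : C, is_derive (K := C_AbsRing) (V := C_NormedModule) (g1 g) z (dg1 g z)) /\
  (forall z : C, is_derive (K := C_AbsRing) (V := C_NormedModule) (g2 g) z (dg2 g z)).

Definition nonconst_on (g : curve) (r : R) : Prop :=
  exists z : C, Cmod z < r /\ (g1 g z <> g1 g (RtoC 0) \/ g2 g z <> g2 g (RtoC 0)).

(* density of g^* eta with respect to Lebesgue measure dx dy on C *)
Definition pull (eta : form11) (g : curve) (z : C) : C :=
  let p := (g1 g z, g2 g z) in
  (c11 eta p * dg1 g z * Cconj (dg1 g z) + c12 eta p * dg1 g z * Cconj (dg2 g z) +
   c21 eta p * dg2 g z * Cconj (dg1 g z) + c22 eta p * dg2 g z * Cconj (dg2 g z))%C.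

Definition CInt (f : R -> C) (a b : R) : C :=
  (RInt (fun x => Re (f x)) a b, RInt (fun x => Im (f x)) a b).
Definition pol (s th : R) : C := (s * cos th, s * sin th).
(* integral over the disc D_t, in polar coordinates (dA = s ds dtheta) *)
Definition disc_int (h : C -> C) (t : R) : C :=
  CInt (fun s => CInt (fun th => (h (pol s th) * RtoC s)%C) 0 (2 * PI)) 0 t.

Definition image_current (g : curve) (r : R) (eta : form11) : C :=
  disc_int (pull eta g) r.
Definition Tnev (g : curve) (R0 : R) (eta : form11) : C :=
  CInt (fun t => (disc_int (pull eta g) t / RtoC t)%C) 0 R0.
Definition bdry_length (g : curve) (t : R) : R :=
  RInt (fun th => sqrt (Cmod (dg1 g (pol t th)) ^ 2 + Cmod (dg2 g (pol t th)) ^ 2) * t)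
       0 (2 * PI).
Definition Lnev (g : curve) (R0 : R) : R :=
  RInt (fun t => bdry_length g t / t) 0 R0.
Definition Area (g : curve) (r : R) : R := Re (image_current g r omega).

Definition radii (r : nat -> R) : Prop :=
  (forall l, 0 < r l /\ r l < r (S l)) /\ is_lim_seq r p_infty.

Definition produces_nevanlinna (g : curve) (r : nat -> R) : Prop :=
  (forall l, nonconst_on g (r l)) /\
  is_lim_seq (fun l => Lnev g (r l) / Re (Tnev g (r l) omega)) 0.

Definition produces_ahlfors (g : curve) (r : nat -> R) : Prop :=
  (forall l, nonconst_on g (r l)) /\
  is_lim_seq (fun l => bdry_length g (r l) / Area g (r l)) 0.

Definition subseq (phi : nat -> nat) : Prop := forall n, (phi n < phi (S n))%nat.

Definition nevanlinna_current (a1 b1 a2 b2 : C) (g : curve) (r : nat -> R)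
    (T : form11 -> C) : Prop :=
  exists phi, subseq phi /\
  forall eta, test_form a1 b1 a2 b2 eta ->
    filterlim (fun l => (Tnev g (r (phi l)) eta / RtoC (Re (Tnev g (r (phi l)) omega)))%C)
      eventually (locally (T eta)).

Definition ahlfors_current (a1 b1 a2 b2 : C) (g : curve) (r : nat -> R)
    (T : form11 -> C) : Prop :=
  exists phi, subseq phi /\
  forall eta, test_form a1 b1 a2 b2 eta ->
    filterlim (fun l => (image_current g (r (phi l)) eta / RtoC (Area g (r (phi l))))%C)
      eventually (locally (T eta)).

(* [{e1} x E2](eta) = int_{E2} eta_{22}(e1, .) dA, E2 parametrized by the
   fundamental parallelogram {s a2 + t b2 : s,t in [0,1]}. *)
Definition fiber1_current (a2 b2 e1 : C) (eta : form11) : C :=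
  (RtoC (Rabs (Im (Cconj a2 * b2))) *
   CInt (fun s => CInt (fun t =>
     c22 eta (e1, (RtoC s * a2 + RtoC t * b2)%C)) 0 1) 0 1)%C.
Definition fiber2_current (a1 b1 e2 : C) (eta : form11) : C :=
  (RtoC (Rabs (Im (Cconj a1 * b1))) *
   CInt (fun s => CInt (fun t =>
     c11 eta ((RtoC s * a1 + RtoC t * b1)%C, e2)) 0 1) 0 1)%C.

Definition positive_multiple (a1 b1 a2 b2 : C) (T S : form11 -> C) : Prop :=
  exists c : R, 0 < c /\
  forall eta, test_form a1 b1 a2 b2 eta -> T eta = (RtoC c * S eta)%C.

(* Main.v *)
(** The curve is [g = lim (G1, G2)], built by adding exponentials on larger and larger discs.  At a step
    of radius [r] with target [e] in the first factor, one first adds [c exp (N' (z - r))] to [G1] so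
    that [G1 r = e], and then [exp (N (z - r + 1/2))] to [G2] with [N] enormous.  Both terms are
    negligible on the disc of radius [r - 1], so the sums converge; on the disc of radius [r] the
    second one carries almost all the area, all of it near [z = r] where [g1] is close to [e].
    The targets run infinitely often through a dense sequence, alternately in both factors.
    For a test form, the coefficients other than [c22] then contribute little by Cauchy-Schwarz, and
    [c22 (g1, g2)] may be replaced by [c22 (e1, g2)].  On the torus, [c22 (e1, .)] minus its mean is the
    differential of a bounded 1-form, so by Green's formula its integral over the image of the disc is
    bounded by the length of the boundary, which is negligible with respect to the area.  The same
    estimates hold for the logarithmic averages that define Nevanlinna currents. *)

Require Import Defs.
From Stdlib Require Import ZArith Reals Lra Lia Psatz Classical ClassicalEpsilon FunctionalExtensionality Cantor.
From Coquelicot Require Import Coquelicot.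
Open Scope R_scope.

(** * Continuity and complex derivatives *)

(** Concentration has to survive infinitely many later corrections, so each step proves it for every
    curve that is $C^1$-close to the current pair on the disc of radius [r], and not only for that
    pair; the limit curve is then covered at every step. The correction of [G1] is fixed before [N]
    is chosen, because the Lipschitz bound for the first component near [z = r] must not depend on
    [N]. The shift by [1/2] serves both sides at once: up to powers of [N], the second term has size
    at most [exp (- N / 2)] on the disc of radius [r - 1] and size [exp (N / 2)] at [z = r].
    Derivatives of the limit are found as limits of derivatives, so the approximants carry their
    derivatives along, and Taylor estimates pass to the limit. Countably many targets serve all [e],
    since replacing [e] by a target at distance [d] costs only a Lipschitz constant times [d] in the
    normalized integrals. The estimates use area and length only through linearity, positivity and
    the length-area bound, so Ahlfors and Nevanlinna currents are two instances of a single argument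
    about abstract functionals. *)

Section Continuity.
Context {U : UniformSpace}.
Implicit Types f g : U -> R.

Lemma ct_plus f g x : continuous f x -> continuous g x -> continuous (fun y => f y + g y) x.
Proof. exact (continuous_plus (V := R_NormedModule) f g x). Qed.
Lemma ct_minus f g x : continuous f x -> continuous g x -> continuous (fun y => f y - g y) x.
Proof. exact (continuous_minus (V := R_NormedModule) f g x). Qed.
Lemma ct_mult f g x : continuous f x -> continuous g x -> continuous (fun y => f y * g y) x.
Proof. exact (continuous_mult (K := R_AbsRing) f g x). Qed.
Lemma ct_opp f x : continuous f x -> continuous (fun y => - f y) x.
Proof. exact (continuous_opp (V := R_NormedModule) f x). Qed.
Lemma ct_pow f n x : continuous f x -> continuous (fun y => f y ^ n) x.
Proof.
  intros H; induction n as [|n IH]; simpl; [apply continuous_const|].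
  now apply ct_mult.
Qed.
Lemma ct_comp (h : R -> R) f x : continuous f x -> continuity_pt h (f x) ->
  continuous (fun y => h (f y)) x.
Proof.
  intros H1 H2; apply (continuous_comp f h); [exact H1|].
  now apply continuity_pt_filterlim.
Qed.
Lemma ct_sqrt f x : continuous f x -> continuous (fun y => sqrt (f y)) x.
Proof.
  intros H; apply (continuous_comp f sqrt); [exact H|]. apply continuous_sqrt.
Qed.
Lemma ct_abs f x : continuous f x -> continuous (fun y => Rabs (f y)) x.
Proof. intros H; apply ct_comp; auto. apply Rcontinuity_abs. Qed.
Lemma ct_exp f x : continuous f x -> continuous (fun y => exp (f y)) x.
Proof.
  intros H; apply ct_comp; auto. apply derivable_continuous_pt, derivable_pt_exp.
Qed.
Lemma ct_cos f x : continuous f x -> continuous (fun y => cos (f y)) x.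
Proof. intros H; apply ct_comp; auto. apply continuity_cos. Qed.
Lemma ct_sin f x : continuous f x -> continuous (fun y => sin (f y)) x.
Proof. intros H; apply ct_comp; auto. apply continuity_sin. Qed.

Lemma ct_pair {V W : UniformSpace} (f : U -> V) (g : U -> W) x :
  continuous f x -> continuous g x ->
  continuous (U := prod_UniformSpace V W) (fun y => (f y, g y)) x.
Proof.
  intros Hf Hg; apply (continuous_comp_2 f g pair); auto.
  apply continuous_ext with (f := fun p : V * W => p).
  - now intros [].
  - apply continuous_id.
Qed.
Lemma ct_fst {V W : UniformSpace} (f : U -> V * W) x :
  continuous f x -> continuous (fun y => fst (f y)) x.
Proof.
  intros H; apply (continuous_comp f fst); auto. destruct (f x); apply continuous_fst.
Qed.
Lemma ct_snd {V W : UniformSpace} (f : U -> V * W) x :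
  continuous f x -> continuous (fun y => snd (f y)) x.
Proof.
  intros H; apply (continuous_comp f snd); auto. destruct (f x); apply continuous_snd.
Qed.
Lemma ct_Re (f : U -> C) x : continuous f x -> continuous (fun y => Re (f y)) x.
Proof. apply ct_fst. Qed.
Lemma ct_Im (f : U -> C) x : continuous f x -> continuous (fun y => Im (f y)) x.
Proof. apply ct_snd. Qed.
Lemma ct_C (f : U -> C) x : continuous (fun y => Re (f y)) x ->
  continuous (fun y => Im (f y)) x -> continuous f x.
Proof.
  intros H1 H2. apply continuous_ext with (fun y => (Re (f y), Im (f y))).
  - intros y; now destruct (f y).
  - now apply ct_pair.
Qed.
Lemma ct_Cplus (f g : U -> C) x : continuous f x -> continuous g x ->
  continuous (fun y => (f y + g y)%C) x.
Proof.
  intros H1 H2; apply ct_C; apply ct_plus;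
    [exact (ct_fst _ _ H1)|exact (ct_fst _ _ H2)|exact (ct_snd _ _ H1)|exact (ct_snd _ _ H2)].
Qed.
Lemma ct_Cminus (f g : U -> C) x : continuous f x -> continuous g x ->
  continuous (fun y => (f y - g y)%C) x.
Proof.
  intros H1 H2; apply ct_C; apply ct_minus;
    [exact (ct_fst _ _ H1)|exact (ct_fst _ _ H2)|exact (ct_snd _ _ H1)|exact (ct_snd _ _ H2)].
Qed.
Lemma ct_Cmult (f g : U -> C) x : continuous f x -> continuous g x ->
  continuous (fun y => (f y * g y)%C) x.
Proof.
  intros H1 H2; apply ct_C; [apply ct_minus|apply ct_plus]; apply ct_mult;
    [exact (ct_fst _ _ H1)|exact (ct_fst _ _ H2)|exact (ct_snd _ _ H1)|exact (ct_snd _ _ H2)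
    |exact (ct_fst _ _ H1)|exact (ct_snd _ _ H2)|exact (ct_snd _ _ H1)|exact (ct_fst _ _ H2)].
Qed.
Lemma ct_Cconj (f : U -> C) x : continuous f x -> continuous (fun y => Cconj (f y)) x.
Proof.
  intros H1; apply ct_C; [|apply ct_opp]; [exact (ct_fst _ _ H1)|exact (ct_snd _ _ H1)].
Qed.
Lemma ct_RtoC f x : continuous f x -> continuous (fun y => RtoC (f y)) x.
Proof. intros H1; apply ct_C; simpl; [auto|apply continuous_const]. Qed.
Lemma ct_Cmod (f : U -> C) x : continuous f x -> continuous (fun y => Cmod (f y)) x.
Proof.
  intros H; unfold Cmod; apply ct_sqrt, ct_plus; apply ct_pow; [apply ct_fst|apply ct_snd]; auto.
Qed.
End Continuity.

Lemma ct_pol {U : UniformSpace} (f g : U -> R) x : continuous f x -> continuous g x ->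
  continuous (fun y => pol (f y) (g y)) x.
Proof.
  intros H1 H2; unfold pol; apply ct_pair; apply ct_mult; auto; [now apply ct_cos|now apply ct_sin].
Qed.

(** Directed by syntax, and closed under hypotheses of the literal form [forall z, continuous h z];
    this is why continuity facts are recorded in that form and [cont] is unfolded before [cts] is
    called. *)
Ltac ct_step :=
  match goal with
  | |- continuous (fun x => ?c) _ => apply continuous_const
  | |- continuous (fun x => x) _ => apply continuous_id
  | |- continuous (fun x => (@?f x + @?g x)%R) _ => apply (ct_plus f g)
  | |- continuous (fun x => (@?f x - @?g x)%R) _ => apply (ct_minus f g)
  | |- continuous (fun x => (@?f x * @?g x)%R) _ => apply (ct_mult f g)
  | |- continuous (fun x => (- @?f x)%R) _ => apply (ct_opp f)
  | |- continuous (fun x => (@?f x ^ ?n)%R) _ => apply (ct_pow f n)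
  | |- continuous (fun x => sqrt (@?f x)) _ => apply (ct_sqrt f)
  | |- continuous (fun x => Rabs (@?f x)) _ => apply (ct_abs f)
  | |- continuous (fun x => exp (@?f x)) _ => apply (ct_exp f)
  | |- continuous (fun x => cos (@?f x)) _ => apply (ct_cos f)
  | |- continuous (fun x => sin (@?f x)) _ => apply (ct_sin f)
  | |- continuous (fun x => Cplus (@?f x) (@?g x)) _ => apply (ct_Cplus f g)
  | |- continuous (fun x => Cminus (@?f x) (@?g x)) _ => apply (ct_Cminus f g)
  | |- continuous (fun x => Cmult (@?f x) (@?g x)) _ => apply (ct_Cmult f g)
  | |- continuous (fun x => Cconj (@?f x)) _ => apply (ct_Cconj f)
  | |- continuous (fun x => RtoC (@?f x)) _ => apply (ct_RtoC f)
  | |- continuous (fun x => Cmod (@?f x)) _ => apply (ct_Cmod f)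
  | |- continuous (fun x => pol (@?f x) (@?g x)) _ => apply (ct_pol f g)
  | |- continuous (fun x => Re (@?f x)) _ => apply (ct_Re f)
  | |- continuous (fun x => Im (@?f x)) _ => apply (ct_Im f)
  | |- continuous (fun x => (@?f x, @?g x)) _ => apply (ct_pair f g)
  | |- continuous (fun x => fst (@?f x)) _ => apply (ct_fst f)
  | |- continuous (fun x => snd (@?f x)) _ => apply (ct_snd f)
  | H : forall z, continuous ?h z |- continuous ?h _ => apply H
  | H : forall z, continuous ?h z |- continuous (fun x => ?h (@?f x)) _ =>
      apply (continuous_comp f h); [|apply H]
  end.
Ltac cts := repeat (cbv beta; ct_step).

Lemma locally_C_Cmod (z : C) (P : C -> Prop) :
  locally z P <-> exists d, 0 < d /\ forall w, Cmod (w - z)%C < d -> P w.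
Proof.
  split.
  - intros H. apply locally_C in H. destruct H as [d Hd].
    exists d; split; [apply cond_pos|]. intros w Hw; apply Hd; exact Hw.
  - intros [d [Hd H]]. apply locally_C. exists (mkposreal d Hd). intros w Hw; apply H; exact Hw.
Qed.

Lemma continuous_C_R (f : C -> R) z :
  continuous f z <-> forall e, 0 < e -> exists d, 0 < d /\
    forall w, Cmod (w - z)%C < d -> Rabs (f w - f z) < e.
Proof.
  split.
  - intros H e He.
    assert (L : locally (f z) (fun y => Rabs (y - f z) < e)).
    { exists (mkposreal e He); intros y Hy; exact Hy. }
    specialize (H _ L). now apply locally_C_Cmod in H.
  - intros H P [e He]. apply locally_C_Cmod. destruct (H e (cond_pos e)) as [d [Hd Hw]].
    exists d; split; auto. intros w Hd'; apply He; exact (Hw w Hd').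
Qed.

Lemma Rabs_Re (c : C) : Rabs (Re c) <= Cmod c.
Proof. apply re_le_Cmod. Qed.
Lemma Rabs_Im (c : C) : Rabs (Im c) <= Cmod c.
Proof. eapply Rle_trans; [apply Rmax_r|apply Rmax_Cmod]. Qed.
Lemma Cmod_le_ReIm (c : C) : Cmod c <= Rabs (Re c) + Rabs (Im c).
Proof.
  replace c with (RtoC (Re c) + RtoC (Im c) * Ci)%C at 1.
  - eapply Rle_trans; [apply Cmod_triangle|]. rewrite Cmod_mult, !Cmod_R.
    replace (Cmod Ci) with 1; [lra|]. unfold Cmod, Ci; simpl.
    replace (0*(0*1)+1*(1*1)) with 1 by ring. now rewrite sqrt_1.
  - destruct c; unfold Ci, RtoC, Cplus, Cmult; simpl; f_equal; ring.
Qed.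
Lemma Cmod_sqr (c : C) : Cmod c ^ 2 = Re c ^ 2 + Im c ^ 2.
Proof. unfold Cmod; rewrite pow2_sqrt; [reflexivity|]. apply Rplus_le_le_0_compat; apply pow2_ge_0. Qed.
Lemma Cmod_sub_sym (a b : C) : Cmod (a - b)%C = Cmod (b - a)%C.
Proof. rewrite <- (Cmod_opp (a-b)%C). f_equal; ring. Qed.
Lemma Cmod_pol (s t : R) : 0 <= s -> Cmod (pol s t) = s.
Proof.
  intros Hs; unfold Cmod, pol; simpl fst; simpl snd.
  replace ((s * cos t) ^ 2 + (s * sin t) ^ 2) with (Rsqr s * (Rsqr (sin t) + Rsqr (cos t)))
    by (unfold Rsqr; ring).
  rewrite sin2_cos2, Rmult_1_r. now apply sqrt_Rsqr.
Qed.

(** Complex differentiability in its little-o form, with the single norm [Cmod]. All estimates are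
    made in this form, which is translated to [is_derive] only for the final [entire]. *)
Definition Cder (f : C -> C) (z l : C) : Prop :=
  forall e, 0 < e -> exists d, 0 < d /\ forall w, Cmod (w - z)%C < d ->
    Cmod (f w - f z - l * (w - z))%C <= e * Cmod (w - z)%C.

Lemma Cder_is_derive f z l : Cder f z l ->
  is_derive (K := C_AbsRing) (V := C_NormedModule) f z l.
Proof.
  intros H; split.
  - apply (is_linear_scal_l (K := C_AbsRing) (V := C_NormedModule) l).
  - intros x Hx. 
    assert (x = z).
    { symmetry. exact (is_filter_lim_locally_unique (V := AbsRing_NormedModule C_AbsRing) z x Hx). }
    subst x. intros e. destruct (H e (cond_pos e)) as [d [Hd Hw]].
    exists (mkposreal d Hd). intros w Hw'.
    eapply Rle_trans; [|apply (Hw w Hw')]. apply Req_le.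
    change (Cmod (f w - f z - (w - z) * l)%C = Cmod (f w - f z - l * (w - z))%C).
    f_equal; ring.
Qed.

Lemma Cder_cont f z l : Cder f z l -> continuous f z.
Proof.
  intros H. destruct (H 1 Rlt_0_1) as [d [Hd Hw]].
  assert (K : forall e, 0 < e -> exists d, 0 < d /\
    forall w, Cmod (w - z)%C < d -> Cmod (f w - f z)%C < e).
  { intros e He. set (K := 1 + Cmod l + 1).
    assert (HK : 0 < K) by (unfold K; generalize (Cmod_ge_0 l); lra).
    exists (Rmin d (e / K)); split.
    - apply Rmin_pos; auto. now apply Rdiv_lt_0_compat.
    - intros w Hm.
      assert (H1 : Cmod (w-z)%C < d) by (eapply Rlt_le_trans; [exact Hm|apply Rmin_l]).
      assert (H2 : Cmod (w-z)%C < e / K) by (eapply Rlt_le_trans; [exact Hm|apply Rmin_r]).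
      specialize (Hw w H1).
      replace (f w - f z)%C with ((f w - f z - l * (w - z)) + l * (w-z))%C by ring.
      eapply Rle_lt_trans; [apply Cmod_triangle|]. rewrite Cmod_mult.
      assert (H3 : K * Cmod (w-z)%C < e).
      { apply Rmult_lt_reg_r with (/K); [now apply Rinv_0_lt_compat|].
        replace (K * Cmod (w-z)%C * / K) with (Cmod (w-z)%C) by (field; lra). exact H2. }
      unfold K in H3. generalize (Cmod_ge_0 (w-z)%C); nra. }
  apply ct_C; apply continuous_C_R; intros e He; destruct (K e He) as [d' [Hd' Hw']];
    exists d'; split; auto; intros w Hm; (eapply Rle_lt_trans; [|exact (Hw' w Hm)]).
  - apply (Rabs_Re (f w - f z)%C).
  - apply (Rabs_Im (f w - f z)%C).
Qed.

Lemma Cder_plus f g z l m : Cder f z l -> Cder g z m ->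
  Cder (fun w => f w + g w)%C z (l + m)%C.
Proof.
  intros H1 H2 e He.
  destruct (H1 (e/2)) as [d1 [Hd1 Hw1]]; [lra|].
  destruct (H2 (e/2)) as [d2 [Hd2 Hw2]]; [lra|].
  exists (Rmin d1 d2); split; [now apply Rmin_pos|]. intros w Hm.
  specialize (Hw1 w (Rlt_le_trans _ _ _ Hm (Rmin_l _ _))).
  specialize (Hw2 w (Rlt_le_trans _ _ _ Hm (Rmin_r _ _))).
  replace (f w + g w - (f z + g z) - (l + m) * (w - z))%C with
   ((f w - f z - l * (w - z)) + (g w - g z - m * (w-z)))%C by ring.
  eapply Rle_trans; [apply Cmod_triangle|]. lra.
Qed.

Lemma Cder_scal c f z l : Cder f z l -> Cder (fun w => c * f w)%C z (c * l)%C.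
Proof.
  intros H e He.
  assert (Hc : 0 < Cmod c + 1) by (generalize (Cmod_ge_0 c); lra).
  destruct (H (e / (Cmod c + 1))) as [d [Hd Hw]]; [now apply Rdiv_lt_0_compat|].
  exists d; split; auto. intros w Hm; specialize (Hw w Hm).
  replace (c * f w - c * f z - c * l * (w - z))%C with (c * (f w - f z - l * (w-z)))%C by ring.
  rewrite Cmod_mult.
  apply Rle_trans with ((Cmod c + 1) * (e / (Cmod c + 1) * Cmod (w - z)%C)).
  - apply Rmult_le_compat; auto using Cmod_ge_0; lra.
  - apply Req_le; field; lra.
Qed.

Lemma Cder_const c z : Cder (fun _ => c) z 0%C.
Proof.
  intros e He; exists 1; split; [lra|]. intros w _.
  replace (c - c - 0 * (w - z))%C with (RtoC 0) by ring. rewrite Cmod_0.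
  generalize (Cmod_ge_0 (w-z)%C); nra.
Qed.
Lemma Cder_id z : Cder (fun w => w) z 1%C.
Proof.
  intros e He; exists 1; split; [lra|]. intros w _.
  replace (w - z - 1 * (w - z))%C with (RtoC 0) by ring. rewrite Cmod_0.
  generalize (Cmod_ge_0 (w-z)%C); nra.
Qed.

(** Chain rule along a real path in the plane. It is the only bridge from complex derivatives to
    real calculus, on segments and on polar coordinate lines. *)
Lemma Cder_path f l (p q : R -> R) t dp dq :
  Cder f (p t, q t) l -> is_derive p t dp -> is_derive q t dq ->
  is_derive (fun s => Re (f (p s, q s))) t (Re (l * (dp, dq))%C) /\
  is_derive (fun s => Im (f (p s, q s))) t (Im (l * (dp, dq))%C).
Proof.
  intros Hf Hp Hq.
  (* Real and imaginary parts are treated together through [a * Re + b * Im]; the cases [(1, 0)] and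
     [(0, 1)] are read off at the end. *)
  assert (F : forall a b : R, (forall w : C, Rabs (a * Re w + b * Im w) <= (Rabs a + Rabs b) * Cmod w) /\
    filterdiff (fun u : R * R => a * Re (f u) + b * Im (f u)) (locally (p t, q t))
     (fun u : R * R => a * Re (l * u)%C + b * Im (l * u)%C)).
  { intros a b.
    assert (E : forall w : C, Rabs (a * Re w + b * Im w) <= (Rabs a + Rabs b) * Cmod w).
    { intros w. eapply Rle_trans; [apply Rabs_triang|]. rewrite !Rabs_mult.
      generalize (Rabs_Re w) (Rabs_Im w) (Rabs_pos a) (Rabs_pos b); nra. }
    split; [exact E|]. split.
    - split.
      + intros x y. destruct x, y, l; unfold plus; simpl; unfold plus; simpl; ring.
      + intros k x; destruct x, l; unfold scal; simpl; unfold scal; simpl; unfold mult; simpl; ring.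
      + exists ((Rabs a + Rabs b + 1) * (Cmod l + 1) * 2). split.
        * generalize (Rabs_pos a) (Rabs_pos b) (Cmod_ge_0 l); nra.
        * intros x. change (Rabs (a * Re (l * x)%C + b * Im (l * x)%C) <=
            (Rabs a + Rabs b + 1) * (Cmod l + 1) * 2 * norm (x : R * R)).
          eapply Rle_trans; [apply E|]. rewrite Cmod_mult.
          assert (Cmod x <= 2 * norm (x : R * R)).
          { destruct x as [x1 x2].
            eapply Rle_trans; [apply Cmod_le_ReIm|]. simpl.
            generalize (norm_prod (K := R_AbsRing) (U := R_NormedModule) (V := R_NormedModule) x1 x2); intros [HH _].
            change (norm x1) with (Rabs x1) in HH; change (norm x2) with (Rabs x2) in HH.
            generalize (Rmax_l (Rabs x1) (Rabs x2)) (Rmax_r (Rabs x1) (Rabs x2)).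
            cbn in HH |- *. lra. }
          generalize (Rabs_pos a) (Rabs_pos b) (Cmod_ge_0 l) (Cmod_ge_0 x); intros.
          replace ((Rabs a + Rabs b + 1) * (Cmod l + 1) * 2 * norm (x : R * R)) with
           ((Rabs a + Rabs b + 1) * ((Cmod l + 1) * (2 * norm (x : R * R)))) by ring.
          apply Rmult_le_compat; try lra. { apply Rmult_le_pos; lra. }
          apply Rmult_le_compat; lra.
    - intros x Hx.
      assert (x = (p t, q t)).
      { symmetry; exact (is_filter_lim_locally_unique (V := prod_NormedModule _ R_NormedModule R_NormedModule) _ x Hx). }
      subst x. intros e.
      assert (HK : 0 < (Rabs a + Rabs b + 1) * 2) by (generalize (Rabs_pos a) (Rabs_pos b); lra).
      destruct (Hf (e / ((Rabs a + Rabs b + 1) * 2))) as [d [Hd Hw]].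
      { apply Rdiv_lt_0_compat; auto. apply cond_pos. }
      apply locally_C_Cmod. exists d; split; auto. intros w Hm. specialize (Hw w Hm).
      set (z := (p t, q t) : C) in *.
      change (Rabs (a * Re (f w) + b * Im (f w) - (a * Re (f z) + b * Im (f z)) -
         (a * Re (l * (w - z))%C + b * Im (l * (w - z))%C)) <= e * norm ((w - z)%C : R * R)).
      replace (a * Re (f w) + b * Im (f w) - (a * Re (f z) + b * Im (f z)) -
         (a * Re (l * (w - z))%C + b * Im (l * (w - z))%C)) with
        (a * Re (f w - f z - l * (w - z))%C + b * Im (f w - f z - l * (w - z))%C)
        by (clearbody z; unfold Re, Im, Cminus, Cplus, Copp, Cmult; simpl; ring).
      eapply Rle_trans; [apply E|].
      assert (Cmod (w - z) <= 2 * norm ((w-z)%C : R * R)).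
      { destruct (w - z)%C as [x1 x2].
            eapply Rle_trans; [apply Cmod_le_ReIm|]. simpl.
            generalize (norm_prod (K := R_AbsRing) (U := R_NormedModule) (V := R_NormedModule) x1 x2); intros [HH _].
            change (norm x1) with (Rabs x1) in HH; change (norm x2) with (Rabs x2) in HH.
            generalize (Rmax_l (Rabs x1) (Rabs x2)) (Rmax_r (Rabs x1) (Rabs x2)).
            cbn in HH |- *. lra. }
      apply Rle_trans with ((Rabs a + Rabs b + 1) * (e / ((Rabs a + Rabs b + 1) * 2) * (2 * norm ((w-z)%C : R * R)))).
      + generalize (Rabs_pos a) (Rabs_pos b); intros.
        apply Rmult_le_compat; try lra; [apply Cmod_ge_0|].
        eapply Rle_trans; [exact Hw|]. apply Rmult_le_compat_l; auto.
        apply Rlt_le, Rdiv_lt_0_compat; auto. apply cond_pos.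
      + apply Req_le; field. generalize (Rabs_pos a) (Rabs_pos b); lra. }
  assert (G : forall a b : R, is_derive (fun s => a * Re (f (p s, q s)) + b * Im (f (p s, q s))) t
     (a * Re (l * (dp, dq))%C + b * Im (l * (dp, dq))%C)).
  { intros a b. destruct (F a b) as [_ Fab].
    generalize (filterdiff_comp'_2 p q (fun x y => a * Re (f (x,y)) + b * Im (f (x,y))) t
     _ _ (fun x y => a * Re (l * (x,y))%C + b * Im (l * (x,y))%C) Hp Hq); intros K.
    eapply filterdiff_ext_lin; [apply K|].
    - eapply filterdiff_ext_lin; [eapply filterdiff_ext; [|exact Fab]|].
      + intros [x y]; reflexivity.
      + intros [x y]; reflexivity.
    - intros y; simpl. unfold scal; simpl; unfold mult; simpl; ring. }
  split.
  - replace (Re (l * (dp, dq))%C) with (1 * Re (l * (dp, dq))%C + 0 * Im (l * (dp, dq))%C) by ring.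
    eapply is_derive_ext; [|apply (G 1 0)]. intros s; simpl; ring.
  - replace (Im (l * (dp, dq))%C) with (0 * Re (l * (dp, dq))%C + 1 * Im (l * (dp, dq))%C) by ring.
    eapply is_derive_ext; [|apply (G 0 1)]. intros s; simpl; ring.
Qed.

(** * Limits of holomorphic functions and the exponential *)

Lemma Cmod_segment (a b : C) t r : 0 <= t <= 1 -> Cmod a <= r -> Cmod b <= r ->
  Cmod (a + RtoC t * (b - a))%C <= r.
Proof.
  intros Ht Ha Hb. replace (a + RtoC t * (b - a))%C with (RtoC (1 - t) * a + RtoC t * b)%C
    by (rewrite RtoC_minus; ring).
  eapply Rle_trans; [apply Cmod_triangle|]. rewrite !Cmod_mult, !Cmod_R, !Rabs_pos_eq by lra. nra.
Qed.

(** The real mean value theorem is applied to both coordinates along the segment; the two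
    intermediate points differ, and adding the two bounds costs the factor [2]. *)
Lemma Cmod_mvt (f f' : C -> C) (a b : C) M :
  (forall z, Cder f z (f' z)) ->
  (forall t, 0 <= t <= 1 -> Cmod (f' (a + RtoC t * (b - a))%C) <= M) ->
  Cmod (f b - f a)%C <= 2 * M * Cmod (b - a)%C.
Proof.
  intros Hf HM.
  set (p := fun t => Re a + t * (Re b - Re a)). set (q := fun t => Im a + t * (Im b - Im a)).
  assert (E : forall t, @eq C (p t, q t) (a + RtoC t * (b - a))%C).
  { intros t; unfold p, q; destruct a, b; unfold RtoC, Cmult, Cminus, Cplus, Copp; simpl; f_equal; ring. }
  assert (D : forall t, is_derive (fun s => Re (f (p s, q s))) t (Re (f' (p t, q t) * (b - a))%C) /\
                   is_derive (fun s => Im (f (p s, q s))) t (Im (f' (p t, q t) * (b - a))%C)).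
  { intros t. replace (b - a)%C with ((Re b - Re a, Im b - Im a) : C) by (destruct a, b; reflexivity).
    apply Cder_path; [apply Hf| |]; unfold p, q; auto_derive; auto; apply Rmult_1_l. }
  assert (E0 : @eq C (p 0, q 0) a) by (rewrite E; ring).
  assert (E1 : @eq C (p 1, q 1) b) by (rewrite E; ring).
  assert (B : forall t, 0 <= t <= 1 -> Cmod (f' (p t, q t) * (b - a))%C <= M * Cmod (b-a)%C).
  { intros t Ht. rewrite Cmod_mult, E. apply Rmult_le_compat_r; [apply Cmod_ge_0|now apply HM]. }
  assert (H1 : Rabs (Re (f b - f a)%C) <= M * Cmod (b-a)%C).
  { destruct (MVT_gen (fun s => Re (f (p s, q s))) 0 1 (fun t => Re (f' (p t, q t) * (b - a))%C)) as [c [Hc Ec]].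
    - intros x _; apply D.
    - intros x _. apply continuity_pt_filterlim, (ex_derive_continuous (fun s => Re (f (p s, q s)))).
      exact (ex_intro _ _ (proj1 (D x))).
    - rewrite E0, E1 in Ec. rewrite Rmin_left, Rmax_right in Hc by lra.
      replace (Re (f b - f a)%C) with (Re (f' (p c, q c) * (b - a))%C * (1 - 0)) by (rewrite <- Ec; reflexivity).
      rewrite Rminus_0_r, Rmult_1_r. eapply Rle_trans; [apply Rabs_Re|]. now apply B. }
  assert (H2 : Rabs (Im (f b - f a)%C) <= M * Cmod (b-a)%C).
  { destruct (MVT_gen (fun s => Im (f (p s, q s))) 0 1 (fun t => Im (f' (p t, q t) * (b - a))%C)) as [c [Hc Ec]].
    - intros x _; apply D.
    - intros x _. apply continuity_pt_filterlim, (ex_derive_continuous (fun s => Im (f (p s, q s)))).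
      exact (ex_intro _ _ (proj2 (D x))).
    - rewrite E0, E1 in Ec. rewrite Rmin_left, Rmax_right in Hc by lra.
      replace (Im (f b - f a)%C) with (Im (f' (p c, q c) * (b - a))%C * (1 - 0)) by (rewrite <- Ec; reflexivity).
      rewrite Rminus_0_r, Rmult_1_r. eapply Rle_trans; [apply Rabs_Im|]. now apply B. }
  eapply Rle_trans; [apply Cmod_le_ReIm|]. lra.
Qed.

(** The mean value inequality is used twice, for [f] minus its linear part at [a] and then for [f'],
    so its factor [2] appears squared. *)
Lemma Cmod_taylor (f f' f'' : C -> C) (a b : C) r M :
  (forall z, Cder f z (f' z)) -> (forall z, Cder f' z (f'' z)) ->
  (forall z, Cmod z <= r -> Cmod (f'' z) <= M) -> Cmod a <= r -> Cmod b <= r ->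
  Cmod (f b - f a - f' a * (b - a))%C <= 4 * M * Cmod (b - a)%C ^ 2.
Proof.
  intros Hf Hf' HM Ha Hb.
  assert (HM0 : 0 <= M) by (eapply Rle_trans; [apply Cmod_ge_0|apply (HM a Ha)]).
  generalize (Cmod_mvt (fun z => f z + - f' a * z)%C (fun z => f' z + - f' a * 1)%C a b (2 * M * Cmod (b - a)%C)).
  intros K.
  replace (f b - f a - f' a * (b - a))%C with (f b + - f' a * b - (f a + - f' a * a))%C by ring.
  eapply Rle_trans; [apply K|].
  - intros z. apply Cder_plus; [apply Hf|]. apply Cder_scal, Cder_id.
  - intros t Ht. replace (f' (a + t * (b - a)) + - f' a * 1)%C with (f' (a + t * (b - a)) - f' a)%C by ring.
    eapply Rle_trans; [apply (Cmod_mvt f' f'' a _ M Hf')|].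
    + intros s Hs. apply HM. replace (a + s * (a + t * (b - a) - a))%C with (a + RtoC (s * t) * (b - a))%C
       by (rewrite RtoC_mult; ring).
      apply Cmod_segment; auto. nra.
    + replace (a + t * (b - a) - a)%C with (RtoC t * (b - a))%C by ring.
      rewrite Cmod_mult, Cmod_R, Rabs_pos_eq by lra.
      apply Rmult_le_compat_l; [lra|]. generalize (Cmod_ge_0 (b-a)%C); nra.
  - right; ring.
Qed.

Lemma half_pow_pos k : 0 < (1/2)^k.
Proof. apply pow_lt; lra. Qed.

Lemma Rseq_geometric_limit (u : nat -> R) n :
  (forall k, (n <= k)%nat -> Rabs (u (S k) - u k) <= (1/2)^k) ->
  exists l, forall k, (n <= k)%nat -> Rabs (u k - l) <= 2 * (1/2)^k.
Proof.
  intros H.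
  (* Keeping the exact remainder of the geometric tail lets the induction on [j] close. *)
  assert (T : forall k j, (n <= k)%nat -> Rabs (u (k + j)%nat - u k) <= 2 * (1/2)^k - 2 * (1/2)^(k+j)).
  { intros k j Hk; induction j as [|j IH].
    - rewrite Nat.add_0_r, Rminus_diag, Rabs_R0; lra.
    - replace (u (k + S j)%nat - u k) with ((u (S (k + j)) - u (k + j)%nat) + (u (k+j)%nat - u k))
        by (rewrite Nat.add_succ_r; ring).
      eapply Rle_trans; [apply Rabs_triang|].
      specialize (H (k+j)%nat ltac:(lia)). rewrite Nat.add_succ_r; simpl pow. lra. }
  assert (L : ex_finite_lim_seq u).
  { apply ex_lim_seq_cauchy_corr. intros e.
    assert (Z : is_lim_seq (fun k => (1/2)^k) 0) by (apply is_lim_seq_geom; rewrite Rabs_pos_eq; lra).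
    assert (He4 : 0 < e/4) by (generalize (cond_pos e); lra).
    apply is_lim_seq_spec in Z. destruct (Z (mkposreal _ He4)) as [N HN]. simpl in HN.
    exists (max n N). intros i j Hi Hj.
    specialize (HN (max n N) ltac:(lia)). rewrite Rminus_0_r in HN.
    rewrite Rabs_pos_eq in HN by (apply Rlt_le, half_pow_pos).
    assert (Q : forall i, (max n N <= i)%nat -> Rabs (u i - u (max n N)) < e/2).
    { intros i' Hi'. replace i' with (max n N + (i' - max n N))%nat by lia.
      eapply Rle_lt_trans; [apply T; lia|].
      generalize (half_pow_pos (max n N + (i' - max n N))); lra. }
    replace (u i - u j) with ((u i - u (max n N)) - (u j - u (max n N))) by ring.
    eapply Rle_lt_trans; [apply Rabs_triang|]. rewrite Rabs_Ropp.
    generalize (Q i Hi) (Q j Hj); lra. }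
  destruct L as [l Hl]. exists l. intros k Hk.
  assert (Hl' : is_lim_seq (fun j => Rabs (u k - u (j + k)%nat)) (Rabs (u k - l))).
  { apply (is_lim_seq_abs (fun j => u k - u (j + k)%nat) (u k - l)).
    apply is_lim_seq_minus'; [apply is_lim_seq_const|]. now apply (is_lim_seq_incr_n u k l). }
  apply (is_lim_seq_le (fun j => Rabs (u k - u (j + k)%nat)) (fun _ => 2 * (1/2)^k) (Rabs (u k - l)) (2 * (1/2)^k)).
  - intros j. rewrite Rabs_minus_sym, Nat.add_comm. specialize (T k j Hk). generalize (half_pow_pos (k+j)); lra.
  - exact Hl'.
  - apply is_lim_seq_const.
Qed.

Lemma Cseq_geometric_limit (u : nat -> C) n :
  (forall k, (n <= k)%nat -> Cmod (u (S k) - u k)%C <= (1/2)^k) ->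
  exists l, forall k, (n <= k)%nat -> Cmod (u k - l)%C <= 4 * (1/2)^k.
Proof.
  intros H.
  destruct (Rseq_geometric_limit (fun k => Re (u k)) n) as [l1 H1].
  { intros k Hk. eapply Rle_trans; [|apply (H k Hk)]. apply (Rabs_Re (u (S k) - u k)%C). }
  destruct (Rseq_geometric_limit (fun k => Im (u k)) n) as [l2 H2].
  { intros k Hk. eapply Rle_trans; [|apply (H k Hk)]. apply (Rabs_Im (u (S k) - u k)%C). }
  exists (l1, l2). intros k Hk. eapply Rle_trans; [apply Cmod_le_ReIm|].
  specialize (H1 k Hk); specialize (H2 k Hk).
  change (Rabs (Re (u k) - l1) + Rabs (Im (u k) - l2) <= 4 * (1/2)^k). lra.
Qed.

(** Locally uniform convergence with its rate built in. The tail of the geometric series is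
    [2 * (1/2)^k], doubled by the passage through real and imaginary parts. *)
Definition disc_limit (f : nat -> C -> C) (F : C -> C) : Prop :=
  forall k z, Cmod z <= INR k -> Cmod (f k z - F z)%C <= 4 * (1/2)^k.

Lemma disc_limit_exists (f : nat -> C -> C) :
  (forall k z, Cmod z <= INR k -> Cmod (f (S k) z - f k z)%C <= (1/2)^k) ->
  exists F, disc_limit f F.
Proof.
  intros H.
  assert (E : forall z, exists l, forall k, Cmod z <= INR k -> Cmod (f k z - l)%C <= 4 * (1/2)^k).
  { intros z. destruct (nfloor_ex (Cmod z) (Cmod_ge_0 z)) as [n [Hn1 Hn2]].
    (* The sequence must start at the least [k] with [Cmod z <= INR k], since the estimate is
       claimed from that index on: it is [n] when [Cmod z] is the integer [n], and [S n]
       otherwise. *)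
    destruct (Rle_lt_dec (Cmod z) (INR n)) as [Hle|Hlt].
    - destruct (Cseq_geometric_limit (fun k => f k z) n) as [l Hl].
      + intros k Hk; apply H. eapply Rle_trans; [exact Hle|]. now apply le_INR.
      + exists l; intros k Hk; apply Hl. apply INR_le. lra.
    - destruct (Cseq_geometric_limit (fun k => f k z) (S n)) as [l Hl].
      + intros k Hk; apply H. apply le_INR in Hk. rewrite S_INR in Hk; lra.
      + exists l; intros k Hk; apply Hl. apply INR_lt; lra. }
  exists (fun z => proj1_sig (constructive_indefinite_description _ (E z))).
  intros k z Hz. destruct (constructive_indefinite_description _ (E z)) as [l Hl]; simpl. now apply Hl.
Qed.

(** For [k >= n] the second derivative of [f k - f n] is bounded by [4 + 4 = 8] on the disc of
    radius [n], uniformly in [k]. Taylor's estimate with constant [4 * 8 = 32] therefore passes to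
    the limit and controls [F - f n] near [z], while [f n] is itself differentiable. Each use
    consumes two derivatives beyond the function that is differentiated. *)
Lemma disc_limit_Cder (f f1 f2 : nat -> C -> C) F F1 F2 :
  (forall k z, Cder (f k) z (f1 k z)) -> (forall k z, Cder (f1 k) z (f2 k z)) ->
  disc_limit f F -> disc_limit f1 F1 -> disc_limit f2 F2 ->
  forall z, Cder F z (F1 z).
Proof.
  intros D D1 L L1 L2 z.
  (* The shift by [2] puts the whole unit disc around [z] inside the disc of radius [n]. *)
  destruct (nfloor_ex (Cmod z) (Cmod_ge_0 z)) as [n0 [_ Hn]]. set (n := (n0 + 2)%nat).
  assert (Hz : Cmod z + 1 <= INR n) by (unfold n; rewrite plus_INR; simpl; lra).
  assert (K : forall w, Cmod (w - z)%C < 1 ->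
    Cmod ((F w - f n w) - (F z - f n z) - (F1 z - f1 n z) * (w - z))%C <= 32 * Cmod (w - z)%C ^ 2).
  { intros w Hw.
    assert (Hw' : Cmod w <= INR n).
    { replace w with (z + (w - z))%C by ring. eapply Rle_trans; [apply Cmod_triangle|lra]. }
    apply le_epsilon. intros e He.
    assert (Z : is_lim_seq (fun k => (1/2)^k) 0) by (apply is_lim_seq_geom; rewrite Rabs_pos_eq; lra).
    (* Three errors, at [w], at [z] and in the derivative, of at most [4 * (1/2)^k] each. *)
    assert (He4 : 0 < e/12) by lra.
    apply is_lim_seq_spec in Z. destruct (Z (mkposreal _ He4)) as [N HN]. simpl in HN.
    set (k := max n N). specialize (HN k ltac:(lia)). rewrite Rminus_0_r in HN.
    rewrite Rabs_pos_eq in HN by (apply Rlt_le, half_pow_pos).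
    assert (Hk : INR n <= INR k) by (apply le_INR; lia).
    generalize (Cmod_taylor (fun z => f k z + - 1 * f n z)%C (fun z => f1 k z + - 1 * f1 n z)%C
      (fun z => f2 k z + - 1 * f2 n z)%C z w (INR n) 8); intros T.
    replace ((F w - f n w) - (F z - f n z) - (F1 z - f1 n z) * (w - z))%C with
      ((f k w + - 1 * f n w - (f k z + - 1 * f n z) - (f1 k z + - 1 * f1 n z) * (w - z))
       + (- (f k w - F w) + (f k z - F z) + (f1 k z - F1 z) * (w - z)))%C by ring.
    eapply Rle_trans; [apply Cmod_triangle|]. apply Rplus_le_compat.
    - replace 32 with (4 * 8) by ring. apply T.
      + intros x; apply Cder_plus; [apply D|apply Cder_scal, D].
      + intros x; apply Cder_plus; [apply D1|apply Cder_scal, D1].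
      + intros x Hx. replace (f2 k x + - 1 * f2 n x)%C with ((f2 k x - F2 x) + - (f2 n x - F2 x))%C by ring.
        eapply Rle_trans; [apply Cmod_triangle|]. rewrite Cmod_opp.
        generalize (L2 k x ltac:(lra)) (L2 n x Hx). 
        assert (P : forall m, (1/2)^m <= 1).
        { intros m. assert (Hp := pow_incr (1/2) 1 m). rewrite pow1 in Hp. apply Hp; lra. }
        generalize (P k) (P n); lra.
      + lra.
      + exact Hw'.
    - eapply Rle_trans; [apply Cmod_triangle|].
      eapply Rle_trans; [apply Rplus_le_compat_r, Cmod_triangle|].
      rewrite Cmod_opp, Cmod_mult.
      generalize (L k w ltac:(lra)) (L k z ltac:(lra)) (L1 k z ltac:(lra)) (Cmod_ge_0 (f1 k z - F1 z)%C) (Cmod_ge_0 (w - z)%C).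
      intros. assert (Cmod (f1 k z - F1 z)%C * Cmod (w - z)%C <= 4 * (1/2)^k * 1).
      { apply Rmult_le_compat; lra. }
      lra. }
  intros e He. destruct (D n z (e/2)) as [d [Hd Hw]]; [lra|].
  exists (Rmin 1 (Rmin d (e / 64))); split.
  { repeat apply Rmin_pos; lra. }
  intros w Hm.
  assert (H1 := Rlt_le_trans _ _ _ Hm (Rmin_l _ _)).
  assert (H2 := Rlt_le_trans _ _ _ (Rlt_le_trans _ _ _ Hm (Rmin_r _ _)) (Rmin_l _ _)).
  assert (H3 := Rlt_le_trans _ _ _ (Rlt_le_trans _ _ _ Hm (Rmin_r _ _)) (Rmin_r _ _)).
  specialize (K w H1). specialize (Hw w H2).
  replace (F w - F z - F1 z * (w - z))%C with
    ((F w - f n w - (F z - f n z) - (F1 z - f1 n z) * (w - z)) + (f n w - f n z - f1 n z * (w - z)))%C by ring.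
  eapply Rle_trans; [apply Cmod_triangle|].
  generalize (Cmod_ge_0 (w - z)%C); intros. nra.
Qed.

(** * The complex exponential *)

Definition cexp (z : C) : C := pol (exp (Re z)) (Im z).

Lemma Cmod_cexp z : Cmod (cexp z) = exp (Re z).
Proof. apply Cmod_pol, Rlt_le, exp_pos. Qed.
Lemma cexp_plus z w : cexp (z + w)%C = (cexp z * cexp w)%C.
Proof.
  unfold cexp, pol, Re, Im; simpl. rewrite exp_plus, cos_plus, sin_plus.
  unfold Cmult; simpl; f_equal; ring.
Qed.
Lemma cexp_0 : cexp 0%C = 1%C.
Proof. unfold cexp, pol; simpl; rewrite exp_0, cos_0, sin_0. unfold RtoC; f_equal; ring. Qed.

Lemma Rabs_sin_le x : Rabs (sin x) <= Rabs x.
Proof.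
  destruct (MVT_abs sin cos 0 x) as [c [Hc _]].
  - intros c _; apply derivable_pt_lim_sin.
  - rewrite sin_0, !Rminus_0_r in Hc. rewrite Hc.
    assert (Rabs (cos c) <= 1) by (apply Rabs_le, COS_bound). generalize (Rabs_pos x); nra.
Qed.
Lemma one_minus_cos_le x : 0 <= 1 - cos x <= x ^ 2 / 2.
Proof.
  split; [generalize (COS_bound x); lra|].
  replace x with (2 * (x/2)) at 1 by field. rewrite cos_2a_sin.
  assert (H := Rabs_sin_le (x/2)). apply Rsqr_le_abs_1 in H. unfold Rsqr in H. lra.
Qed.
Lemma sin_taylor x : Rabs x <= 1 -> Rabs (sin x - x) <= x ^ 2.
Proof.
  intros Hx.
  destruct (MVT_abs (fun x => sin x - x) (fun x => cos x - 1) 0 x) as [c [Hc Hb]].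
  - intros c _. apply derivable_pt_lim_minus; [apply derivable_pt_lim_sin|apply derivable_pt_lim_id].
  - rewrite sin_0, !Rminus_0_r in Hc. rewrite Hc.
    assert (Hcx : Rabs c <= Rabs x).
    { revert Hb. unfold Rmin, Rmax; destruct (Rle_dec 0 x); intros; unfold Rabs;
      repeat destruct Rcase_abs; lra. }
    assert (H := one_minus_cos_le c). rewrite Rabs_minus_sym, (Rabs_pos_eq (1 - cos c)) by lra.
    assert (Hc2 : c ^ 2 <= Rabs x ^ 2) by (rewrite <- (pow2_abs c); apply pow_incr; split; [apply Rabs_pos|auto]).
    rewrite <- (pow2_abs x). generalize (Rabs_pos x); nra.
Qed.
Lemma exp_taylor x : Rabs x <= 1/2 -> 0 <= exp x - 1 - x <= 2 * x ^ 2.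
Proof.
  intros Hx. apply Rabs_le_between in Hx. split; [generalize (exp_ineq1_le x); lra|].
  assert (H : exp x <= / (1 - x)).
  { replace x with (- - x) at 1 by ring. rewrite exp_Ropp. apply Rinv_le_contravar; [lra|].
    generalize (exp_ineq1_le (-x)); lra. }
  assert (/ (1 - x) <= 1 + x + 2 * x ^ 2).
  { apply Rmult_le_reg_l with (1 - x); [lra|]. rewrite Rinv_r by lra. nra. }
  lra.
Qed.

Lemma cexp_taylor h : Cmod h <= 1/2 -> Cmod (cexp h - 1 - h)%C <= 8 * Cmod h ^ 2.
Proof.
  intros Hh. destruct h as [x y].
  assert (Hx := Rabs_Re (x, y)); assert (Hy := Rabs_Im (x, y)).
  eapply Rle_trans; [apply Cmod_le_ReIm|]. unfold cexp, pol.
  rewrite Cmod_sqr. set (m := Cmod (x,y)) in *. simpl in *.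
  assert (Ex := exp_taylor x ltac:(lra)).
  assert (Sy := sin_taylor y ltac:(lra)). assert (Cy := one_minus_cos_le y).
  assert (Cb := COS_bound y). assert (Sb := Rabs_sin_le y).
  replace (exp x * cos y + - (1) + -x) with ((exp x - 1 - x) * cos y + - ((1 + x) * (1 - cos y))) by ring.
  replace (exp x * sin y + -0 + -y) with ((exp x - 1 - x) * sin y + x * sin y + (sin y - y)) by ring.
  assert (Ax : Rabs x <= 1/2) by lra. assert (Ay : Rabs y <= 1/2) by lra.
  assert (P1 : Rabs ((exp x - 1 - x) * cos y) <= 2 * x^2).
  { rewrite Rabs_mult, (Rabs_pos_eq (exp x - 1 - x)) by lra.
    assert (Rabs (cos y) <= 1) by (apply Rabs_le; lra). generalize (Rabs_pos (cos y)); nra. }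
  assert (P2 : Rabs (- ((1 + x) * (1 - cos y))) <= y ^ 2).
  { rewrite Rabs_Ropp. apply Rabs_le_between in Ax. rewrite Rabs_pos_eq by nra. nra. }
  assert (P3 : Rabs ((exp x - 1 - x) * sin y) <= 2 * x^2).
  { rewrite Rabs_mult, (Rabs_pos_eq (exp x - 1 - x)) by lra.
    generalize (Rabs_pos (sin y)); nra. }
  assert (P4 : Rabs (x * sin y) <= x^2 + y^2).
  { rewrite Rabs_mult, <- (pow2_abs x), <- (pow2_abs y). 
    apply Rle_trans with (Rabs x * Rabs y); [apply Rmult_le_compat_l; [apply Rabs_pos|auto]|].
    generalize (Rabs_pos x) (Rabs_pos y); nra. }
  assert (Q1 := Rabs_triang ((exp x - 1 - x) * cos y) (- ((1 + x) * (1 - cos y)))).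
  assert (Q2 := Rabs_triang ((exp x - 1 - x) * sin y + x * sin y) (sin y - y)).
  assert (Q3 := Rabs_triang ((exp x - 1 - x) * sin y) (x * sin y)).
  change (x * (x * 1)) with (x^2). change (y * (y*1)) with (y^2).
  generalize (pow2_ge_0 x) (pow2_ge_0 y). lra.
Qed.

Lemma Cder_cexp z : Cder cexp z (cexp z).
Proof.
  intros e He. set (M := Cmod (cexp z)). assert (HM : 0 <= M) by apply Cmod_ge_0.
  exists (Rmin (1/2) (e / (8 * (M + 1)))); split.
  { apply Rmin_pos; [lra|]. apply Rdiv_lt_0_compat; lra. }
  intros w Hw.
  assert (H1 := Rlt_le_trans _ _ _ Hw (Rmin_l _ _)). assert (H2 := Rlt_le_trans _ _ _ Hw (Rmin_r _ _)).
  replace (cexp w) with (cexp z * cexp (w - z))%C by (rewrite <- cexp_plus; f_equal; ring).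
  replace (cexp z * cexp (w - z) - cexp z - cexp z * (w - z))%C with
    (cexp z * (cexp (w - z) - 1 - (w - z)))%C by ring.
  rewrite Cmod_mult. fold M. assert (T := cexp_taylor (w-z)%C ltac:(lra)).
  assert (H3 : 8 * (M+1) * Cmod (w-z)%C <= e).
  { apply Rmult_le_reg_r with (/ (8 * (M+1))); [apply Rinv_0_lt_compat; lra|].
    replace (8 * (M + 1) * Cmod (w - z)%C * / (8 * (M + 1))) with (Cmod (w-z)%C) by (field; lra).
    unfold Rdiv in H2; lra. }
  generalize (Cmod_ge_0 (w-z)%C). intros.
  apply Rle_trans with ((M+1) * (8 * Cmod (w - z)%C ^ 2)).
  - apply Rmult_le_compat; try lra. apply Cmod_ge_0.
  - replace ((M+1) * (8 * Cmod (w - z)%C ^ 2)) with (8 * (M+1) * Cmod (w-z)%C * Cmod (w-z)%C) by ring.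
    apply Rmult_le_compat_r; auto.
Qed.

(** A function together with all its derivatives as data, so that the derivatives of a limit can be
    taken as limits of the derivatives. *)
Definition jet := nat -> C -> C.
Definition isjet (F : jet) : Prop := forall m z, Cder (F m) z (F (S m) z).

Definition jadd (F G : jet) : jet := fun m z => (F m z + G m z)%C.
Lemma isjet_add F G : isjet F -> isjet G -> isjet (jadd F G).
Proof. intros HF HG m z; apply Cder_plus; auto. Qed.
Definition jzero : jet := fun _ _ => 0%C.
Lemma isjet_zero : isjet jzero.
Proof. intros m z; apply Cder_const. Qed.

(** The derivatives of [v * exp (N (z - c))]. For large [N] the real number [c] is a threshold for
    [Re z]: exponentially small to its left, exponentially large to its right. *)
Definition jexp (v : C) (N c : R) : jet :=
  fun m z => (v * RtoC (N ^ m) * cexp (RtoC N * (z - RtoC c)))%C.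

Lemma Cder_cexp_affine N c z :
  Cder (fun w => cexp (RtoC N * (w - RtoC c)))%C z (RtoC N * cexp (RtoC N * (z - RtoC c)))%C.
Proof.
  intros e He. set (K := Rabs N + 1). assert (HK : 0 < K) by (unfold K; generalize (Rabs_pos N); lra).
  destruct (Cder_cexp (RtoC N * (z - RtoC c))%C (e / K)) as [d [Hd Hw]].
  { now apply Rdiv_lt_0_compat. }
  exists (d / K); split; [now apply Rdiv_lt_0_compat|].
  intros w Hm. 
  assert (E : (RtoC N * (w - RtoC c) - RtoC N * (z - RtoC c))%C = (RtoC N * (w - z))%C) by ring.
  specialize (Hw (RtoC N * (w - RtoC c))%C). rewrite E in Hw.
  rewrite Cmod_mult, Cmod_R in Hw.
  assert (B : Rabs N * Cmod (w - z)%C <= K * Cmod (w-z)%C).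
  { apply Rmult_le_compat_r; [apply Cmod_ge_0|unfold K; lra]. }
  assert (H1 : K * Cmod (w - z)%C < d).
  { apply Rmult_lt_reg_r with (/K); [now apply Rinv_0_lt_compat|].
    replace (K * Cmod (w - z)%C * / K) with (Cmod (w-z)%C) by (field; lra). exact Hm. }
  specialize (Hw ltac:(lra)).
  replace (RtoC N * cexp (RtoC N * (z - RtoC c)) * (w - z))%C with
    (cexp (RtoC N * (z - RtoC c)) * (RtoC N * (w - z)))%C by ring.
  eapply Rle_trans; [exact Hw|].
  apply Rle_trans with (e / K * (K * Cmod (w-z)%C)).
  - apply Rmult_le_compat_l; auto. now apply Rlt_le, Rdiv_lt_0_compat.
  - right; field; lra.
Qed.

Lemma isjet_exp v N c : isjet (jexp v N c).
Proof.
  intros m z. unfold jexp.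
  replace (v * RtoC (N ^ S m) * cexp (RtoC N * (z - RtoC c)))%C with
    (v * RtoC (N ^ m) * (RtoC N * cexp (RtoC N * (z - RtoC c))))%C.
  - apply Cder_scal, Cder_cexp_affine.
  - simpl pow. rewrite RtoC_mult. ring.
Qed.

Lemma Cmod_jexp v N c m z : 0 <= N ->
  Cmod (jexp v N c m z) = Cmod v * N ^ m * exp (N * (Re z - c)).
Proof.
  intros HN. unfold jexp. rewrite !Cmod_mult, Cmod_R, Cmod_cexp, Rabs_pos_eq by (now apply pow_le).
  f_equal. f_equal. destruct z; simpl; ring.
Qed.

(** * Integrals over discs and circles *)

Lemma continuous_ball {U : UniformSpace} (f : U -> R) x e :
  continuous f x -> 0 < e -> exists d : posreal, forall y, ball x d y -> Rabs (f y - f x) < e.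
Proof.
  intros H He.
  assert (L : locally (f x) (fun y => Rabs (y - f x) < e)).
  { exists (mkposreal e He); intros y Hy; exact Hy. }
  destruct (H _ L) as [d Hd]. exists d. exact Hd.
Qed.

Lemma continuous_of_ball {U : UniformSpace} (f : U -> R) x :
  (forall e, 0 < e -> exists d : posreal, forall y, ball x d y -> Rabs (f y - f x) < e) ->
  continuous f x.
Proof.
  intros H P [e He]. destruct (H e (cond_pos e)) as [d Hd]. exists d. intros y Hy. apply He, Hd, Hy.
Qed.

Lemma ex_RInt_cont (f : R -> R) a b : (forall x, continuous f x) -> ex_RInt f a b.
Proof. intros H; apply (ex_RInt_continuous (V := R_CompleteNormedModule)); auto. Qed.

Section Param.
Context {U : UniformSpace}.
Variable f : U -> R -> R.
Hypothesis Hf : forall p t, continuous (fun q : U * R => f (fst q) (snd q)) (p, t).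

Lemma continuous_slice p t : continuous (f p) t.
Proof.
  apply (continuous_comp (fun t => (p, t)) (fun q : U * R => f (fst q) (snd q))); [|apply Hf].
  apply ct_pair; [apply continuous_const|apply continuous_id].
Qed.

(** The parameter space is an arbitrary uniform space, so uniformity in [t] comes from the
    compactness of [[a, b]] alone. *)
Lemma continuous_RInt_param a b p0 : a <= b -> continuous (fun p => RInt (f p) a b) p0.
Proof.
  intros Hab. apply continuous_of_ball. intros e He.
  set (e' := e / (4 * (b - a + 1))).
  assert (He' : 0 < e') by (apply Rdiv_lt_0_compat; lra).
  assert (X : forall t, exists d : posreal, forall q, ball (p0, t) d q -> Rabs (f (fst q) (snd q) - f p0 t) < e').
  { intros t. apply (continuous_ball (fun q : U * R => f (fst q) (snd q))); auto. }
  set (delta := fun t => proj1_sig (constructive_indefinite_description _ (X t))).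
  destruct (compactness_value_1d a b delta) as [d Hd].
  exists d. intros p Hp.
  (* Both values are compared with [f p0 u] at a nearby centre [u], hence [2 * e']. Compactness
     provides [u] only under a double negation, which is harmless for an inequality. *)
  assert (B : forall t, a <= t <= b -> Rabs (f p t - f p0 t) <= 2 * e').
  { intros t Ht. apply NNPP; intros Hn. apply (Hd t Ht). intros [u [Hu [Htu Hdu]]]. apply Hn.
    unfold delta in Htu, Hdu. destruct (constructive_indefinite_description _ (X u)) as [du Hu']; simpl in *.
    assert (K1 := Hu' (p, t)). assert (K2 := Hu' (p0, t)). simpl in K1, K2.
    assert (Htu' : ball u du t) by exact Htu.
    specialize (K1 (conj (ball_le _ _ _ Hdu _ Hp) Htu')). specialize (K2 (conj (ball_center _ _) Htu')).
    replace (f p t - f p0 t) with ((f p t - f p0 u) - (f p0 t - f p0 u)) by ring.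
    eapply Rle_trans; [apply Rabs_triang|]. rewrite Rabs_Ropp. lra. }
  assert (E : RInt (f p) a b - RInt (f p0) a b = RInt (fun t => f p t - f p0 t) a b).
  { symmetry; apply (RInt_minus (V := R_CompleteNormedModule)); apply ex_RInt_cont; intros; apply continuous_slice. }
  rewrite E. eapply Rle_lt_trans; [apply (abs_RInt_le_const _ _ _ (2 * e')); auto|].
  - apply ex_RInt_cont; intros. apply ct_minus; apply continuous_slice.
  - unfold e'. replace ((b - a) * (2 * (e / (4 * (b - a + 1))))) with (e * ((b - a) / (2 * (b - a + 1)))) by (field; lra).
    rewrite <- (Rmult_1_r e) at 2. apply Rmult_lt_compat_l; auto.
    apply Rmult_lt_reg_r with (2 * (b - a + 1)); [lra|].
    unfold Rdiv; rewrite Rmult_assoc, Rinv_l; lra.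
Qed.
End Param.

Lemma RInt_pos_sub (f : R -> R) a b c d : (forall x, continuous f x) ->
  a <= c -> c < d -> d <= b -> (forall x, a <= x <= b -> 0 <= f x) ->
  (forall x, c < x < d -> 0 < f x) -> 0 < RInt f a b.
Proof.
  intros Hc H1 H2 H3 H4 H5.
  rewrite <- (RInt_Chasles (V := R_CompleteNormedModule) f a c b) by (now apply ex_RInt_cont).
  rewrite <- (RInt_Chasles (V := R_CompleteNormedModule) f c d b) by (now apply ex_RInt_cont).
  change (0 < RInt f a c + (RInt f c d + RInt f d b)).
  assert (0 <= RInt f a c) by (apply RInt_ge_0; auto using ex_RInt_cont; intros; apply H4; lra).
  assert (0 <= RInt f d b) by (apply RInt_ge_0; auto using ex_RInt_cont; intros; apply H4; lra).
  assert (0 < RInt f c d) by (apply RInt_gt_0; auto). lra.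
Qed.

Definition cont (f : C -> R) : Prop := forall z : C, continuous f z.

(** For [s >= 0] this is the integral over the circle against arc length. It plays two roles: for
    [sqrt (dens g)] it is the boundary length, and for any [h] it is the radial derivative of the
    area integral. *)
Definition rcirc (h : C -> R) (s : R) : R := RInt (fun th => h (pol s th) * s) 0 (2 * PI).
Definition rdisc (h : C -> R) (t : R) : R := RInt (rcirc h) 0 t.
Definition rdisc_log (h : C -> R) (r : R) : R := RInt (fun t => rdisc h t / t) 0 r.
Definition rcirc_log (h : C -> R) (r : R) : R := RInt (fun t => rcirc h t / t) 0 r.

Lemma two_PI_pos : 0 < 2 * PI.
Proof. generalize PI_RGT_0; lra. Qed.

Lemma cont_polar (h : C -> R) : cont h -> forall s th,
  continuous (fun q : R * R => h (pol (fst q) (snd q))) (s, th).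
Proof.
  intros H s th. apply (continuous_comp (fun q : R * R => pol (fst q) (snd q)) h); [|apply H].
  apply ct_pol; [apply ct_fst|apply ct_snd]; apply continuous_id.
Qed.

Lemma cont_polar_slice (h : C -> R) : cont h -> forall s th, continuous (fun th => h (pol s th)) th.
Proof. intros H s th. exact (continuous_slice (fun s th => h (pol s th)) (cont_polar h H) s th). Qed.

Lemma rcirc_cont h : cont h -> forall s, continuous (rcirc h) s.
Proof.
  intros H s. apply (continuous_RInt_param (fun s th => h (pol s th) * s)).
  - intros p t. apply ct_mult; [now apply cont_polar|]. apply ct_fst, continuous_id.
  - generalize two_PI_pos; lra.
Qed.

Lemma rdisc_derive h : cont h -> forall t, is_derive (rdisc h) t (rcirc h t).
Proof.
  intros H t. apply (is_derive_RInt (rcirc h) (rdisc h) 0 t).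
  - exists (mkposreal 1 Rlt_0_1). intros y _. apply (RInt_correct (V := R_CompleteNormedModule) (rcirc h) 0 y).
    apply ex_RInt_cont. now apply rcirc_cont.
  - now apply rcirc_cont.
Qed.

(* At [t = 0] the quotient is the junk value [0 * / 0 = 0], which is also its limit. *)
Lemma rdisc_over_cont h : cont h -> forall t, continuous (fun t => rdisc h t / t) t.
Proof.
  intros H t. destruct (Req_dec t 0) as [->|Ht].
  - assert (D := rdisc_derive h H 0). apply is_derive_Reals in D.
    assert (E0 : rcirc h 0 = 0).
    { unfold rcirc. rewrite (RInt_ext _ (fun _ => 0)).
      - rewrite RInt_const. apply Rmult_0_r.
      - intros; apply Rmult_0_r. }
    assert (E1 : rdisc h 0 = 0) by (apply (RInt_point (V := R_CompleteNormedModule))).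
    rewrite E0 in D. apply continuous_of_ball. intros e He. destruct (D e He) as [d Hd].
    exists d. intros y Hy. unfold Rdiv at 2. rewrite E1, Rmult_0_l, Rminus_0_r.
    destruct (Req_dec y 0) as [->|Hy0].
    + rewrite E1. unfold Rdiv. rewrite Rmult_0_l, Rabs_R0; auto.
    + specialize (Hd y Hy0). rewrite Rplus_0_l, E1, !Rminus_0_r in Hd. apply Hd.
      assert (Hy' : Rabs (y - 0) < d) by exact Hy. now rewrite Rminus_0_r in Hy'.
  - apply ct_mult.
    + apply (ex_derive_continuous (rdisc h)). exists (rcirc h t). now apply rdisc_derive.
    + apply (ct_comp Rinv (fun t => t)); [apply continuous_id|].
      apply continuity_pt_inv; auto. apply derivable_continuous_pt, derivable_pt_id.
Qed.

Lemma avg_cont h : cont h -> forall t, continuous (fun t => RInt (fun th => h (pol t th)) 0 (2 * PI)) t.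
Proof.
  intros H t. apply (continuous_RInt_param (fun s th => h (pol s th))).
  - now apply cont_polar.
  - generalize two_PI_pos; lra.
Qed.

(** Away from [t = 0] the division cancels the arc length factor. At [t = 0] the quotient has the
    default value [0] instead of its limit [2 * PI * h 0]; the right-hand integrand is continuous
    there, and the integral does not see the difference. *)
Lemma rcirc_log_eq h r : cont h ->
  rcirc_log h r = RInt (fun t => RInt (fun th => h (pol t th)) 0 (2 * PI)) 0 r.
Proof.
  intros H. apply RInt_ext. intros t Ht. unfold rcirc.
  assert (Ht0 : t <> 0) by (unfold Rmin, Rmax in Ht; destruct (Rle_dec 0 r); lra).
  rewrite (RInt_ext _ (fun th => scal t (h (pol t th)))).
  - rewrite (RInt_scal (V := R_CompleteNormedModule)).
    + unfold scal; simpl; unfold mult; simpl. field; auto.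
    + apply ex_RInt_cont. intros; now apply cont_polar_slice.
  - intros; apply Rmult_comm.
Qed.

(** A positive linear functional carried by the closed disc of radius [r]: functions are compared on
    that disc only, which is where the curve will be controlled. *)
Record posfun (r : R) (L : (C -> R) -> R) : Prop := PosFun {
  pf_plus : forall f g, cont f -> cont g -> L (fun z => f z + g z) = L f + L g;
  pf_scal : forall c f, cont f -> L (fun z => c * f z) = c * L f;
  pf_le : forall f g, cont f -> cont g -> (forall z, Cmod z <= r -> f z <= g z) -> L f <= L g }.

Lemma rcirc_posfun r : 0 <= r -> posfun r (fun h => rcirc h r).
Proof.
  intros Hr.
  assert (X : forall f, cont f -> ex_RInt (fun th => f (pol r th) * r) 0 (2 * PI)).
  { intros f Hf; apply ex_RInt_cont; intros. apply ct_mult; [now apply cont_polar_slice|apply continuous_const]. }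
  split; unfold rcirc.
  - intros f g Hf Hg. rewrite <- (RInt_plus (V := R_CompleteNormedModule)) by auto.
    apply RInt_ext; intros; unfold plus; simpl; ring.
  - intros c f Hf. rewrite <- (RInt_scal (V := R_CompleteNormedModule)) by auto.
    apply RInt_ext; intros; unfold scal; simpl; unfold mult; simpl; ring.
  - intros f g Hf Hg H. apply RInt_le; auto; [generalize two_PI_pos; lra|].
    intros x _. apply Rmult_le_compat_r; auto. apply H. rewrite Cmod_pol; lra.
Qed.

Lemma posfun_RInt r (F : (C -> R) -> R -> R) : 0 <= r ->
  (forall f, cont f -> forall t, continuous (F f) t) ->
  (forall t, 0 < t < r -> posfun t (fun h => F h t)) ->
  posfun r (fun h => RInt (F h) 0 r).
Proof.
  intros Hr Hc HF.
  assert (Ex : forall t, Rmin 0 r < t < Rmax 0 r -> posfun t (fun h => F h t)).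
  { intros t Ht; rewrite Rmin_left, Rmax_right in Ht by lra; auto. }
  split.
  - intros f g Hf Hg. rewrite <- (RInt_plus (V := R_CompleteNormedModule)) by (apply ex_RInt_cont; auto).
    apply RInt_ext; intros t Ht. apply (pf_plus _ _ (Ex t Ht)); auto.
  - intros c f Hf. rewrite <- (RInt_scal (V := R_CompleteNormedModule)) by (apply ex_RInt_cont; auto).
    apply RInt_ext; intros t Ht. apply (pf_scal _ _ (Ex t Ht)); auto.
  - intros f g Hf Hg H. apply RInt_le; auto; try (apply ex_RInt_cont; auto).
    intros t Ht. apply (pf_le _ _ (HF t Ht)); auto. intros z Hz; apply H; lra.
Qed.

Lemma rdisc_posfun r : 0 <= r -> posfun r (fun h => rdisc h r).
Proof.
  intros Hr. apply (posfun_RInt r rcirc); auto.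
  - intros; now apply rcirc_cont.
  - intros; apply rcirc_posfun; lra.
Qed.

Lemma rdisc_log_posfun r : 0 <= r -> posfun r (fun h => rdisc_log h r).
Proof.
  intros Hr. apply (posfun_RInt r (fun h t => rdisc h t / t)); auto.
  - intros; now apply rdisc_over_cont.
  - intros t Ht. destruct (rdisc_posfun t) as [P1 P2 P3]; [lra|]. split.
    + intros; rewrite P1 by auto. field; lra.
    + intros; rewrite P2 by auto. field; lra.
    + intros. apply Rmult_le_compat_r; [apply Rlt_le, Rinv_0_lt_compat; lra|]. now apply P3.
Qed.

Lemma rcirc_log_posfun r : 0 <= r -> posfun r (fun h => rcirc_log h r).
Proof.
  intros Hr.
  assert (P : posfun r (fun h => RInt (fun t => RInt (fun th => h (pol t th)) 0 (2 * PI)) 0 r)).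
  { apply (posfun_RInt r (fun h t => RInt (fun th => h (pol t th)) 0 (2 * PI))); auto.
    - intros; now apply avg_cont.
    - intros t Ht. assert (X : forall f, cont f -> ex_RInt (fun th => f (pol t th)) 0 (2 * PI)).
      { intros f Hf; apply ex_RInt_cont; intros; now apply cont_polar_slice. }
      split.
      + intros. now rewrite <- (RInt_plus (V := R_CompleteNormedModule)) by auto.
      + intros. now rewrite <- (RInt_scal (V := R_CompleteNormedModule)) by auto.
      + intros. apply RInt_le; auto; [generalize two_PI_pos; lra|].
        intros x _. apply H1. rewrite Cmod_pol; lra. }
  destruct P as [P1 P2 P3]; split.
  - intros. rewrite !rcirc_log_eq; auto. intros z; now apply ct_plus.
  - intros. rewrite !rcirc_log_eq; auto. intros z; apply ct_mult; auto using continuous_const.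
  - intros. rewrite !rcirc_log_eq; auto.
Qed.

(** Positivity at the single boundary point [z = r] spreads to a polar box. The exponentials
    concentrate at this point, and the lemma supplies the mass available there. *)
Lemma rdisc_pos h r : cont h -> (forall z, 0 <= h z) -> 0 < r -> 0 < h (RtoC r) ->
  0 < rdisc h r /\ 0 < rdisc_log h r.
Proof.
  intros Hc Hn Hr Hp.
  assert (E : pol r 0 = RtoC r) by (unfold pol, RtoC; rewrite cos_0, sin_0; f_equal; ring).
  destruct (continuous_ball _ _ (h (RtoC r)) (cont_polar h Hc r 0) Hp) as [d Hd].
  simpl in Hd. rewrite E in Hd.
  (* [r/2] keeps the radii of the box positive, and [1] keeps its angles below [2 * PI]. *)
  set (x := Rmin d (Rmin (r/2) 1)).
  assert (Hx : 0 < x) by (repeat apply Rmin_pos; try lra; apply cond_pos).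
  assert (Hx1 : x <= d) by apply Rmin_l.
  assert (Hx2 : x <= r/2) by (eapply Rle_trans; [apply Rmin_r|apply Rmin_l]).
  assert (Hx3 : x <= 1) by (eapply Rle_trans; [apply Rmin_r|apply Rmin_r]).
  assert (Hpos : forall s th, r - x < s < r + x -> 0 < th < x -> 0 < h (pol s th)).
  { intros s th Hs Ht. specialize (Hd (s, th)). simpl in Hd.
    assert (Hb : ball (r, 0) d (s, th)).
    { split; simpl; [change (Rabs (s - r) < d)|change (Rabs (th - 0) < d)]; apply Rabs_def1; lra. }
    specialize (Hd Hb). apply Rabs_def2 in Hd. lra. }
  assert (Hc1 : forall s, 0 <= s -> 0 <= rcirc h s).
  { intros s Hs. apply RInt_ge_0; [generalize two_PI_pos; lra| |].
    - apply ex_RInt_cont; intros; apply ct_mult; [now apply cont_polar_slice|apply continuous_const].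
    - intros; apply Rmult_le_pos; auto. }
  assert (Hc2 : forall s, r - x < s < r + x -> 0 < rcirc h s).
  { intros s Hs. apply (RInt_pos_sub _ _ _ 0 x); try lra.
    - intros; apply ct_mult; [now apply cont_polar_slice|apply continuous_const].
    - generalize PI2_1; unfold PI2; lra.
    - intros; apply Rmult_le_pos; auto; lra.
    - intros th Ht; apply Rmult_lt_0_compat; [now apply Hpos|lra]. }
  assert (Hd1 : forall t, 0 <= t -> 0 <= rdisc h t).
  { intros t Ht. apply RInt_ge_0; auto. - apply ex_RInt_cont, rcirc_cont; auto. - intros; apply Hc1; lra. }
  assert (Hd2 : forall t, r - x < t <= r -> 0 < rdisc h t).
  { intros t Ht. apply (RInt_pos_sub _ _ _ (r - x) t); try lra.
    - now apply rcirc_cont.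
    - intros; apply Hc1; lra.
    - intros; apply Hc2; lra. }
  split; [apply Hd2; lra|].
  apply (RInt_pos_sub _ _ _ (r - x) r); try lra.
  - now apply rdisc_over_cont.
  - intros y Hy. destruct (Req_dec y 0) as [->|Hy0].
    + unfold rdisc. rewrite RInt_point. unfold zero; simpl. unfold Rdiv; rewrite Rmult_0_l; lra.
    + apply Rmult_le_pos; [apply Hd1; lra|]. apply Rlt_le, Rinv_0_lt_compat; lra.
  - intros y Hy. apply Rdiv_lt_0_compat; [apply Hd2|]; lra.
Qed.

(** * Green's formula in polar coordinates *)

(** Equations left by integrals and derivatives live in a structure whose carrier is [R]; they are
    restated over [R] itself for [ring]. *)
Ltac Req := match goal with |- @eq _ ?a ?b => change (@eq R a b) end.

Definition cont2 (f : R -> R -> R) : Prop :=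
  forall p : R * R, continuous (fun q : R * R => f (fst q) (snd q)) p.

Lemma cont2_comp {U : UniformSpace} (f : R -> R -> R) (x y : U -> R) p : cont2 f ->
  continuous x p -> continuous y p -> continuous (fun q => f (x q) (y q)) p.
Proof.
  intros Hf Hx Hy. apply (continuous_comp (fun q => (x q, y q)) (fun q : R * R => f (fst q) (snd q))).
  - now apply ct_pair.
  - apply Hf.
Qed.

Lemma cont2_l f : cont2 f -> forall x y, continuous (f x) y.
Proof. intros Hf x y. apply (cont2_comp f (fun _ => x) (fun y => y)); auto using continuous_const, continuous_id. Qed.

(** Two partial derivatives, one of them continuous, give total differentiability, and the chain
    rule follows. *)
Lemma is_derive_comp2 (b b1 b2 : R -> R -> R) (x y : R -> R) t dx dy :
  (forall x y, is_derive (fun x => b x y) x (b1 x y)) ->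
  (forall x y, is_derive (fun y => b x y) y (b2 x y)) -> cont2 b1 ->
  is_derive x t dx -> is_derive y t dy ->
  is_derive (fun t => b (x t) (y t)) t (b1 (x t) (y t) * dx + b2 (x t) (y t) * dy).
Proof.
  intros H1 H2 Hc Hx Hy.
  assert (F := is_derive_filterdiff b (x t) (y t) b1 (b2 (x t) (y t))).
  assert (G : filterdiff (fun u : R * R => b (fst u) (snd u)) (locally (x t, y t))
    (fun u : R * R => plus (scal (fst u) (b1 (x t) (y t))) (scal (snd u) (b2 (x t) (y t))))).
  { apply F; auto. apply filter_forall; auto. }
  generalize (filterdiff_comp'_2 x y b t _ _ (fun u v => plus (scal u (b1 (x t) (y t))) (scal v (b2 (x t) (y t)))) Hx Hy G).
  intros K. eapply filterdiff_ext_lin; [exact K|].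
  intros s. unfold plus, scal; simpl; unfold mult; simpl. ring.
Qed.

Lemma is_derive_RInt_param' (f df : R -> R -> R) a b s :
  (forall s t, is_derive (fun s => f s t) s (df s t)) -> cont2 df -> (forall s t, continuous (f s) t) ->
  is_derive (fun s => RInt (f s) a b) s (RInt (df s) a b).
Proof.
  intros H1 H2 H3.
  rewrite <- (RInt_ext (fun t => Derive (fun u => f u t) s)).
  - apply is_derive_RInt_param.
    + apply filter_forall; intros x t _. exists (df x t); apply H1.
    + intros t _. apply (continuity_2d_pt_ext df).
      * intros x y; symmetry; now apply is_derive_unique.
      * apply continuity_2d_pt_filterlim. apply (H2 (s, t)).
    + apply filter_forall; intros y. now apply ex_RInt_cont.
  - intros t _. now apply is_derive_unique.
Qed.

Lemma pol_ds s th : is_derive (fun s => s * cos th) s (cos th) /\ is_derive (fun s => s * sin th) s (sin th).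
Proof. split; auto_derive; auto; ring. Qed.
Lemma pol_dth s th : is_derive (fun th => s * cos th) th (- s * sin th) /\
  is_derive (fun th => s * sin th) th (s * cos th).
Proof. split; auto_derive; auto; ring. Qed.

Lemma pol_2PI s : pol s (2 * PI) = pol s 0.
Proof. unfold pol. now rewrite cos_2PI, sin_2PI, cos_0, sin_0. Qed.

(* The partial derivatives of [pol s th] in [s], in [th], and the mixed one. *)
Definition pol_s (th : R) : C := (cos th, sin th).
Definition pol_th (s th : R) : C := (- s * sin th, s * cos th).
Definition pol_sth (th : R) : C := (- sin th, cos th).

Section Green.
Variables x1 x2 y1 y2 : R.
Let X (w : C) := x1 * Re w + x2 * Im w.
Let Y (w : C) := y1 * Re w + y2 * Im w.
Variables h h' h'' : C -> C.
Hypothesis Hh : forall z, Cder h z (h' z).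
Hypothesis Hh' : forall z, Cder h' z (h'' z).
Hypothesis Hh'' : forall z, continuous h'' z.
Variables b b1 b2 : R -> R -> R.
Hypothesis Hb1 : forall x y, is_derive (fun x => b x y) x (b1 x y).
Hypothesis Hb2 : forall x y, is_derive (fun y => b x y) y (b2 x y).
Hypothesis Cb : cont2 b.
Hypothesis Cb1 : cont2 b1.
Hypothesis Cb2 : cont2 b2.

(** Suffixes [t] and [s] mark the polar partial derivatives in angle and radius of the real
    coordinates [X] and [Y] of [h]; [Xst] is the mixed one. *)
Let Xt s th := X (h' (pol s th) * pol_th s th)%C.
Let Xs s th := X (h' (pol s th) * pol_s th)%C.
Let Yt s th := Y (h' (pol s th) * pol_th s th)%C.
Let Ys s th := Y (h' (pol s th) * pol_s th)%C.
Let Xst s th := X (h'' (pol s th) * pol_s th * pol_th s th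
   + h' (pol s th) * pol_sth th)%C.
Let bb s th := b (X (h (pol s th))) (Y (h (pol s th))).

Lemma lin_ds (c1 c2 : R) s th :
  is_derive (fun s => c1 * Re (h (pol s th)) + c2 * Im (h (pol s th))) s
    (c1 * Re (h' (pol s th) * pol_s th)%C + c2 * Im (h' (pol s th) * pol_s th)%C).
Proof.
  destruct (pol_ds s th) as [P Q].
  destruct (Cder_path h (h' (pol s th)) _ _ s _ _ (Hh _) P Q) as [D1 D2].
  apply (is_derive_plus (V := R_NormedModule)); now apply (is_derive_scal (fun s => _)).
Qed.
Lemma lin_dth (c1 c2 : R) s th :
  is_derive (fun th => c1 * Re (h (pol s th)) + c2 * Im (h (pol s th))) th
    (c1 * Re (h' (pol s th) * pol_th s th)%C + c2 * Im (h' (pol s th) * pol_th s th)%C).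
Proof.
  destruct (pol_dth s th) as [P Q].
  destruct (Cder_path h (h' (pol s th)) _ _ th _ _ (Hh _) P Q) as [D1 D2].
  apply (is_derive_plus (V := R_NormedModule)); now apply (is_derive_scal (fun s => _)).
Qed.

Lemma bb_ds s th : is_derive (fun s => bb s th) s
  (b1 (X (h (pol s th))) (Y (h (pol s th))) * Xs s th + b2 (X (h (pol s th))) (Y (h (pol s th))) * Ys s th).
Proof. apply (is_derive_comp2 b b1 b2 (fun s => X (h (pol s th))) (fun s => Y (h (pol s th)))); auto; apply lin_ds. Qed.
Lemma bb_dth s th : is_derive (fun th => bb s th) th
  (b1 (X (h (pol s th))) (Y (h (pol s th))) * Xt s th + b2 (X (h (pol s th))) (Y (h (pol s th))) * Yt s th).
Proof. apply (is_derive_comp2 b b1 b2 (fun th => X (h (pol s th))) (fun th => Y (h (pol s th)))); auto; apply lin_dth. Qed.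

Lemma is_derive_mult_R (f g : R -> R) x df dg : is_derive f x df -> is_derive g x dg ->
  is_derive (fun t => f t * g t) x (df * g x + f x * dg).
Proof. intros H1 H2. apply (is_derive_mult f g); auto. intros; apply Rmult_comm. Qed.

Lemma Xt_ds s th : is_derive (fun s => Xt s th) s (Xst s th).
Proof.
  destruct (pol_ds s th) as [P Q].
  destruct (Cder_path h' (h'' (pol s th)) _ _ s _ _ (Hh' _) P Q) as [D1 D2].
  change (is_derive (fun s => Re (h' (pol s th))) s (Re (h'' (pol s th) * pol_s th)%C)) in D1.
  change (is_derive (fun s => Im (h' (pol s th))) s (Im (h'' (pol s th) * pol_s th)%C)) in D2.
  set (A := fun s => Re (h' (pol s th))) in *. set (B := fun s => Im (h' (pol s th))) in *.
  assert (KA := is_derive_mult_R A (fun s => s) s _ _ D1 (is_derive_id s)).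
  assert (KB := is_derive_mult_R B (fun s => s) s _ _ D2 (is_derive_id s)).
  assert (K2 := is_derive_plus (V := R_NormedModule) _ _ s _ _
     (is_derive_scal _ s (- x1 * sin th + x2 * cos th) _ KA)
     (is_derive_scal _ s (- x1 * cos th - x2 * sin th) _ KB)).
  match type of K2 with is_derive _ _ ?l => replace (Xst s th) with l end.
  - eapply is_derive_ext; [|exact K2]. intros u. unfold Xt, X, A, B, pol_th.
    unfold plus; simpl. unfold Re, Im; simpl. ring.
  - unfold Xst, X, A, B, pol_s, pol_th, pol_sth, plus, one; simpl. unfold Re, Im, one; simpl. ring.
Qed.

(** Both orders of differentiation are computed to the same expression [Xst], which gives the
    symmetry of the mixed derivatives. *)
Lemma Xs_dth s th : is_derive (fun th => Xs s th) th (Xst s th).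
Proof.
  destruct (pol_dth s th) as [P Q].
  destruct (Cder_path h' (h'' (pol s th)) _ _ th _ _ (Hh' _) P Q) as [D1 D2].
  change (is_derive (fun th => Re (h' (pol s th))) th (Re (h'' (pol s th) * pol_th s th)%C)) in D1.
  change (is_derive (fun th => Im (h' (pol s th))) th (Im (h'' (pol s th) * pol_th s th)%C)) in D2.
  set (A := fun th => Re (h' (pol s th))) in *. set (B := fun th => Im (h' (pol s th))) in *.
  assert (E1 : is_derive (fun th => x1 * cos th + x2 * sin th) th (- x1 * sin th + x2 * cos th)).
  { auto_derive; auto; ring. }
  assert (E2 : is_derive (fun th => - x1 * sin th + x2 * cos th) th (- x1 * cos th - x2 * sin th)).
  { auto_derive; auto; ring. }
  assert (K2 := is_derive_plus (V := R_NormedModule) _ _ th _ _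
     (is_derive_mult_R _ _ th _ _ D1 E1) (is_derive_mult_R _ _ th _ _ D2 E2)).
  match type of K2 with is_derive _ _ ?l => replace (Xst s th) with l end.
  - eapply is_derive_ext; [|exact K2]. intros u. unfold Xs, X, A, B, pol_s.
    unfold plus; simpl. unfold Re, Im; simpl. ring.
  - unfold Xst, X, A, B, pol_s, pol_th, pol_sth, plus, one; simpl. unfold Re, Im, one; simpl. ring.
Qed.

Let Ch z : continuous h z := Cder_cont _ _ _ (Hh z).
Let Ch' z : continuous h' z := Cder_cont _ _ _ (Hh' z).

Lemma cont2_Xt : cont2 Xt. Proof. intros p; unfold Xt, X, pol_th; cts. Qed.
Lemma cont2_Yt : cont2 Yt. Proof. intros p; unfold Yt, Y, pol_th; cts. Qed.
Lemma cont2_Xs : cont2 Xs. Proof. intros p; unfold Xs, X, pol_s; cts. Qed.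
Lemma cont2_Ys : cont2 Ys. Proof. intros p; unfold Ys, Y, pol_s; cts. Qed.
Lemma cont2_Xst : cont2 Xst. Proof. intros p; unfold Xst, X, pol_s, pol_th, pol_sth; cts. Qed.
Lemma cont2_bh (c : R -> R -> R) : cont2 c -> cont2 (fun s th => c (X (h (pol s th))) (Y (h (pol s th)))).
Proof. intros Hc p; apply cont2_comp; auto; unfold X, Y; cts. Qed.

(** The Jacobian of the real coordinates of [h] in polar form: [s] comes from polar coordinates, the
    determinant from the linear change, and the squared modulus from the Cauchy-Riemann
    equations. *)
Lemma XsYt s th : Xs s th * Yt s th - Xt s th * Ys s th = s * ((x1 * y2 - x2 * y1) * Cmod (h' (pol s th)) ^ 2).
Proof.
  rewrite Cmod_sqr. unfold Xs, Yt, Xt, Ys, X, Y, pol_s, pol_th; simpl. destruct (h' (pol s th)) as [u v]; simpl.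
  assert (E := sin2_cos2 th). unfold Rsqr in E.
  transitivity (s * ((x1 * y2 - x2 * y1) * (u ^ 2 + v ^ 2)) * (sin th * sin th + cos th * cos th)); [ring|].
  rewrite E; simpl; ring.
Qed.

Let G (z : C) := b2 (X (h z)) (Y (h z)) * ((x1 * y2 - x2 * y1) * Cmod (h' z) ^ 2).

(** Stokes for the 1-form [b dX] pulled back by [h], since [d(b dX) = - b2 dX /\ dY]. The circle
    integral [Phi] is differentiated in the radius and then integrated from [Phi 0 = 0]. *)
Lemma green_identity t : rdisc G t = - RInt (fun th => bb t th * Xt t th) 0 (2 * PI).
Proof.
  set (Phi := fun s => RInt (fun th => bb s th * Xt s th) 0 (2 * PI)).
  set (B1 := fun s th => b1 (X (h (pol s th))) (Y (h (pol s th)))).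
  set (B2 := fun s th => b2 (X (h (pol s th))) (Y (h (pol s th)))).
  assert (cB1 : cont2 B1) by (now apply cont2_bh).
  assert (cB2 : cont2 B2) by (now apply cont2_bh).
  assert (cbb : cont2 bb) by (now apply cont2_bh).
  pose (df := fun s th => (B1 s th * Xs s th + B2 s th * Ys s th) * Xt s th + bb s th * Xst s th).
  (* [dg] is the angular derivative of [bb * Xs], so it integrates to zero over a period; [df - dg]
     is [- B2] times the Jacobian. *)
  pose (dg := fun s th => (B1 s th * Xt s th + B2 s th * Yt s th) * Xs s th + bb s th * Xst s th).
  assert (cdf : cont2 df).
  { intros p. pose proof (cB1 p); pose proof (cB2 p); pose proof (cbb p); pose proof (cont2_Xs p);
    pose proof (cont2_Xt p); pose proof (cont2_Ys p); pose proof (cont2_Xst p). unfold df.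
    cts; assumption. }
  assert (cdg : cont2 dg).
  { intros p. pose proof (cB1 p); pose proof (cB2 p); pose proof (cbb p); pose proof (cont2_Xs p);
    pose proof (cont2_Xt p); pose proof (cont2_Yt p); pose proof (cont2_Xst p). unfold dg.
    cts; assumption. }
  assert (D : forall s, is_derive Phi s (RInt (df s) 0 (2 * PI))).
  { intros s. apply (is_derive_RInt_param' (fun s th => bb s th * Xt s th) df).
    - intros s' th. apply (is_derive_mult_R (fun s => bb s th) (fun s => Xt s th)); [apply bb_ds|apply Xt_ds].
    - exact cdf.
    - intros s' th. apply (cont2_l (fun s th => bb s th * Xt s th)). intros p.
      apply ct_mult; [apply cbb|apply cont2_Xt]. }
  assert (Z : forall s, RInt (dg s) 0 (2 * PI) = 0).
  { intros s. assert (I := is_RInt_derive (V := R_CompleteNormedModule) (fun th => bb s th * Xs s th) (dg s) 0 (2 * PI)).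
    assert (I' := fun p q => is_RInt_unique (V := R_CompleteNormedModule) _ _ _ _ (I p q)).
    etransitivity; [apply I'|].
    3: { unfold minus, plus, opp; simpl. unfold bb, Xs, pol_s. rewrite pol_2PI, cos_2PI, sin_2PI, cos_0, sin_0. Req; ring. }
    - intros th _. apply (is_derive_mult_R (fun th => bb s th) (fun th => Xs s th)); [apply bb_dth|apply Xs_dth].
    - intros th _. now apply cont2_l. }
  assert (E : forall s, RInt (df s) 0 (2 * PI) = - rcirc G s).
  { intros s. unfold rcirc.
    transitivity (RInt (dg s) 0 (2 * PI) - RInt (fun th => G (pol s th) * s) 0 (2 * PI)); [|rewrite Z; Req; ring].
    rewrite <- (RInt_minus (V := R_CompleteNormedModule)).
    - apply RInt_ext. intros th _. unfold minus, plus, opp; simpl.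
      transitivity (dg s th + - (B2 s th * (Xs s th * Yt s th - Xt s th * Ys s th))).
      + unfold df, dg. Req; ring.
      + rewrite XsYt. unfold G, B2. Req; ring.
    - apply ex_RInt_cont. now apply cont2_l.
    - apply ex_RInt_cont. intros th.
      apply (continuous_ext (fun th => B2 s th * (Xs s th * Yt s th - Xt s th * Ys s th))).
      + intros x; rewrite XsYt. unfold G, B2; (Req; ring).
      + apply ct_mult; [now apply cont2_l|]. apply ct_minus; apply ct_mult; apply cont2_l;
        auto using cont2_Xs, cont2_Xt, cont2_Yt, cont2_Ys. }
  assert (P0 : Phi 0 = 0).
  { unfold Phi. rewrite (RInt_ext _ (fun _ => 0)).
    - rewrite RInt_const. apply Rmult_0_r.
    - intros th _. unfold Xt, X, pol_th; simpl. (Req; ring). }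
  assert (I := is_RInt_derive (V := R_CompleteNormedModule) (fun s => - Phi s) (rcirc G) 0 t).
  assert (I' := fun p q => is_RInt_unique (V := R_CompleteNormedModule) _ _ _ _ (I p q)).
  unfold rdisc. etransitivity; [apply I'|].
  3: { unfold minus, plus, opp; simpl. rewrite P0. unfold Phi. Req; ring. }
  - intros s _. replace (rcirc G s) with (opp (- rcirc G s)) by (unfold opp; simpl; (Req; ring)).
    apply (is_derive_opp (V := R_NormedModule)). rewrite <- E. apply D.
  - intros s _. apply rcirc_cont. intros z. unfold G, X, Y.
    apply ct_mult; [apply cont2_comp; auto|]; cts.
Qed.

Lemma green_bound M t : (forall x y, Rabs (b x y) <= M) -> 0 <= t ->
  Rabs (rdisc G t) <= M * (Rabs x1 + Rabs x2) * rcirc (fun z => Cmod (h' z)) t.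
Proof.
  intros HM Ht. rewrite green_identity, Rabs_Ropp.
  assert (c1 : forall th, continuous (fun th => bb t th * Xt t th) th).
  { intros th. apply ct_mult; apply cont2_l; [now apply cont2_bh|apply cont2_Xt]. }
  assert (M0 : 0 <= M) by (eapply Rle_trans; [apply Rabs_pos|apply (HM 0 0)]).
  eapply Rle_trans; [apply abs_RInt_le; [generalize two_PI_pos; lra|now apply ex_RInt_cont]|].
  unfold rcirc. rewrite <- (RInt_scal (V := R_CompleteNormedModule)).
  - apply RInt_le; [generalize two_PI_pos; lra| | |].
    + apply ex_RInt_cont. intros; now apply ct_abs.
    + apply ex_RInt_cont. intros th. apply (ct_mult (fun _ => _)); [apply continuous_const|].
      apply ct_mult; [|apply continuous_const]. apply (cont_polar_slice (fun z => Cmod (h' z))).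
      intros z; apply ct_Cmod; eapply Cder_cont, Hh'.
    + intros th _. unfold scal; simpl; unfold mult; simpl.
      rewrite Rabs_mult.
      assert (E : Cmod (pol_th t th) = t).
      (* The angular derivative of [pol] is [pol] turned by a right angle. *)
      { transitivity (Cmod (pol t (th + PI/2))); [|now apply Cmod_pol]. f_equal. unfold pol, pol_th.
        rewrite cos_plus, sin_plus, cos_PI2, sin_PI2. f_equal; ring. }
      assert (H2 : Rabs (Xt t th) <= (Rabs x1 + Rabs x2) * (Cmod (h' (pol t th)) * t)).
      { replace (Cmod (h' (pol t th)) * t) with (Cmod (h' (pol t th) * pol_th t th)%C)
          by (rewrite Cmod_mult, E; reflexivity). unfold Xt, X.
        set (w := (h' (pol t th) * pol_th t th)%C).
        eapply Rle_trans; [apply Rabs_triang|]. rewrite !Rabs_mult.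
        generalize (Rabs_Re w) (Rabs_Im w) (Rabs_pos x1) (Rabs_pos x2); nra. }
      rewrite Rmult_assoc. apply Rmult_le_compat; auto using Rabs_pos. apply HM.
  - apply ex_RInt_cont. intros th. apply ct_mult; [|apply continuous_const].
    apply (cont_polar_slice (fun z => Cmod (h' z))). intros z; apply ct_Cmod; eapply Cder_cont, Hh'.
Qed.
End Green.

(** * Bounded primitives of periodic functions *)

Lemma RInt_0_derive (k : R -> R) : (forall x, continuous k x) ->
  forall y, is_derive (fun y => RInt k 0 y) y (k y).
Proof.
  intros Hk y. apply (is_derive_RInt k (fun y => RInt k 0 y) 0 y); auto.
  apply filter_forall; intros x. apply (RInt_correct (V := R_CompleteNormedModule) k 0 x).
  now apply ex_RInt_cont.
Qed.

Lemma periodic_IZR (u : R -> R) : (forall y, u (y + 1) = u y) -> forall n y, u (y + IZR n) = u y.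
Proof.
  intros H.
  assert (P : forall (n : nat) y, u (y + INR n) = u y).
  { induction n as [|n IH]; intros y; [now rewrite Rplus_0_r|].
    rewrite S_INR, <- Rplus_assoc, H; apply IH. }
  intros n y. destruct (Z_le_gt_dec 0 n) as [Hn|Hn].
  - replace n with (Z.of_nat (Z.to_nat n)) by lia. rewrite <- INR_IZR_INZ. apply P.
  - rewrite <- (P (Z.to_nat (- n)) (y + IZR n)). f_equal. rewrite INR_IZR_INZ, Z2Nat.id by lia.
    rewrite opp_IZR; ring.
Qed.

Lemma frac_part_bound y : exists n, 0 <= y + IZR n <= 1.
Proof. exists (- Int_part y)%Z. rewrite opp_IZR. generalize (base_Int_part y); lra. Qed.

(** Zero mean makes the primitive periodic, so it has to be bounded on one period only. *)
Lemma primitive_bounded (k : R -> R) M : (forall x, continuous k x) ->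
  (forall x, k (x + 1) = k x) -> RInt k 0 1 = 0 -> (forall x, Rabs (k x) <= M) ->
  forall y, Rabs (RInt k 0 y) <= M.
Proof.
  intros Hc Hp H0 HM.
  assert (M0 : 0 <= M) by (eapply Rle_trans; [apply Rabs_pos|apply (HM 0)]).
  assert (P : forall y, RInt k 0 (y + 1) = RInt k 0 y).
  { intros y.
    set (u := fun y => RInt k 0 (y + 1) - RInt k 0 y).
    assert (D : forall x, is_derive u x 0).
    { intros x. unfold u.
      assert (K : is_derive (fun y => RInt k 0 (y + 1)) x (1 * k (x + 1))).
      { apply (is_derive_comp (fun y => RInt k 0 y) (fun y => y + 1) x); [now apply RInt_0_derive|].
        auto_derive; auto; ring. }
      assert (K2 := is_derive_minus _ _ x _ _ K (RInt_0_derive k Hc x)).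
      assert (E : @eq R (minus (1 * k (x + 1)) (k x)) 0).
      { rewrite Hp. unfold minus, plus, opp; simpl; Req; ring. }
      exact (eq_rect _ (fun l => is_derive u x l) K2 _ E). }
    destruct (MVT_gen u 0 y (fun _ => 0)) as [c [_ Hc2]].
    - intros; apply D.
    - intros x _. apply continuity_pt_filterlim, (ex_derive_continuous u). exists 0; apply D.
    - unfold u in Hc2. rewrite Rplus_0_l, H0, RInt_point in Hc2. unfold zero in Hc2; simpl in Hc2. lra. }
  intros y. destruct (frac_part_bound y) as [n Hn].
  rewrite <- (periodic_IZR (fun y => RInt k 0 y) P n y).
  eapply Rle_trans; [apply (abs_RInt_le_const k 0 _ M); [lra|now apply ex_RInt_cont|auto]|]. nra.
Qed.

(** The substitution of [y * t] for the integration variable moves the variable upper limit into the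
    integrand, which leaves a parametric integral over [[0, 1]]. *)
Lemma cont2_RInt (k : R -> R -> R) : cont2 k -> cont2 (fun x y => RInt (k x) 0 y).
Proof.
  intros Hk p.
  assert (E : forall q : R * R, snd q * RInt (fun t => k (fst q) (snd q * t)) 0 1 = RInt (k (fst q)) 0 (snd q)).
  { intros [x y]; simpl.
    assert (K := RInt_comp_lin (V := R_CompleteNormedModule) (k x) y 0 0 1).
    rewrite Rmult_0_r, Rmult_1_r, !Rplus_0_r in K. rewrite <- K.
    - rewrite (RInt_scal (V := R_CompleteNormedModule)).
      + unfold scal; simpl; unfold mult; simpl. f_equal. apply RInt_ext. intros; now rewrite Rplus_0_r.
      + apply ex_RInt_cont. intros t. apply cont2_comp; cts; auto.
    - apply ex_RInt_cont. now apply cont2_l. }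
  apply (continuous_ext _ _ _ E).
  apply (ct_mult (fun q : R * R => snd q) (fun q => RInt (fun t => k (fst q) (snd q * t)) 0 1));
    [apply ct_snd, continuous_id|].
  apply (continuous_RInt_param (fun (q : R * R) t => k (fst q) (snd q * t))); [|lra].
  intros q t. apply cont2_comp; auto; cts.
Qed.

Lemma cont_RInt_r (f : R -> R -> R) : cont2 f -> forall x, continuous (fun x => RInt (f x) 0 1) x.
Proof. intros Hf x. apply (cont2_comp (fun x y => RInt (f x) 0 y) (fun x => x) (fun _ => 1)); cts. now apply cont2_RInt. Qed.

Lemma RInt_0_1_bound (k : R -> R) M : (forall x, continuous k x) -> (forall x, Rabs (k x) <= M) ->
  Rabs (RInt k 0 1) <= M.
Proof.
  intros Hc HM. eapply Rle_trans; [apply (abs_RInt_le_const k 0 1 M); [lra|now apply ex_RInt_cont|auto]|]. lra.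
Qed.

(* On the torus [f - m] is the exact form [d(A dy - B dx)] with [A], [B] periodic, so by Green its
   integral over the image of a disc is controlled by the length of the boundary. *)
Lemma periodic_length_area (f f1 : R -> R -> R) M x1 x2 y1 y2 :
  cont2 f -> cont2 f1 -> (forall x y, is_derive (fun x => f x y) x (f1 x y)) ->
  (forall x y, f (x + 1) y = f x y) -> (forall x y, f x (y + 1) = f x y) ->
  (forall x y, Rabs (f x y) <= M) -> x1 * y2 - x2 * y1 <> 0 ->
  exists K, 0 <= K /\ forall h h' h'' : C -> C,
    (forall z, Cder h z (h' z)) -> (forall z, Cder h' z (h'' z)) -> (forall z, continuous h'' z) ->
    forall t, 0 <= t ->
    Rabs (rdisc (fun z => (f (x1 * Re (h z) + x2 * Im (h z)) (y1 * Re (h z) + y2 * Im (h z))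
       - RInt (fun s => RInt (fun t => f s t) 0 1) 0 1) * Cmod (h' z) ^ 2) t)
     <= K * rcirc (fun z => Cmod (h' z)) t.
Proof.
  intros Cf Cf1 Hf1 Px Py HM Hd.
  set (fb := fun x => RInt (f x) 0 1). set (f1b := fun x => RInt (f1 x) 0 1).
  set (m := RInt (fun s => RInt (fun t => f s t) 0 1) 0 1).
  assert (Cfb : forall x, continuous fb x) by (now apply cont_RInt_r).
  assert (Cf1b : forall x, continuous f1b x) by (now apply cont_RInt_r).
  assert (Dfb : forall x, is_derive fb x (f1b x)).
  { intros x. apply is_derive_RInt_param'; auto. now apply cont2_l. }
  assert (M0 : 0 <= M) by (eapply Rle_trans; [apply Rabs_pos|apply (HM 0 0)]).
  assert (Bfb : forall x, Rabs (fb x) <= M) by (intros x; apply RInt_0_1_bound; auto using cont2_l).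
  assert (Bm : Rabs m <= M) by (now apply RInt_0_1_bound).
  (* [f - m] splits into [k], of zero mean in the second variable for each [x], and [fb - m], of
     zero mean in [x]; each part has a bounded periodic primitive in its own variable. *)
  set (k := fun x t => f x t - fb x). set (k1 := fun x t => f1 x t - f1b x).
  assert (Ck : cont2 k) by (intros p; pose proof (Cf p); unfold k; cts; assumption).
  assert (Ck1 : cont2 k1) by (intros p; pose proof (Cf1 p); unfold k1; cts; assumption).
  set (b := fun x y => RInt (k x) 0 y). set (b1 := fun x y => RInt (k1 x) 0 y).
  assert (Bb : forall x y, Rabs (b x y) <= 2 * M).
  { intros x. apply primitive_bounded.
    - now apply cont2_l.
    - intros y; unfold k; now rewrite Py.
    - unfold k. rewrite (RInt_minus (V := R_CompleteNormedModule)) by (apply ex_RInt_cont; auto using cont2_l, continuous_const).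
      rewrite RInt_const. unfold minus, plus, opp, scal; simpl; unfold mult; simpl. fold (fb x). Req; ring.
    - intros y. unfold k. eapply Rle_trans; [apply Rabs_triang|]. rewrite Rabs_Ropp.
      generalize (HM x y) (Bfb x); lra. }
  (* Green's lemmas differentiate in the second variable, so for [a] the two coordinates are
     exchanged. Hence the dummy first argument, and the opposite sign of the determinant in [F2]. *)
  set (a := fun (_ x : R) => RInt (fun x => fb x - m) 0 x).
  assert (Ckm : forall x, continuous (fun x => fb x - m) x) by (intros x; cts).
  assert (Ba : forall y x, Rabs (a y x) <= 2 * M).
  { intros y; unfold a. apply primitive_bounded; auto.
    - intros x. f_equal. unfold fb. apply RInt_ext; auto.
    - rewrite (RInt_minus (V := R_CompleteNormedModule)) by (apply ex_RInt_cont; auto using continuous_const).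
      rewrite RInt_const. unfold minus, plus, opp, scal; simpl; unfold mult; simpl.
      match goal with |- context [RInt ?g 0 1] => change (RInt g 0 1) with m end. Req; ring.
    - intros x. eapply Rle_trans; [apply Rabs_triang|]. rewrite Rabs_Ropp. generalize (Bfb x); lra. }
  set (d := x1 * y2 - x2 * y1) in *.
  set (K := / Rabs d * (2 * M * (Rabs x1 + Rabs x2) + 2 * M * (Rabs y1 + Rabs y2))).
  assert (Hd' : 0 < Rabs d) by (now apply Rabs_pos_lt).
  exists K. split.
  { apply Rmult_le_pos; [now apply Rlt_le, Rinv_0_lt_compat|].
    generalize (Rabs_pos x1) (Rabs_pos x2) (Rabs_pos y1) (Rabs_pos y2); intros.
    apply Rplus_le_le_0_compat; apply Rmult_le_pos; lra. }
  intros h h' h'' Hh Hh' Hh'' t Ht.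
  set (X := fun z => x1 * Re (h z) + x2 * Im (h z)). set (Y := fun z => y1 * Re (h z) + y2 * Im (h z)).
  assert (G1 := green_bound x1 x2 y1 y2 h h' h'' Hh Hh' Hh'' b b1 k).
  assert (G2 := green_bound y1 y2 x1 x2 h h' h'' Hh Hh' Hh'' a (fun _ _ => 0) (fun _ x => fb x - m)).
  specialize (G1 ltac:(intros x y; apply (is_derive_RInt_param' k k1); auto using cont2_l;
     intros s t'; apply (is_derive_minus (fun x => f x t') fb); auto)).
  specialize (G1 ltac:(intros x y; apply RInt_0_derive; now apply cont2_l)).
  specialize (G1 (cont2_RInt k Ck) (cont2_RInt k1 Ck1) Ck (2 * M) t Bb Ht).
  specialize (G2 ltac:(intros x y; exact (is_derive_const (K := R_AbsRing) (V := R_NormedModule) (a 0 y) x))).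
  specialize (G2 ltac:(intros x y; now apply RInt_0_derive)).
  specialize (G2 (cont2_RInt (fun _ x => fb x - m) ltac:(intros q; cts))).
  specialize (G2 ltac:(intros p; cts) ltac:(intros p; cts) (2 * M) t Ba Ht).
  fold d in G1. fold (X) in G1.
  assert (ch : forall z, continuous h z) by (intros z; eapply Cder_cont, Hh).
  assert (ch' : forall z, continuous h' z) by (intros z; eapply Cder_cont, Hh').
  set (F1 := fun z : C => k (X z) (Y z) * (d * Cmod (h' z) ^ 2)).
  set (F2 := fun z : C => (fb (X z) - m) * ((y1 * x2 - y2 * x1) * Cmod (h' z) ^ 2)).
  assert (cX : forall z, continuous X z) by (intros z; unfold X; cts).
  assert (cY : forall z, continuous Y z) by (intros z; unfold Y; cts).
  assert (cF1 : cont F1).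
  { intros z; unfold F1. apply ct_mult; [apply cont2_comp; auto|cts]. }
  assert (cF2 : cont F2) by (intros z; unfold F2; cts).
  destruct (rdisc_posfun t Ht) as [L1 L2 L3].
  change (Rabs (rdisc F1 t) <= 2 * M * (Rabs x1 + Rabs x2) * rcirc (fun z => Cmod (h' z)) t) in G1.
  change (Rabs (rdisc F2 t) <= 2 * M * (Rabs y1 + Rabs y2) * rcirc (fun z => Cmod (h' z)) t) in G2.
  assert (E : rdisc (fun z => (f (X z) (Y z) - m) * Cmod (h' z) ^ 2) t = / d * (rdisc F1 t + -1 * rdisc F2 t)).
  { unfold cont in cF1, cF2. rewrite <- L2 by auto. rewrite <- L1 by (auto; intros z; cts).
    rewrite <- L2 by (intros z; cts).
    unfold rdisc. apply RInt_ext. intros s _. apply RInt_ext. intros th _. f_equal.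
    unfold F1, F2, k. unfold d. field. exact Hd. }
  change (Rabs (rdisc (fun z => (f (X z) (Y z) - m) * Cmod (h' z) ^ 2) t) <= K * rcirc (fun z => Cmod (h' z)) t).
  rewrite E, Rabs_mult, Rabs_inv. unfold K. rewrite Rmult_assoc.
  apply Rmult_le_compat_l; [now apply Rlt_le, Rinv_0_lt_compat|].
  eapply Rle_trans; [apply Rabs_triang|]. rewrite Rabs_mult. replace (Rabs (-1)) with 1 by (rewrite Rabs_left; lra). lra.
Qed.

(** The length-area bound holds at every radius with the same [K], so it can be integrated against
    [dt / t]. *)
Lemma rdisc_log_bound F G K r : cont F -> cont G -> 0 <= r ->
  (forall t, 0 <= t -> Rabs (rdisc F t) <= K * rcirc G t) ->
  Rabs (rdisc_log F r) <= K * rcirc_log G r.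
Proof.
  intros HF HG Hr H.
  assert (cF := rdisc_over_cont F HF).
  eapply Rle_trans; [apply abs_RInt_le; [auto|now apply ex_RInt_cont]|].
  rewrite rcirc_log_eq by auto.
  rewrite <- (RInt_scal (V := R_CompleteNormedModule)) by (apply ex_RInt_cont; now apply avg_cont).
  apply RInt_le; auto.
  - apply ex_RInt_cont. intros; now apply ct_abs.
  - apply ex_RInt_cont. intros t. apply (ct_mult (fun _ => K)); [cts|now apply avg_cont].
  - intros t Ht. unfold scal; simpl; unfold mult; simpl. unfold Rdiv. rewrite Rabs_mult.
    rewrite (Rabs_pos_eq (/ t)) by (apply Rlt_le, Rinv_0_lt_compat; lra).
    apply Rmult_le_reg_r with t; [lra|]. rewrite Rmult_assoc, Rinv_l, Rmult_1_r by lra.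
    eapply Rle_trans; [apply H; lra|]. right. unfold rcirc.
    rewrite (RInt_ext _ (fun th => scal t (G (pol t th)))) by (intros; apply Rmult_comm).
    rewrite (RInt_scal (V := R_CompleteNormedModule)) by (apply ex_RInt_cont; intros; now apply cont_polar_slice).
    unfold scal; simpl; unfold mult; simpl. Req; ring.
Qed.

(** * Periodic coefficients *)

Definition rperiodic (a1 b1 a2 b2 : C) (u : C * C -> R) : Prop :=
  forall (p : C * C) (g1 g2 : C), lattice a1 b1 g1 -> lattice a2 b2 g2 ->
    u ((fst p + g1)%C, (snd p + g2)%C) = u p.

(** The gauge at each point is chosen so small that its reciprocal bounds [F] nearby. The positive
    lower bound that compactness gives for the gauges then turns into the upper bound [/ d] for
    [F]. *)
Lemma continuous_bounded_box4 (F : R -> R -> R -> R -> R) :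
  (forall x y z t, continuous (fun q : R * (R * (R * R)) =>
      F (fst q) (fst (snd q)) (fst (snd (snd q))) (snd (snd (snd q)))) (x, (y, (z, t)))) ->
  exists M, forall x y z t, 0 <= x <= 1 -> 0 <= y <= 1 -> 0 <= z <= 1 -> 0 <= t <= 1 ->
    Rabs (F x y z t) <= M.
Proof.
  intros HF.
  assert (X : forall q : Compactness.Tn 4 R, exists d : posreal, forall x y z t,
    close_n 4 d (x, (y, (z, (t, tt)))) q -> Rabs (F x y z t) <= / d).
  { intros [x0 [y0 [z0 [t0 []]]]].
    destruct (continuous_ball _ _ 1 (HF x0 y0 z0 t0) Rlt_0_1) as [d Hd]. simpl in Hd.
    set (B := Rabs (F x0 y0 z0 t0) + 1).
    assert (HB : 0 < B) by (unfold B; generalize (Rabs_pos (F x0 y0 z0 t0)); lra).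
    assert (Hd' : 0 < Rmin d (/ B)) by (apply Rmin_pos; [apply cond_pos|now apply Rinv_0_lt_compat]).
    exists (mkposreal _ Hd'). intros x y z t. simpl. intros [H1 [H2 [H3 [H4 _]]]].
    assert (W : forall u v, Rabs (u - v) < Rmin d (/ B) -> ball v d u).
    { intros u v Huv. change (Rabs (u - v) < d). eapply Rlt_le_trans; [exact Huv|apply Rmin_l]. }
    assert (K : Rabs (F x y z t - F x0 y0 z0 t0) < 1).
    { apply (Hd (x, (y, (z, t)))). repeat split; simpl; apply W; assumption. }
    apply Rle_trans with B.
    - unfold B. replace (F x y z t) with ((F x y z t - F x0 y0 z0 t0) + F x0 y0 z0 t0) by ring.
      eapply Rle_trans; [apply Rabs_triang|lra].
    - apply Rle_trans with (/ / B); [right; symmetry; apply Rinv_inv|].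
      apply Rinv_le_contravar; [exact Hd'|apply Rmin_r]. }
  set (delta := fun q => proj1_sig (constructive_indefinite_description _ (X q))).
  destruct (compactness_value 4 (0, (0, (0, (0, tt)))) (1, (1, (1, (1, tt)))) delta) as [d Hd].
  exists (/ d). intros x y z t Hx Hy Hz Ht. apply NNPP; intros Hn.
  apply (Hd (x, (y, (z, (t, tt))))).
  - simpl; tauto.
  - intros [q [_ [Hq Hdq]]]. apply Hn. unfold delta in Hq, Hdq.
    destruct (constructive_indefinite_description _ (X q)) as [dq Hdq']; simpl proj1_sig in *.
    eapply Rle_trans; [apply Hdq'; exact Hq|]. apply Rinv_le_contravar; auto. apply cond_pos.
Qed.

(** Cramer's rule for the real coordinates of [w] in the basis [a, b], written as a real linear form
    in [Re w] and [Im w], the shape used for Green's formula. *)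
Definition coordX (a b w : C) : R :=
  Im b / Im (Cconj a * b) * Re w + (- Re b / Im (Cconj a * b)) * Im w.
Definition coordY (a b w : C) : R :=
  (- Im a / Im (Cconj a * b)) * Re w + Re a / Im (Cconj a * b) * Im w.

Lemma coord_decomp a b w : nondeg a b -> w = (RtoC (coordX a b w) * a + RtoC (coordY a b w) * b)%C.
Proof.
  unfold nondeg, coordX, coordY. destruct a as [a1 a2], b as [b1 b2], w as [w1 w2].
  unfold Im, Re, Cconj, Cmult, Cplus, RtoC; simpl. intros H. f_equal; field; lra.
Qed.

Lemma coord_det a b : nondeg a b ->
  Im b / Im (Cconj a * b) * (Re a / Im (Cconj a * b)) -
  (- Re b / Im (Cconj a * b)) * (- Im a / Im (Cconj a * b)) <> 0.
Proof.
  unfold nondeg. destruct a as [a1 a2], b as [b1 b2]. unfold Im, Re, Cconj, Cmult; simpl. intros H.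
  replace (b2 / (a1 * b2 + - a2 * b1) * (a1 / (a1 * b2 + - a2 * b1)) -
   - b1 / (a1 * b2 + - a2 * b1) * (- a2 / (a1 * b2 + - a2 * b1))) with (/ (a1 * b2 + - a2 * b1)).
  - now apply Rinv_neq_0_compat.
  - field; lra.
Qed.

Lemma lattice_reduce a b w : nondeg a b -> exists g s t, lattice a b g /\
  0 <= s <= 1 /\ 0 <= t <= 1 /\ (w + g)%C = (RtoC s * a + RtoC t * b)%C.
Proof.
  intros H. destruct (frac_part_bound (coordX a b w)) as [m Hm].
  destruct (frac_part_bound (coordY a b w)) as [n Hn].
  exists (RtoC (IZR m) * a + RtoC (IZR n) * b)%C, (coordX a b w + IZR m), (coordY a b w + IZR n).
  split; [now exists m, n|]. split; auto. split; auto.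
  rewrite (coord_decomp a b w H) at 1. rewrite !RtoC_plus. ring.
Qed.

Lemma lattice_0 a b : lattice a b 0%C.
Proof. exists 0%Z, 0%Z. ring. Qed.
Lemma lattice_a a b : lattice a b a.
Proof. exists 1%Z, 0%Z. ring. Qed.
Lemma lattice_b a b : lattice a b b.
Proof. exists 0%Z, 1%Z. ring. Qed.

Section Coef.
Variables a1 b1 a2 b2 : C.
Hypothesis h1 : nondeg a1 b1.
Hypothesis h2 : nondeg a2 b2.

Lemma rperiodic_bounded u : (forall p : C * C, continuous u p) -> rperiodic a1 b1 a2 b2 u ->
  exists M, forall p, Rabs (u p) <= M.
Proof.
  intros Hc Hp.
  destruct (continuous_bounded_box4 (fun x y z t =>
     u ((RtoC x * a1 + RtoC y * b1)%C, (RtoC z * a2 + RtoC t * b2)%C))) as [M HM].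
  - intros x y z t. cts.
  - exists M. intros [z w].
    destruct (lattice_reduce a1 b1 z h1) as [g1 [s [t [G1 [Hs [Ht E1]]]]]].
    destruct (lattice_reduce a2 b2 w h2) as [g2 [s' [t' [G2 [Hs' [Ht' E2]]]]]].
    rewrite <- (Hp (z, w) g1 g2 G1 G2). simpl. rewrite E1, E2. now apply HM.
Qed.

Lemma pderiv_periodic u v : rperiodic a1 b1 a2 b2 u -> rperiodic a1 b1 a2 b2 (pderiv v u).
Proof.
  intros H p g1 g2 G1 G2. unfold pderiv. apply Derive_ext. intros t.
  rewrite <- (H (shiftR p v t) g1 g2 G1 G2). f_equal. unfold shiftR; simpl. f_equal; ring.
Qed.

(** Differentiability at [0] from every base point gives it all along the line, by moving the base
    point. *)
Lemma pderiv_is_derive u v p t : (forall p, ex_derive (fun t => u (shiftR p v t)) 0) ->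
  is_derive (fun t => u (shiftR p v t)) t (pderiv v u (shiftR p v t)).
Proof.
  intros H.
  assert (D := Derive_correct _ _ (H (shiftR p v t))).
  fold (pderiv v u (shiftR p v t)) in D.
  assert (K : is_derive (fun s => (fun s => u (shiftR (shiftR p v t) v s)) (s - t)) t (1 * pderiv v u (shiftR p v t))).
  { apply (is_derive_comp (fun s => u (shiftR (shiftR p v t) v s)) (fun s => s - t)).
    - now rewrite Rminus_diag.
    - auto_derive; auto; ring. }
  rewrite Rmult_1_l in K. eapply is_derive_ext; [|exact K].
  intros s; cbv beta. f_equal. unfold shiftR; simpl. rewrite RtoC_minus. f_equal; ring.
Qed.

Lemma Ck1_cont u : Ck 1 u -> forall p : C * C, continuous u p.
Proof. intros [H _]; exact H. Qed.

Lemma Ck1_lipschitz_dir u v : Ck 1 u -> rperiodic a1 b1 a2 b2 u -> coord_dir v ->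
  exists K, forall p t, Rabs (u (shiftR p v t) - u p) <= K * Rabs t.
Proof.
  intros [Hc H] Hp Hv. destruct (H v Hv) as [He [Hc' _]].
  destruct (rperiodic_bounded (pderiv v u) Hc' (pderiv_periodic u v Hp)) as [K HK].
  exists K. intros p t.
  assert (B := bounded_variation (fun t => u (shiftR p v t)) (fun t => pderiv v u (shiftR p v t)) K 0 t).
  rewrite Rminus_0_r in B.
  replace (shiftR p v 0) with p in B.
  - apply B. intros s _. split; [now apply pderiv_is_derive|apply HK].
  - destruct p as [p1 p2]; unfold shiftR; simpl; f_equal; ring.
Qed.

Lemma Ck1_lipschitz u : Ck 1 u -> rperiodic a1 b1 a2 b2 u ->
  exists K, 0 <= K /\ forall z z' w, Rabs (u (z, w) - u (z', w)) <= K * Cmod (z - z')%C.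
Proof.
  intros Hu Hp.
  destruct (Ck1_lipschitz_dir u (RtoC 1, RtoC 0) Hu Hp) as [K1 H1]; [now left|].
  destruct (Ck1_lipschitz_dir u ((0, 1) : C, RtoC 0) Hu Hp) as [K2 H2]; [now right; left|].
  exists (Rabs K1 + Rabs K2). split; [generalize (Rabs_pos K1) (Rabs_pos K2); lra|].
  intros z z' w.
  set (zm := (Re z, Im z') : C).
  specialize (H1 (z', w) (Re z - Re z')). specialize (H2 (zm, w) (Im z - Im z')).
  assert (E1 : shiftR (z', w) (RtoC 1, RtoC 0) (Re z - Re z') = (zm, w)).
  { unfold zm; destruct z, z', w; unfold shiftR, RtoC, Cplus, Cmult; simpl. f_equal; f_equal; ring. }
  assert (E2 : shiftR (zm, w) ((0, 1) : C, RtoC 0) (Im z - Im z') = (z, w)).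
  { unfold zm; destruct z, z', w; unfold shiftR, RtoC, Cplus, Cmult; simpl. f_equal; f_equal; ring. }
  rewrite E1 in H1. rewrite E2 in H2.
  replace (u (z, w) - u (z', w)) with ((u (z, w) - u (zm, w)) + (u (zm, w) - u (z', w))) by ring.
  eapply Rle_trans; [apply Rabs_triang|].
  assert (R1 : Rabs (Re z - Re z') <= Cmod (z - z')%C) by apply (Rabs_Re (z - z')%C).
  assert (R2 : Rabs (Im z - Im z') <= Cmod (z - z')%C) by apply (Rabs_Im (z - z')%C).
  assert (W : forall k x m, 0 <= x -> x <= m -> k * x <= Rabs k * m).
  { intros k x m Hx Hm. apply Rle_trans with (Rabs k * x).
    - apply Rmult_le_compat_r; auto. apply Rle_abs.
    - apply Rmult_le_compat_l; auto. apply Rabs_pos. }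
  assert (W1 := W K1 _ _ (Rabs_pos _) R1). assert (W2 := W K2 _ _ (Rabs_pos _) R2). lra.
Qed.

(** In lattice coordinates the restriction of [u] to the fibre over [e] has period [1] in both
    variables. [K] depends on [u] and [e] but not on [h], so it serves all radii and curves. *)
Lemma slice_length_area u e : Ck 1 u -> rperiodic a1 b1 a2 b2 u ->
  exists K, 0 <= K /\ forall h h' h'' : C -> C,
    (forall z, Cder h z (h' z)) -> (forall z, Cder h' z (h'' z)) -> (forall z, continuous h'' z) ->
    forall t, 0 <= t ->
    Rabs (rdisc (fun z => (u (e, h z)
       - RInt (fun s => RInt (fun t => u (e, (RtoC s * a2 + RtoC t * b2)%C)) 0 1) 0 1) * Cmod (h' z) ^ 2) t)
     <= K * rcirc (fun z => Cmod (h' z)) t.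
Proof.
  intros Hu Hp. assert (Hc := Ck1_cont u Hu). destruct Hu as [_ Hu].
  destruct (Hu (RtoC 0, RtoC 1)) as [D1 [C1 _]]; [now right; right; left|].
  destruct (Hu (RtoC 0, (0, 1) : C)) as [D2 [C2 _]]; [now right; right; right|].
  set (u1 := pderiv (RtoC 0, RtoC 1) u) in *. set (u2 := pderiv (RtoC 0, (0, 1) : C) u) in *.
  set (f := fun x y => u (e, (RtoC x * a2 + RtoC y * b2)%C)).
  (* The directional derivative along [a2], that is, the partial derivative in the first lattice
     coordinate. *)
  set (f1 := fun x y => u1 (e, (RtoC x * a2 + RtoC y * b2)%C) * Re a2 + u2 (e, (RtoC x * a2 + RtoC y * b2)%C) * Im a2).
  destruct (rperiodic_bounded u Hc Hp) as [M HM].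
  destruct (periodic_length_area f f1 M (Im b2 / Im (Cconj a2 * b2)) (- Re b2 / Im (Cconj a2 * b2))
      (- Im a2 / Im (Cconj a2 * b2)) (Re a2 / Im (Cconj a2 * b2))) as [K [K0 HK]].
  - intros p; unfold f; cts.
  - intros p; unfold f1; cts.
  - intros x y.
    assert (P1 : forall p q, is_derive (fun p => u (e, (p, q))) p (u1 (e, (p, q)))).
    { intros p q. assert (S : forall p, shiftR (e, (0, q)) (RtoC 0, RtoC 1) p = (e, (p, q))).
      { intros p'; destruct e; unfold shiftR, RtoC, Cplus, Cmult; simpl. f_equal; f_equal; ring. }
      assert (K := pderiv_is_derive u (RtoC 0, RtoC 1) (e, (0, q)) p D1). rewrite S in K.
      eapply is_derive_ext; [|exact K]. intros t; cbv beta; now rewrite S. }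
    assert (P2 : forall p q, is_derive (fun q => u (e, (p, q))) q (u2 (e, (p, q)))).
    { intros p q. assert (S : forall q, shiftR (e, (p, 0)) (RtoC 0, (0,1) : C) q = (e, (p, q))).
      { intros p'; destruct e; unfold shiftR, RtoC, Cplus, Cmult; simpl. f_equal; f_equal; ring. }
      assert (K := pderiv_is_derive u (RtoC 0, (0, 1) : C) (e, (p, 0)) q D2). rewrite S in K.
      eapply is_derive_ext; [|exact K]. intros t; cbv beta; now rewrite S. }
    assert (E : forall x, ((x * Re a2 + y * Re b2, x * Im a2 + y * Im b2) : C) = (RtoC x * a2 + RtoC y * b2)%C).
    { intros x'; destruct a2, b2; unfold RtoC, Cplus, Cmult; simpl. f_equal; ring. }
    assert (K := is_derive_comp2 (fun p q => u (e, (p, q))) (fun p q => u1 (e, (p, q))) (fun p q => u2 (e, (p, q)))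
      (fun x => x * Re a2 + y * Re b2) (fun x => x * Im a2 + y * Im b2) x (Re a2) (Im a2) P1 P2).
    cbv beta in K. rewrite E in K. fold (f1 x y) in K.
    eapply is_derive_ext; [|apply K].
    + intros t; cbv beta. now rewrite E.
    + intros p. cts.
    + auto_derive; auto. Req; ring.
    + auto_derive; auto. Req; ring.
  - intros x y. unfold f. rewrite <- (Hp (e, (RtoC x * a2 + RtoC y * b2)%C) 0%C a2 (lattice_0 _ _) (lattice_a _ _)).
    simpl. f_equal. rewrite RtoC_plus. f_equal; ring.
  - intros x y. unfold f. rewrite <- (Hp (e, (RtoC x * a2 + RtoC y * b2)%C) 0%C b2 (lattice_0 _ _) (lattice_b _ _)).
    simpl. f_equal. rewrite RtoC_plus. f_equal; ring.
  - intros x y; apply HM.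
  - now apply coord_det.
  - exists K; split; auto. intros h h' h'' Hh Hh' Hh'' t Ht.
    specialize (HK h h' h'' Hh Hh' Hh'' t Ht).
    match goal with |- Rabs ?a <= _ => match type of HK with Rabs ?b <= _ => replace a with b; [exact HK|] end end.
    unfold rdisc. apply RInt_ext. intros s _. apply RInt_ext. intros th _. f_equal. f_equal. f_equal.
    unfold f. f_equal. f_equal. symmetry. apply (coord_decomp a2 b2 (h (pol s th)) h2).
Qed.
End Coef.

(** * Concentrated curves and their currents *)

(* Instantiated by the disc and circle integrals for Ahlfors currents, and by their logarithmic
   averages for Nevanlinna currents. *)
Record area_length (r : R) (L l : (C -> R) -> R) : Prop := AreaLength {
  al_area : posfun r L;
  al_length : posfun r l;
  al_bound : forall F G K, cont F -> cont G ->
    (forall t, 0 <= t -> Rabs (rdisc F t) <= K * rcirc G t) -> Rabs (L F) <= K * l G;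
  al_pos : forall h, cont h -> (forall z, 0 <= h z) -> 0 < h (RtoC r) -> 0 < L h }.

Lemma area_length_ahlfors r : 0 < r -> area_length r (fun h => rdisc h r) (fun h => rcirc h r).
Proof.
  intros Hr; split.
  - apply rdisc_posfun; lra.
  - apply rcirc_posfun; lra.
  - intros F G K _ _ H; apply H; lra.
  - intros h H1 H2 H3. exact (proj1 (rdisc_pos h r H1 H2 Hr H3)).
Qed.

Lemma area_length_nevanlinna r : 0 < r -> area_length r (fun h => rdisc_log h r) (fun h => rcirc_log h r).
Proof.
  intros Hr; split.
  - apply rdisc_log_posfun; lra.
  - apply rcirc_log_posfun; lra.
  - intros; apply rdisc_log_bound; auto; lra.
  - intros h H1 H2 H3. exact (proj2 (rdisc_pos h r H1 H2 Hr H3)).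
Qed.

Lemma posfun_abs r L F G : posfun r L -> cont F -> cont G ->
  (forall z, Cmod z <= r -> Rabs (F z) <= G z) -> Rabs (L F) <= L G.
Proof.
  intros [P1 P2 P3] HF HG H. apply Rabs_le. split.
  - replace (- L G) with (-1 * L G) by ring. rewrite <- P2 by auto. apply P3; auto.
    + unfold cont in *; intros z; cts.
    + intros z Hz. specialize (H z Hz). apply Rabs_le_between in H. lra.
  - apply P3; auto. intros z Hz. specialize (H z Hz). apply Rabs_le_between in H. lra.
Qed.

Definition dens (g : curve) (z : C) : R := Cmod (dg1 g z) ^ 2 + Cmod (dg2 g z) ^ 2.

Definition twice_diff (g : curve) : Prop :=
  (forall z, Cder (g1 g) z (dg1 g z)) /\ (forall z, Cder (g2 g) z (dg2 g z)) /\
  (exists d, (forall z, Cder (dg1 g) z (d z)) /\ forall z, continuous d z) /\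
  (exists d, (forall z, Cder (dg2 g) z (d z)) /\ forall z, continuous d z).

(** Besides positive area: the length is negligible, so Green applies; the first component has
    negligible area, which removes all coefficients but [c22]; and [g1] is close to [e] on average
    for the area of the second component, which is what a Lipschitz coefficient requires. *)
Definition concentrated (L l : (C -> R) -> R) (g : curve) (e : C) (eps : R) : Prop :=
  0 < L (dens g) /\
  l (fun z => sqrt (dens g z)) <= eps * L (dens g) /\
  L (fun z => Cmod (dg1 g z) ^ 2) <= eps * L (dens g) /\
  L (fun z => Cmod (g1 g z - e)%C * Cmod (dg2 g z) ^ 2) <= eps * L (dens g).

Lemma young_tau a b t : 0 < t -> 2 * (a * b) <= / t * a ^ 2 + t * b ^ 2.
Proof.
  intros Ht. apply Rmult_le_reg_l with t; auto.
  replace (t * (/ t * a ^ 2 + t * b ^ 2)) with (a ^ 2 + (t * b) ^ 2) by (field; lra).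
  generalize (pow2_ge_0 (a - t * b)). nra.
Qed.

Section Criterion.
Variables a1 b1 a2 b2 : C.
Hypothesis h1 : nondeg a1 b1.
Hypothesis h2 : nondeg a2 b2.

(** [v] stands for the real or imaginary part of a pulled-back form, and [u] for that of [c22]. A
    weighted Young inequality bounds the cross term; the weight [sqrt eps] balances the first
    component, of area at most [eps * L (dens g)], against the second, and is the origin of
    [sqrt eps]. [K] is fixed before the radius, the functionals and the curve, so the estimate can
    be used along a sequence. *)
Lemma concentrated_estimate u e1 M : Ck 1 u -> rperiodic a1 b1 a2 b2 u -> 0 <= M ->
  exists K, 0 <= K /\ forall r L l g e eps v,
    area_length r L l -> twice_diff g -> 0 < eps <= 1 -> concentrated L l g e eps -> cont v ->
    (forall z, Rabs (v z - u (g1 g z, g2 g z) * Cmod (dg2 g z) ^ 2)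
       <= M * (Cmod (dg1 g z) ^ 2 + 2 * (Cmod (dg1 g z) * Cmod (dg2 g z)))) ->
    Rabs (L v - RInt (fun s => RInt (fun t => u (e1, (RtoC s * a2 + RtoC t * b2)%C)) 0 1) 0 1 * L (dens g))
      <= K * (sqrt eps + Cmod (e - e1)%C) * L (dens g).
Proof.
  intros Hu Hp HM.
  destruct (Ck1_lipschitz a1 b1 a2 b2 h1 h2 u Hu Hp) as [K1 [K10 HK1]].
  destruct (slice_length_area a1 b1 a2 b2 h1 h2 u e1 Hu Hp) as [K2 [K20 HK2]].
  assert (Cu := Ck1_cont u Hu).
  set (m := RInt (fun s => RInt (fun t => u (e1, (RtoC s * a2 + RtoC t * b2)%C)) 0 1) 0 1) in *.
  exists (3 * M + Rabs m + K1 + K1 + K2). split; [generalize (Rabs_pos m); lra|].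
  intros r L l g e eps v HL Hg He [A0 [Hl [HA1 HA2]]] Cv Hv.
  destruct Hg as [D1 [D2 [[dd1 [D1' C1']] [dd2 [D2' C2']]]]].
  set (A := L (dens g)) in *. set (tau := sqrt eps).
  assert (Ht : 0 < tau) by (apply sqrt_lt_R0; lra).
  assert (Ett : tau * tau = eps) by (apply sqrt_sqrt; lra).
  assert (Het : eps <= tau).
  { rewrite <- Ett. assert (tau <= 1) by (rewrite <- sqrt_1; apply sqrt_le_1_alt; lra). nra. }
  assert (cg1 : forall z, continuous (g1 g) z) by (intros z; eapply Cder_cont, D1).
  assert (cg2 : forall z, continuous (g2 g) z) by (intros z; eapply Cder_cont, D2).
  assert (cdg1 : forall z, continuous (dg1 g) z) by (intros z; eapply Cder_cont, D1').
  assert (cdg2 : forall z, continuous (dg2 g) z) by (intros z; eapply Cder_cont, D2').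
  set (p := fun z => Cmod (dg1 g z) ^ 2). set (q := fun z => Cmod (dg2 g z) ^ 2).
  set (s := fun z => Cmod (g1 g z - e)%C * Cmod (dg2 g z) ^ 2).
  assert (cp : forall z, continuous p z) by (intros z; unfold p; cts).
  assert (cq : forall z, continuous q z) by (intros z; unfold q; cts).
  assert (cs : forall z, continuous s z) by (intros z; unfold s; cts).
  set (F := fun z => (u (e1, g2 g z) - m) * Cmod (dg2 g z) ^ 2).
  assert (cF : forall z, continuous F z) by (intros z; unfold F; cts).
  destruct HL as [PL Pl Hb _]. destruct PL as [L1 L2 L3].
  assert (PL : posfun r L) by (split; auto).
  assert (EA : A = L p + L q) by (unfold A, p, q; rewrite <- L1; auto).
  assert (Lp0 : 0 <= L p).
  { replace 0 with (0 * L p) by ring. rewrite <- L2 by auto. apply L3; auto; [intros z; cts|].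
    intros; unfold p; generalize (pow2_ge_0 (Cmod (dg1 g z))); lra. }
  assert (Lq0 : L q <= A) by lra.
  (* The coefficients of [p] and [q]: the large [/ tau] meets an integral bounded by
     [eps * A = tau * tau * A], the small [tau] meets the bulk. *)
  set (Ka := M + M * / tau + Rabs m). set (Kb := M * tau + K1 * Cmod (e - e1)%C).
  assert (E1 : Rabs (L (fun z => v z + -1 * (m * dens g z) + -1 * F z)) <=
     L (fun z => Ka * p z + Kb * q z + K1 * s z)).
  { apply (posfun_abs r); [exact PL| | |].
    - unfold cont in Cv. intros z. unfold dens. cts.
    - intros z; cts.
    - intros z _.
      set (P := Cmod (dg1 g z)). set (Q := Cmod (dg2 g z)).
      specialize (Hv z). fold P Q in Hv.
      assert (Y := young_tau P Q tau Ht).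
      assert (Lz := HK1 (g1 g z) e1 (g2 g z)).
      assert (Tr : Cmod (g1 g z - e1)%C <= Cmod (g1 g z - e)%C + Cmod (e - e1)%C).
      { replace (g1 g z - e1)%C with ((g1 g z - e) + (e - e1))%C by ring. apply Cmod_triangle. }
      unfold dens, F, p, q, s. fold P Q.
      (* After subtraction of the Green term [F] there remain the other coefficients, the move of
         the base point from [g1 g z] to [e1], and the mean times the area of the first
         component. *)
      replace (v z + -1 * (m * (P ^ 2 + Q ^ 2)) + -1 * ((u (e1, g2 g z) - m) * Q ^ 2)) with
        ((v z - u (g1 g z, g2 g z) * Q ^ 2) + (u (g1 g z, g2 g z) - u (e1, g2 g z)) * Q ^ 2 + - (m * P ^ 2)) by ring.
      eapply Rle_trans; [apply Rabs_triang|]. eapply Rle_trans; [apply Rplus_le_compat_r, Rabs_triang|].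
      rewrite Rabs_Ropp, !Rabs_mult. rewrite !(Rabs_pos_eq (_ ^ 2)) by apply pow2_ge_0.
      assert (Q2 := pow2_ge_0 Q). assert (P2 := pow2_ge_0 P).
      assert (B1 : M * (P ^ 2 + 2 * (P * Q)) <= M * (P ^ 2 + (/ tau * P ^ 2 + tau * Q ^ 2))) by (apply Rmult_le_compat_l; lra).
      assert (B2 : Rabs (u (g1 g z, g2 g z) - u (e1, g2 g z)) * Q ^ 2 <= K1 * (Cmod (g1 g z - e)%C + Cmod (e - e1)%C) * Q ^ 2).
      { apply Rmult_le_compat_r; auto. eapply Rle_trans; [exact Lz|]. now apply Rmult_le_compat_l. }
      unfold Ka, Kb. lra. }
  assert (E2 : L (fun z => v z + -1 * (m * dens g z) + -1 * F z) = L v - m * A - L F).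
  { assert (cd : cont (dens g)) by (intros z; unfold dens; cts). unfold cont in Cv, cd.
    rewrite L1 by (intros z; cts). rewrite L1 by (intros z; cts).
    rewrite !L2 by (intros z; cts). unfold A; ring. }
  assert (E3 : L (fun z => Ka * p z + Kb * q z + K1 * s z) = Ka * L p + Kb * L q + K1 * L s).
  { rewrite L1 by (intros z; cts). rewrite L1 by (intros z; cts). rewrite !L2 by (intros z; cts). ring. }
  assert (E4 : Rabs (L F) <= K2 * (eps * A)).
  { eapply Rle_trans; [apply (Hb F (fun z => Cmod (dg2 g z)) K2)|].
    - exact cF.
    - intros z; cts.
    - intros t Ht0. apply (HK2 (g2 g) (dg2 g) dd2 D2 D2' C2' t Ht0).
    - apply Rmult_le_compat_l; auto. eapply Rle_trans; [|exact Hl].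
      apply (pf_le _ _ Pl).
      + intros z; cts.
      + intros z; unfold dens; cts.
      + intros z _. rewrite <- (sqrt_pow2 (Cmod (dg2 g z))) by apply Cmod_ge_0.
        apply sqrt_le_1_alt. unfold dens. generalize (pow2_ge_0 (Cmod (dg1 g z))). lra. }
  fold m. rewrite E2, E3 in E1.
  assert (Itau : / tau * eps = tau) by (rewrite <- Ett; field; lra).
  assert (It : 0 < / tau) by (now apply Rinv_0_lt_compat).
  assert (Ec := Cmod_ge_0 (e - e1)%C). assert (Em := Rabs_pos m).
  assert (T1 : Ka * L p <= Ka * (eps * A)).
  { apply Rmult_le_compat_l; [unfold Ka|exact HA1]. generalize (Rmult_le_pos M (/ tau) HM (Rlt_le _ _ It)); lra. }
  assert (T2 : Kb * L q <= Kb * A).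
  { apply Rmult_le_compat_l; auto. unfold Kb. generalize (Rmult_le_pos M tau HM (Rlt_le _ _ Ht)) (Rmult_le_pos K1 _ K10 Ec); lra. }
  assert (T3 : K1 * L s <= K1 * (eps * A)) by (apply Rmult_le_compat_l; auto).
  replace (L v - m * A) with ((L v - m * A - L F) + L F) by ring.
  eapply Rle_trans; [apply Rabs_triang|].
  assert (T4 : Ka * (eps * A) = (M + Rabs m) * (eps * A) + M * tau * A).
  { unfold Ka. rewrite <- Itau at 2. ring. }
  assert (T5 : eps * A <= tau * A) by (apply Rmult_le_compat_r; lra).
  assert (T6 : (M + Rabs m) * (eps * A) <= (M + Rabs m) * (tau * A)) by (apply Rmult_le_compat_l; lra).
  assert (T7 : K1 * (eps * A) <= K1 * (tau * A)) by (now apply Rmult_le_compat_l).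
  assert (T8 : K2 * (eps * A) <= K2 * (tau * A)) by (now apply Rmult_le_compat_l).
  fold tau.
  apply Rle_trans with ((M + Rabs m) * (tau * A) + M * tau * A + Kb * A + K1 * (tau * A) + K2 * (tau * A)); [lra|].
  unfold Kb. set (c := Cmod (e - e1)%C) in *.
  assert (N1 : 0 <= (3 * M + Rabs m + K1 + K2) * (c * A)).
  { apply Rmult_le_pos; [lra|]. apply Rmult_le_pos; lra. }
  assert (N2 : 0 <= K1 * (tau * A)) by (apply Rmult_le_pos; [auto|apply Rmult_le_pos; lra]).
  replace ((3 * M + Rabs m + K1 + K1 + K2) * (tau + c) * A) with
    ((3 * M + Rabs m + K1 + K2) * (tau * A) + K1 * (tau * A) + K1 * (c * A) + (3 * M + Rabs m + K1 + K2) * (c * A)) by ring.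
  lra.
Qed.
End Criterion.

Lemma Cder_const_on_disc f z l r c : Cder f z l -> Cmod z < r ->
  (forall w, Cmod w < r -> f w = c) -> l = 0%C.
Proof.
  intros H Hz Hc. apply Cmod_eq_0. apply Rle_antisym; [|apply Cmod_ge_0].
  apply le_epsilon. intros e He. rewrite Rplus_0_l.
  destruct (H e He) as [d [Hd Hw]].
  set (x := Rmin (d/2) ((r - Cmod z)/2)).
  assert (Hx : 0 < x) by (apply Rmin_pos; lra).
  assert (Hx1 : x <= d/2) by apply Rmin_l. assert (Hx2 : x <= (r - Cmod z)/2) by apply Rmin_r.
  specialize (Hw (z + RtoC x)%C).
  replace (z + RtoC x - z)%C with (RtoC x) in Hw by ring. rewrite Cmod_R, Rabs_pos_eq in Hw by lra.
  assert (Hr : Cmod (z + RtoC x)%C < r).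
  { eapply Rle_lt_trans; [apply Cmod_triangle|]. rewrite Cmod_R, Rabs_pos_eq by lra. lra. }
  rewrite !Hc in Hw by auto. replace (c - c - l * RtoC x)%C with (- (l * RtoC x))%C in Hw by ring.
  rewrite Cmod_opp, Cmod_mult, Cmod_R, Rabs_pos_eq in Hw by lra.
  specialize (Hw ltac:(lra)). now apply Rmult_le_reg_r in Hw.
Qed.

Lemma nonconst_on_of_area g r : 0 < r -> twice_diff g -> 0 < rdisc (dens g) r -> nonconst_on g r.
Proof.
  intros Hr [D1 [D2 _]] HA. apply NNPP; intros Hn.
  assert (N : forall w, Cmod w < r -> g1 g w = g1 g 0%C /\ g2 g w = g2 g 0%C).
  { intros w Hw. split; apply NNPP; intros H; apply Hn; exists w; auto. }
  assert (Z : rdisc (dens g) r = 0).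
  { unfold rdisc. rewrite (RInt_ext _ (fun _ => 0)); [rewrite RInt_const; apply Rmult_0_r|].
    intros s Hs. rewrite Rmin_left, Rmax_right in Hs by lra.
    unfold rcirc. rewrite (RInt_ext _ (fun _ => 0)); [rewrite RInt_const; apply Rmult_0_r|].
    intros th _. unfold dens.
    assert (Hz : Cmod (pol s th) < r) by (rewrite Cmod_pol; lra).
    rewrite (Cder_const_on_disc _ _ _ r _ (D1 (pol s th)) Hz (fun w Hw => proj1 (N w Hw))).
    rewrite (Cder_const_on_disc _ _ _ r _ (D2 (pol s th)) Hz (fun w Hw => proj2 (N w Hw))).
    rewrite Cmod_0. Req; ring. }
  lra.
Qed.

(** * Currents expressed by real integrals *)

Lemma image_current_eq g r eta : image_current g r eta =
  (rdisc (fun z => Re (pull eta g z)) r, rdisc (fun z => Im (pull eta g z)) r).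
Proof.
  unfold image_current, disc_int, CInt. f_equal; apply RInt_ext; intros s _; apply RInt_ext; intros th _;
  unfold Re, Im; simpl; ring.
Qed.

Lemma Tnev_eq g r eta : Tnev g r eta =
  (rdisc_log (fun z => Re (pull eta g z)) r, rdisc_log (fun z => Im (pull eta g z)) r).
Proof.
  unfold Tnev, CInt, rdisc_log.
  f_equal; apply RInt_ext; intros t Ht; change (disc_int (pull eta g) t) with (image_current g t eta);
  rewrite image_current_eq;
  (assert (t <> 0) by (unfold Rmin, Rmax in Ht; destruct (Rle_dec 0 r); lra));
  unfold Re, Im, Cdiv, Cmult, Cinv, RtoC; simpl; field; auto.
Qed.

Lemma Cmult_conj_mod (c d : C) : (c * d * Cconj d)%C = (c * RtoC (Cmod d ^ 2))%C.
Proof.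
  rewrite Cmod_sqr. destruct c, d; unfold Cmult, Cconj, RtoC, Re, Im; simpl; f_equal; ring.
Qed.

Lemma pull_omega g z : pull omega g z = RtoC (dens g z).
Proof.
  unfold pull, omega; simpl. rewrite !Cmult_conj_mod. unfold dens. rewrite RtoC_plus. ring.
Qed.

Lemma rdisc_ext f g r : (forall z, f z = g z) -> rdisc f r = rdisc g r.
Proof. intros H; apply RInt_ext; intros s _; apply RInt_ext; intros th _; now rewrite H. Qed.
Lemma rdisc_log_ext f g r : (forall z, f z = g z) -> rdisc_log f r = rdisc_log g r.
Proof. intros H; apply RInt_ext; intros s _. now rewrite (rdisc_ext f g). Qed.

Lemma Area_eq g r : Area g r = rdisc (dens g) r.
Proof. unfold Area. rewrite image_current_eq. apply rdisc_ext. intros z; now rewrite pull_omega. Qed.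
Lemma Tnev_omega_eq g r : Re (Tnev g r omega) = rdisc_log (dens g) r.
Proof. rewrite Tnev_eq. apply rdisc_log_ext. intros z; now rewrite pull_omega. Qed.

Lemma Re_scal c x : Re (c * RtoC x)%C = Re c * x.
Proof. destruct c; unfold Re; simpl; ring. Qed.
Lemma Im_scal c x : Im (c * RtoC x)%C = Im c * x.
Proof. destruct c; unfold Im; simpl; ring. Qed.

Lemma pull_main_term eta g M z :
  (forall p, Cmod (c11 eta p) <= M) -> (forall p, Cmod (c12 eta p) <= M) -> (forall p, Cmod (c21 eta p) <= M) ->
  Cmod (pull eta g z - c22 eta (g1 g z, g2 g z) * RtoC (Cmod (dg2 g z) ^ 2))%C <=
    M * (Cmod (dg1 g z) ^ 2 + 2 * (Cmod (dg1 g z) * Cmod (dg2 g z))).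
Proof.
  intros H1 H2 H3. unfold pull. rewrite !Cmult_conj_mod.
  set (p := (g1 g z, g2 g z)). specialize (H1 p); specialize (H2 p); specialize (H3 p).
  set (A := dg1 g z). set (B := dg2 g z).
  match goal with |- Cmod ?x <= _ => replace x with
    (c11 eta p * RtoC (Cmod A ^ 2) + c12 eta p * A * Cconj B + c21 eta p * B * Cconj A)%C by ring end.
  eapply Rle_trans; [apply Cmod_triangle|]. eapply Rle_trans; [apply Rplus_le_compat_r, Cmod_triangle|].
  rewrite !Cmod_mult, !Cmod_conj, Cmod_R, Rabs_pos_eq by apply pow2_ge_0.
  assert (0 <= Cmod A * Cmod B) by (apply Rmult_le_pos; apply Cmod_ge_0).
  assert (Cmod (c11 eta p) * Cmod A ^ 2 <= M * Cmod A ^ 2) by (apply Rmult_le_compat_r; auto; apply pow2_ge_0).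
  assert (Cmod (c12 eta p) * (Cmod A * Cmod B) <= M * (Cmod A * Cmod B)) by (now apply Rmult_le_compat_r).
  assert (Cmod (c21 eta p) * (Cmod A * Cmod B) <= M * (Cmod A * Cmod B)) by (now apply Rmult_le_compat_r).
  lra.
Qed.

Lemma is_lim_seq_dominated (u w : nat -> R) : (forall n, Rabs (u n) <= w n) -> is_lim_seq w 0 -> is_lim_seq u 0.
Proof.
  intros H Hw. apply is_lim_seq_abs_0. apply (is_lim_seq_le_le (fun _ => 0) _ w); auto using is_lim_seq_const.
  intros n; split; auto using Rabs_pos.
Qed.

Lemma is_lim_seq_ratio (u A w : nat -> R) (m : R) : (forall n, 0 < A n) ->
  (forall n, Rabs (u n - m * A n) <= w n * A n) -> is_lim_seq w 0 -> is_lim_seq (fun n => u n / A n) m.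
Proof.
  intros HA H Hw.
  apply (is_lim_seq_ext (fun n => (u n - m * A n) / A n + m)).
  - intros n. specialize (HA n). field; lra.
  - replace (Finite m) with (Finite (0 + m)) by (now rewrite Rplus_0_l).
    apply is_lim_seq_plus'; [|apply is_lim_seq_const].
    apply (is_lim_seq_dominated _ w); auto. intros n. specialize (HA n). specialize (H n).
    unfold Rdiv. rewrite Rabs_mult, (Rabs_pos_eq (/ A n)) by (apply Rlt_le, Rinv_0_lt_compat; auto).
    apply Rmult_le_reg_r with (A n); auto. rewrite Rmult_assoc, Rinv_l by lra. lra.
Qed.

Section Currents.
Variables a1 b1 a2 b2 : C.
Hypothesis h1 : nondeg a1 b1.
Hypothesis h2 : nondeg a2 b2.

Lemma smoothC_Re f : smoothC f -> Ck 1 (fun p => Re (f p)).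
Proof. intros H; exact (proj1 (H 1%nat)). Qed.
Lemma smoothC_Im f : smoothC f -> Ck 1 (fun p => Im (f p)).
Proof. intros H; exact (proj2 (H 1%nat)). Qed.
Lemma periodic_Re f : periodic a1 b1 a2 b2 f -> rperiodic a1 b1 a2 b2 (fun p => Re (f p)).
Proof. intros H p x y Hx Hy. now rewrite H. Qed.
Lemma periodic_Im f : periodic a1 b1 a2 b2 f -> rperiodic a1 b1 a2 b2 (fun p => Im (f p)).
Proof. intros H p x y Hx Hy. now rewrite H. Qed.
Lemma smoothC_cont f : smoothC f -> forall p : C * C, continuous f p.
Proof. intros H p. apply ct_C; [apply (Ck1_cont _ (smoothC_Re f H))|apply (Ck1_cont _ (smoothC_Im f H))]. Qed.

Lemma coef_bounded f : smoothC f -> periodic a1 b1 a2 b2 f -> exists M, forall p, Cmod (f p) <= M.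
Proof.
  intros Hs Hp.
  destruct (rperiodic_bounded a1 b1 a2 b2 h1 h2 _ (Ck1_cont _ (smoothC_Re f Hs)) (periodic_Re f Hp)) as [M1 H1].
  destruct (rperiodic_bounded a1 b1 a2 b2 h1 h2 _ (Ck1_cont _ (smoothC_Im f Hs)) (periodic_Im f Hp)) as [M2 H2].
  exists (M1 + M2). intros p. eapply Rle_trans; [apply Cmod_le_ReIm|]. specialize (H1 p); specialize (H2 p); lra.
Qed.

(** The full sequence converges on every test form, so the value of every subsequential current is
    forced. The targets [e n] need only approach [e1]. *)
Lemma concentrated_limit (g : curve) (r eps : nat -> R) (e : nat -> C) (e1 : C)
    (L l : nat -> (C -> R) -> R) eta :
  twice_diff g -> (forall n, area_length (r n) (L n) (l n)) -> (forall n, 0 < eps n <= 1) ->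
  is_lim_seq eps 0 -> is_lim_seq (fun n => Cmod (e n - e1)%C) 0 ->
  (forall n, concentrated (L n) (l n) g (e n) (eps n)) -> test_form a1 b1 a2 b2 eta ->
  filterlim (fun n => ((L n (fun z => Re (pull eta g z)), L n (fun z => Im (pull eta g z))) / RtoC (L n (dens g)))%C)
    eventually (locally (CInt (fun s => CInt (fun t => c22 eta (e1, (RtoC s * a2 + RtoC t * b2)%C)) 0 1) 0 1)).
Proof.
  intros Hg HL He Leps Le HC [S11 [S12 [S21 [S22 [P11 [P12 [P21 P22]]]]]]].
  destruct (coef_bounded _ S11 P11) as [M1 B1]. destruct (coef_bounded _ S12 P12) as [M2 B2].
  destruct (coef_bounded _ S21 P21) as [M3 B3].
  set (M := Rmax M1 (Rmax M2 M3)).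
  assert (HM1 : M1 <= M) by apply Rmax_l.
  assert (HM2 : M2 <= M) by (eapply Rle_trans; [apply Rmax_l|apply Rmax_r]).
  assert (HM3 : M3 <= M) by (eapply Rle_trans; [apply Rmax_r|apply Rmax_r]).
  assert (M0 : 0 <= M).
  { eapply Rle_trans; [|exact HM1]. eapply Rle_trans; [apply Cmod_ge_0|apply (B1 (RtoC 0, RtoC 0))]. }
  assert (PM := fun z => pull_main_term eta g M z
     (fun p => Rle_trans _ _ _ (B1 p) HM1) (fun p => Rle_trans _ _ _ (B2 p) HM2) (fun p => Rle_trans _ _ _ (B3 p) HM3)).
  destruct (concentrated_estimate a1 b1 a2 b2 h1 h2 (fun p => Re (c22 eta p)) e1 M
     (smoothC_Re _ S22) (periodic_Re _ P22) M0) as [K [K0 HK]].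
  destruct (concentrated_estimate a1 b1 a2 b2 h1 h2 (fun p => Im (c22 eta p)) e1 M
     (smoothC_Im _ S22) (periodic_Im _ P22) M0) as [K' [K0' HK']].
  assert (Cp : forall z, continuous (pull eta g) z).
  { destruct Hg as [D1 [D2 [[dd1 [D1' C1']] [dd2 [D2' C2']]]]].
    assert (cg1 : forall z, continuous (g1 g) z) by (intros z; eapply Cder_cont, D1).
    assert (cg2 : forall z, continuous (g2 g) z) by (intros z; eapply Cder_cont, D2).
    assert (cdg1 : forall z, continuous (dg1 g) z) by (intros z; eapply Cder_cont, D1').
    assert (cdg2 : forall z, continuous (dg2 g) z) by (intros z; eapply Cder_cont, D2').
    assert (q11 := smoothC_cont _ S11). assert (q12 := smoothC_cont _ S12).
    assert (q21 := smoothC_cont _ S21). assert (q22 := smoothC_cont _ S22).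
    intros z. unfold pull. cts. }
  assert (LW : forall K, is_lim_seq (fun n => K * (sqrt (eps n) + Cmod (e n - e1)%C)) 0).
  { intros k. replace (Finite 0) with (Rbar_mult k 0) by (simpl; now rewrite Rmult_0_r).
    apply is_lim_seq_scal_l. replace (Finite 0) with (Finite (0 + 0)) by (now rewrite Rplus_0_l).
    apply is_lim_seq_plus'; auto. replace 0 with (sqrt 0) by apply sqrt_0.
    apply (is_lim_seq_continuous sqrt eps 0); auto. apply continuity_pt_filterlim, continuous_sqrt. }
  assert (HA : forall n, 0 < L n (dens g)) by (intros n; apply (HC n)).
  assert (R1 : is_lim_seq (fun n => L n (fun z => Re (pull eta g z)) / L n (dens g))
     (RInt (fun s => RInt (fun t => Re (c22 eta (e1, (RtoC s * a2 + RtoC t * b2)%C))) 0 1) 0 1)).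
  { eapply is_lim_seq_ratio; [exact HA| |exact (LW K)].
    intros n. apply (HK (r n) (L n) (l n)); auto.
    - intros z; cts.
    - intros z. eapply Rle_trans; [|apply (PM z)]. rewrite <- Re_scal.
      eapply Rle_trans; [|apply Rabs_Re]. right; f_equal. }
  assert (R2 : is_lim_seq (fun n => L n (fun z => Im (pull eta g z)) / L n (dens g))
     (RInt (fun s => RInt (fun t => Im (c22 eta (e1, (RtoC s * a2 + RtoC t * b2)%C))) 0 1) 0 1)).
  { eapply is_lim_seq_ratio; [exact HA| |exact (LW K')].
    intros n. apply (HK' (r n) (L n) (l n)); auto.
    - intros z; cts.
    - intros z. eapply Rle_trans; [|apply (PM z)]. rewrite <- Im_scal.
      eapply Rle_trans; [|apply Rabs_Im]. right; f_equal. }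
  unfold CInt; simpl.
  apply (filterlim_ext (fun n => (L n (fun z => Re (pull eta g z)) / L n (dens g), L n (fun z => Im (pull eta g z)) / L n (dens g)))).
  - intros n. specialize (HA n). unfold Cdiv, Cmult, Cinv, RtoC; simpl. f_equal; field; lra.
  - intros P [d Hd].
    destruct (R1 (ball _ d) (locally_ball _ d)) as [N1 HN1]. destruct (R2 (ball _ d) (locally_ball _ d)) as [N2 HN2].
    exists (max N1 N2). intros n Hn. apply Hd. split; [apply HN1|apply HN2]; lia.
Qed.

Lemma subseq_eventually phi : subseq phi -> filterlim phi eventually eventually.
Proof.
  intros H.
  assert (G : forall n, (n <= phi n)%nat).
  { induction n as [|n IH]; [lia|]. specialize (H n). lia. }
  intros P [N HN]. exists N. intros n Hn. apply HN. specialize (G n). lia.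
Qed.

(** The limit is the mean of [c22] over the fibre, and the fibre current is that mean times the area
    of the fundamental parallelogram; the multiple is therefore the reciprocal of this area. *)
Lemma fiber1_of_limit e1 (u : nat -> form11 -> C) T phi : subseq phi ->
  (forall eta, test_form a1 b1 a2 b2 eta -> filterlim (fun n => u n eta) eventually
     (locally (CInt (fun s => CInt (fun t => c22 eta (e1, (RtoC s * a2 + RtoC t * b2)%C)) 0 1) 0 1))) ->
  (forall eta, test_form a1 b1 a2 b2 eta -> filterlim (fun n => u (phi n) eta) eventually (locally (T eta))) ->
  positive_multiple a1 b1 a2 b2 T (fiber1_current a2 b2 e1).
Proof.
  intros Hphi H1 H2.
  assert (D : 0 < Rabs (Im (Cconj a2 * b2))) by (now apply Rabs_pos_lt).
  exists (/ Rabs (Im (Cconj a2 * b2))). split; [now apply Rinv_0_lt_compat|].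
  intros eta Heta. unfold fiber1_current.
  rewrite Cmult_assoc, <- RtoC_mult, Rinv_l, Cmult_1_l by lra.
  apply (filterlim_locally_unique (V := C_NormedModule) (F := eventually) (fun n => u (phi n) eta)).
  - now apply H2.
  - apply (filterlim_comp _ _ _ phi (fun n => u n eta) _ eventually); auto. now apply subseq_eventually.
Qed.

Lemma fiber1_criterion (g : curve) (r eps : nat -> R) (e : nat -> C) (e1 : C) :
  twice_diff g -> (forall n, 0 < r n) -> (forall n, 0 < eps n <= 1) ->
  is_lim_seq eps 0 -> is_lim_seq (fun n => Cmod (e n - e1)%C) 0 ->
  (forall n, concentrated (fun h => rdisc h (r n)) (fun h => rcirc h (r n)) g (e n) (eps n)) ->
  (forall n, concentrated (fun h => rdisc_log h (r n)) (fun h => rcirc_log h (r n)) g (e n) (eps n)) ->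
  produces_nevanlinna g r /\ produces_ahlfors g r /\
  (forall T, nevanlinna_current a1 b1 a2 b2 g r T ->
     positive_multiple a1 b1 a2 b2 T (fiber1_current a2 b2 e1)) /\
  (forall T, ahlfors_current a1 b1 a2 b2 g r T ->
     positive_multiple a1 b1 a2 b2 T (fiber1_current a2 b2 e1)).
Proof.
  intros Hg Hr He Leps Le CA CN.
  assert (NC : forall n, nonconst_on g (r n)).
  { intros n. apply nonconst_on_of_area; auto. apply (CA n). }
  assert (Rt : forall L l, (forall n, concentrated (L n) (l n) g (e n) (eps n)) ->
     (forall n, posfun (r n) (l n)) -> is_lim_seq (fun n => l n (fun z => sqrt (dens g z)) / L n (dens g)) 0).
  { intros L l HC Pl. apply (is_lim_seq_ratio _ _ eps); auto.
    - intros n; apply (HC n).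
    - intros n. destruct (HC n) as [A0 [Hl _]]. rewrite Rmult_0_l, Rminus_0_r, Rabs_pos_eq; auto.
      destruct Hg as [D1 [D2 [[dd1 [D1' C1']] [dd2 [D2' C2']]]]].
      assert (cdg1 : forall z, continuous (dg1 g) z) by (intros z; eapply Cder_cont, D1').
      assert (cdg2 : forall z, continuous (dg2 g) z) by (intros z; eapply Cder_cont, D2').
      assert (cs : cont (fun z => sqrt (dens g z))) by (intros z; unfold dens; cts).
      replace 0 with (0 * l n (fun z => sqrt (dens g z))) by ring.
      rewrite <- (pf_scal _ _ (Pl n)) by auto. apply (pf_le _ _ (Pl n)); auto.
      + intros z; unfold dens; cts.
      + intros z _. generalize (sqrt_pos (dens g z)); lra. }
  split; [|split; [|split]].
  - split; auto.
    (* By conversion, [Lnev] and [bdry_length] are already [rcirc_log] and [rcirc] of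
       [sqrt (dens g)]; only the area terms are rewritten. *)
    apply (is_lim_seq_ext (fun n => rcirc_log (fun z => sqrt (dens g z)) (r n) / rdisc_log (dens g) (r n))).
    + intros n. now rewrite Tnev_omega_eq.
    + apply (Rt (fun n h => rdisc_log h (r n)) (fun n h => rcirc_log h (r n))); auto.
      intros n; apply rcirc_log_posfun, Rlt_le, Hr.
  - split; auto.
    apply (is_lim_seq_ext (fun n => rcirc (fun z => sqrt (dens g z)) (r n) / rdisc (dens g) (r n))).
    + intros n. now rewrite Area_eq.
    + apply (Rt (fun n h => rdisc h (r n)) (fun n h => rcirc h (r n))); auto.
      intros n; apply rcirc_posfun, Rlt_le, Hr.
  - intros T [phi [Hphi HT]].
    apply (fiber1_of_limit e1 (fun n eta => (Tnev g (r n) eta / RtoC (Re (Tnev g (r n) omega)))%C) T phi); auto.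
    intros eta Heta.
    eapply filterlim_ext; [|apply (concentrated_limit g r eps e e1 (fun n h => rdisc_log h (r n)) (fun n h => rcirc_log h (r n)) eta); auto].
    + intros n; cbv beta. now rewrite Tnev_omega_eq, Tnev_eq.
    + intros n. now apply area_length_nevanlinna.
  - intros T [phi [Hphi HT]].
    apply (fiber1_of_limit e1 (fun n eta => (image_current g (r n) eta / RtoC (Area g (r n)))%C) T phi); auto.
    intros eta Heta.
    eapply filterlim_ext; [|apply (concentrated_limit g r eps e e1 (fun n h => rdisc h (r n)) (fun n h => rcirc h (r n)) eta); auto].
    + intros n; cbv beta. now rewrite Area_eq, image_current_eq.
    + intros n. now apply area_length_ahlfors.
Qed.
End Currents.

(** * Exchange of the two factors *)

Definition swapC (p : C * C) : C * C := (snd p, fst p).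
Definition swap_curve (g : curve) : curve := Curve (g2 g) (g1 g) (dg2 g) (dg1 g).
(** Pull-back by the exchange of factors, which exchanges both indices; hence [c12] and [c21] trade
    places as well. The second half of the theorem becomes the first half for the exchanged
    torus. *)
Definition swap_form (eta : form11) : form11 :=
  Form11 (fun p => c22 eta (swapC p)) (fun p => c21 eta (swapC p))
         (fun p => c12 eta (swapC p)) (fun p => c11 eta (swapC p)).

Lemma swapC_invol p : swapC (swapC p) = p.
Proof. now destruct p. Qed.

Lemma swap_form_invol eta : swap_form (swap_form eta) = eta.
Proof.
  destruct eta as [x11 x12 x21 x22]. unfold swap_form; simpl.
  f_equal; apply functional_extensionality; intros p; now rewrite swapC_invol.
Qed.

Lemma pull_swap eta g : pull eta (swap_curve g) = pull (swap_form eta) g.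
Proof. apply functional_extensionality; intros z. unfold pull; simpl. unfold swapC; simpl. ring. Qed.

Lemma dens_swap g : dens (swap_curve g) = dens g.
Proof. apply functional_extensionality; intros z. unfold dens; simpl. ring. Qed.

(** The derivative of [f] composed with the swap along [v] converts to the derivative of [f] along
    [swapC v], composed with the swap, so the induction hypothesis applies as it stands. *)
Lemma Ck_swap k : forall f, Ck k f -> Ck k (fun p => f (swapC p)).
Proof.
  induction k as [|k IH]; intros f [Hc H].
  - split; auto. intros p. unfold swapC. cts.
  - split; [intros p; unfold swapC; cts|].
    intros v Hv. destruct (H (swapC v)) as [H1 H2].
    { destruct Hv as [->|[->|[->| ->]]]; unfold coord_dir, swapC; simpl; tauto. }
    split.
    + intros p. exact (H1 (swapC p)).
    + exact (IH _ H2).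
Qed.

Lemma smoothC_swap f : smoothC f -> smoothC (fun p => f (swapC p)).
Proof.
  intros H k. destruct (H k) as [H1 H2]. split.
  - exact (Ck_swap k _ H1).
  - exact (Ck_swap k _ H2).
Qed.

Lemma periodic_swap a1 b1 a2 b2 f : periodic a1 b1 a2 b2 f -> periodic a2 b2 a1 b1 (fun p => f (swapC p)).
Proof. intros H p x y Hx Hy. exact (H (swapC p) y x Hy Hx). Qed.

Lemma test_form_swap a1 b1 a2 b2 eta : test_form a1 b1 a2 b2 eta -> test_form a2 b2 a1 b1 (swap_form eta).
Proof.
  intros [S11 [S12 [S21 [S22 [P11 [P12 [P21 P22]]]]]]].
  exact (conj (smoothC_swap _ S22) (conj (smoothC_swap _ S21) (conj (smoothC_swap _ S12) (conj (smoothC_swap _ S11)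
    (conj (periodic_swap _ _ _ _ _ P22) (conj (periodic_swap _ _ _ _ _ P21)
    (conj (periodic_swap _ _ _ _ _ P12) (periodic_swap _ _ _ _ _ P11)))))))).
Qed.

Lemma image_current_swap g r eta : image_current (swap_curve g) r eta = image_current g r (swap_form eta).
Proof. unfold image_current. now rewrite pull_swap. Qed.
Lemma Tnev_swap g r eta : Tnev (swap_curve g) r eta = Tnev g r (swap_form eta).
Proof. unfold Tnev. now rewrite pull_swap. Qed.
Lemma bdry_length_swap g r : bdry_length (swap_curve g) r = bdry_length g r.
Proof. change (rcirc (fun z => sqrt (dens (swap_curve g) z)) r = rcirc (fun z => sqrt (dens g z)) r). now rewrite dens_swap. Qed.
Lemma Lnev_swap g r : Lnev (swap_curve g) r = Lnev g r.
Proof. unfold Lnev. apply RInt_ext; intros t _. now rewrite bdry_length_swap. Qed.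
Lemma Area_swap g r : Area (swap_curve g) r = Area g r.
Proof. now rewrite !Area_eq, dens_swap. Qed.
Lemma Tnev_omega_swap g r : Tnev (swap_curve g) r omega = Tnev g r omega.
Proof. rewrite Tnev_swap. reflexivity. Qed.
Lemma nonconst_on_swap g r : nonconst_on (swap_curve g) r -> nonconst_on g r.
Proof. intros [z [Hz H]]. exists z. split; auto. simpl in H. tauto. Qed.
Lemma twice_diff_swap g : twice_diff g -> twice_diff (swap_curve g).
Proof. intros [D1 [D2 [D3 D4]]]. exact (conj D2 (conj D1 (conj D4 D3))). Qed.

Lemma produces_nevanlinna_swap g r : produces_nevanlinna (swap_curve g) r -> produces_nevanlinna g r.
Proof.
  intros [H1 H2]. split; [intros l; now apply nonconst_on_swap|].
  eapply is_lim_seq_ext; [|exact H2]. intros l; cbv beta. now rewrite Lnev_swap, Tnev_omega_swap.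
Qed.
Lemma produces_ahlfors_swap g r : produces_ahlfors (swap_curve g) r -> produces_ahlfors g r.
Proof.
  intros [H1 H2]. split; [intros l; now apply nonconst_on_swap|].
  eapply is_lim_seq_ext; [|exact H2]. intros l; cbv beta. now rewrite bdry_length_swap, Area_swap.
Qed.

Lemma nevanlinna_current_swap a1 b1 a2 b2 g r T : nevanlinna_current a1 b1 a2 b2 g r T ->
  nevanlinna_current a2 b2 a1 b1 (swap_curve g) r (fun eta => T (swap_form eta)).
Proof.
  intros [phi [Hphi H]]. exists phi. split; auto. intros eta Heta.
  eapply filterlim_ext; [|apply (H (swap_form eta) (test_form_swap _ _ _ _ _ Heta))].
  intros l; cbv beta. now rewrite Tnev_omega_swap, Tnev_swap.
Qed.
Lemma ahlfors_current_swap a1 b1 a2 b2 g r T : ahlfors_current a1 b1 a2 b2 g r T ->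
  ahlfors_current a2 b2 a1 b1 (swap_curve g) r (fun eta => T (swap_form eta)).
Proof.
  intros [phi [Hphi H]]. exists phi. split; auto. intros eta Heta.
  eapply filterlim_ext; [|apply (H (swap_form eta) (test_form_swap _ _ _ _ _ Heta))].
  intros l; cbv beta. now rewrite Area_swap, image_current_swap.
Qed.
Lemma positive_multiple_swap a1 b1 a2 b2 T e2 :
  positive_multiple a2 b2 a1 b1 (fun eta => T (swap_form eta)) (fiber1_current a1 b1 e2) ->
  positive_multiple a1 b1 a2 b2 T (fiber2_current a1 b1 e2).
Proof.
  intros [c [Hc H]]. exists c. split; auto. intros eta Heta.
  specialize (H (swap_form eta) (test_form_swap _ _ _ _ _ Heta)). cbv beta in H.
  rewrite swap_form_invol in H. exact H.
Qed.

(** * Concentration of exponentials *)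

Lemma continuous_bounded_disc (f : C -> C) r : (forall z, continuous f z) -> 0 < r ->
  exists M, 0 <= M /\ forall z, Cmod z <= r -> Cmod (f z) <= M.
Proof.
  intros Hf Hr.
  destruct (continuous_bounded_box4 (fun x y _ _ => Cmod (f ((2 * x - 1) * r, (2 * y - 1) * r)))) as [M HM].
  { intros x y z t. cts. }
  assert (B : forall z, Cmod z <= r -> Cmod (f z) <= M).
  { intros [x y] Hz. assert (Hx := Rabs_Re (x, y)). assert (Hy := Rabs_Im (x, y)). simpl in Hx, Hy.
    assert (X : Rabs x <= r) by lra. assert (Y : Rabs y <= r) by lra.
    apply Rabs_le_between in X. apply Rabs_le_between in Y.
    assert (W : forall u, - r <= u <= r -> 0 <= (u / r + 1) / 2 <= 1).
    { intros u Hu. assert (-1 <= u / r <= 1); [|lra].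
      split; apply Rmult_le_reg_r with r; auto; unfold Rdiv; rewrite Rmult_assoc, Rinv_l; lra. }
    specialize (HM ((x / r + 1) / 2) ((y / r + 1) / 2) 0 0 (W x X) (W y Y) ltac:(lra) ltac:(lra)).
    rewrite Rabs_pos_eq in HM by apply Cmod_ge_0.
    replace ((2 * ((x / r + 1) / 2) - 1) * r) with x in HM by (field; lra).
    replace ((2 * ((y / r + 1) / 2) - 1) * r) with y in HM by (field; lra). exact HM. }
  exists M. split; auto. eapply Rle_trans; [apply Cmod_ge_0|apply (B 0%C)]. rewrite Cmod_0; lra.
Qed.

Lemma exp_le x y : x <= y -> exp x <= exp y.
Proof. intros [H|H]; [left; now apply exp_increasing|right; now f_equal]. Qed.

(** The modulus of the exponential depends on [Re z] only; inside the disc, [Re z] close to [r]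
    already forces [z] close to [r]. *)
Lemma Cmod_sub_r_sqr (z : C) r : Cmod z <= r -> Cmod (z - RtoC r)%C ^ 2 <= 2 * r * (r - Re z).
Proof.
  intros Hz. assert (H : Cmod z ^ 2 <= r ^ 2) by (apply pow_incr; split; [apply Cmod_ge_0|auto]).
  rewrite Cmod_sqr in *. destruct z as [x y]. unfold Re, Im in *; simpl in *. nra.
Qed.

(* Laplace's method: on the disc of radius [r] the area of [exp (N (z - r + 1/2))] is concentrated at
   [z = r] and, being quadratic in [exp (N / 2)], outgrows the length and any fixed background. *)
Lemma exp_concentrated r L l (F : C -> C) (e : C) eps K :
  0 < r -> area_length r L l -> 0 < eps -> 0 <= K ->
  (forall z, Cmod z <= r -> Cmod (F z - e)%C <= 2 * K * Cmod (z - RtoC r)%C) ->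
  exists N0, forall N, N0 <= N -> forall g : curve, twice_diff g ->
    (forall z, Cmod z <= r -> Cmod (g1 g z - F z)%C <= eps /\ Cmod (dg1 g z) <= K /\
       Cmod (dg2 g z - jexp 1%C N (r - 1/2) 1%nat z)%C <= K) ->
    concentrated L l g e (3 * eps).
Proof.
  intros Hr HL He HK HF. destruct HL as [PL Pl _ Hpos].
  (* Within distance [w] of [r], [F] stays within [eps] of [e]; [delta] turns this into a condition
     on [Re z]. The cap [1/4] keeps [exp (N * (1 - delta))] above [exp (N / 2)], the peak size of
     the exponential. *)
  set (w := eps / (2 * K + 1)). assert (Hw : 0 < w) by (apply Rdiv_lt_0_compat; lra).
  set (delta := Rmin (1/4) (w ^ 2 / (2 * r))).
  assert (Hw2 : 0 < w ^ 2) by (apply pow_lt; auto).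
  assert (Hd0 : 0 < delta) by (apply Rmin_pos; [lra|apply Rdiv_lt_0_compat; lra]).
  assert (Hd1 : delta <= 1/4) by apply Rmin_l.
  assert (Hd2 : 2 * r * delta <= w ^ 2).
  { assert (delta <= w ^ 2 / (2 * r)) by apply Rmin_r.
    apply Rle_trans with (2 * r * (w ^ 2 / (2 * r))); [apply Rmult_le_compat_l; lra|right; field; lra]. }
  (* [chi] is the positive part of [bump]: a continuous weight equal to [1] at [r] and zero where
     [r - Re z >= delta / 2]. Its mass [c] does not depend on [N]. *)
  set (bump := fun z : C => 1 - (r - Re z) * (2 / delta)).
  set (chi := fun z : C => (bump z + Rabs (bump z)) * / 2).
  assert (cchi : cont chi).
  { intros z. unfold chi, bump. cts. }
  assert (chi0 : forall z, 0 <= chi z).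
  { intros z; unfold chi. generalize (Rle_abs (- bump z)). rewrite Rabs_Ropp. lra. }
  assert (chi1 : chi (RtoC r) = 1).
  { unfold chi, bump; simpl. replace (1 - (r - r) * (2 / delta)) with 1 by ring. rewrite Rabs_R1; field. }
  set (c := L chi). assert (Hc : 0 < c) by (apply Hpos; auto; rewrite chi1; lra).
  assert (c1 : cont (fun _ => 1)) by (intros z; cts).
  set (LL := L (fun _ => 1)). set (ll := l (fun _ => 1)).
  assert (HLL : 0 <= LL).
  { replace 0 with (0 * LL) by ring. unfold LL. rewrite <- (pf_scal _ _ PL) by auto. apply (pf_le _ _ PL); auto; [intros z; cts|intros; lra]. }
  assert (Hll : 0 <= ll).
  { replace 0 with (0 * ll) by ring. unfold ll. rewrite <- (pf_scal _ _ Pl) by auto. apply (pf_le _ _ Pl); auto; [intros z; cts|intros; lra]. }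
  (* Independent of [N]; times the scale [y] below, they bound the length, the bounded background
     and the far part of the last condition. [N0] makes the area at least [S / eps] times [y]. *)
  set (S1 := (2 * K + 1) * ll). set (S2 := K ^ 2 * LL). set (S3 := 4 * K * r * (2 / delta + 2 * K ^ 2) * LL).
  assert (K2 : 0 <= K ^ 2) by apply pow2_ge_0.
  assert (Hid : 0 < / delta) by (now apply Rinv_0_lt_compat).
  assert (HS1 : 0 <= S1) by (apply Rmult_le_pos; lra).
  assert (HS2 : 0 <= S2) by (apply Rmult_le_pos; lra).
  assert (HS3 : 0 <= S3).
  { unfold S3, Rdiv. apply Rmult_le_pos; [|lra]. apply Rmult_le_pos; [|lra]. apply Rmult_le_pos; lra. }
  set (S := S1 + S2 + S3).
  exists (1 + 2 * (S / eps + S2 + 1) / c). intros N HN g Hg Hz.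
  assert (Hi : 0 <= S / eps) by (apply Rmult_le_pos; [unfold S; lra|apply Rlt_le, Rinv_0_lt_compat; lra]).
  assert (HN1 : 1 <= N).
  { assert (0 <= 2 * (S / eps + S2 + 1) / c); [|lra]. apply Rmult_le_pos; [lra|apply Rlt_le, Rinv_0_lt_compat; lra]. }
  assert (HN2 : S / eps + S2 + 1 <= N * c / 2).
  { assert (2 * (S / eps + S2 + 1) / c <= N) by lra.
    apply Rmult_le_compat_r with (r := c) in H; [|lra]. unfold Rdiv at 1 in H. rewrite Rmult_assoc, Rinv_l in H by lra. lra. }
  (* The reference scale: near [r] the squared derivative is at least [N * y], while the derivative
     itself and, where [r - Re z > delta], its square are at most constants times [y]. The spare
     factor [N] wins. *)
  set (y := N * exp (N * (1 - delta))).
  assert (Ex : forall x, 0 <= x -> 1 <= exp x) by (intros x Hx; generalize (exp_ineq1_le x); lra).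
  assert (Hy : 1 <= y).
  { unfold y. generalize (Ex (N * (1 - delta)) ltac:(nra)). nra. }
  destruct Hg as [D1 [D2 [[dd1 [D1' C1']] [dd2 [D2' C2']]]]].
  assert (cg1 : forall z, continuous (g1 g) z) by (intros z; eapply Cder_cont, D1).
  assert (cg2 : forall z, continuous (g2 g) z) by (intros z; eapply Cder_cont, D2).
  assert (cdg1 : forall z, continuous (dg1 g) z) by (intros z; eapply Cder_cont, D1').
  assert (cdg2 : forall z, continuous (dg2 g) z) by (intros z; eapply Cder_cont, D2').
  set (P := fun z => Cmod (jexp 1%C N (r - 1/2) 1%nat z)).
  assert (EP : forall z, P z = N * exp (N * (Re z - (r - 1/2)))).
  { intros z; unfold P. rewrite Cmod_jexp by lra. rewrite Cmod_1. simpl. ring. }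
  assert (P0 : forall z, 0 <= P z) by (intros; apply Cmod_ge_0).
  assert (Re_r : forall z, Cmod z <= r -> Re z <= r).
  { intros z H. generalize (Rabs_Re z) (Rle_abs (Re z)); lra. }
  assert (Q1 : forall z, Cmod z <= r -> Cmod (dg2 g z) <= P z + K).
  { intros z H. destruct (Hz z H) as [_ [_ H3]].
    replace (dg2 g z) with (jexp 1%C N (r - 1/2) 1%nat z + (dg2 g z - jexp 1%C N (r - 1/2) 1%nat z))%C by ring.
    eapply Rle_trans; [apply Cmod_triangle|]. unfold P; lra. }
  assert (Q2 : forall z, Cmod z <= r -> P z <= Cmod (dg2 g z) + K).
  { intros z H. destruct (Hz z H) as [_ [_ H3]]. unfold P.
    replace (jexp 1%C N (r - 1/2) 1%nat z) with (dg2 g z + - (dg2 g z - jexp 1%C N (r - 1/2) 1%nat z))%C at 1 by ring.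
    eapply Rle_trans; [apply Cmod_triangle|]. rewrite Cmod_opp. lra. }
  assert (Plow : forall z, Cmod z <= r -> N * y * chi z <= P z ^ 2).
  { intros z H. specialize (Re_r z H). destruct (Rle_lt_dec (r - Re z) (delta / 2)) as [Hle|Hlt].
    - assert (chi z <= 1).
      { unfold chi. assert (bump z <= 1).
        { unfold bump. assert (0 <= (r - Re z) * (2 / delta)); [|lra]. apply Rmult_le_pos; [lra|]. unfold Rdiv; lra. }
        assert (- 1 <= bump z).
        { unfold bump. assert ((r - Re z) * (2 / delta) <= (delta / 2) * (2 / delta)).
          - apply Rmult_le_compat_r; auto. unfold Rdiv; lra.
          - replace ((delta / 2) * (2 / delta)) with 1 in H1 by (field; lra). lra. }
        assert (Rabs (bump z) <= 1) by (apply Rabs_le; lra). lra. }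
      apply Rle_trans with (N * y * 1); [apply Rmult_le_compat_l; nra|].
      rewrite EP. unfold y. replace ((N * exp (N * (Re z - (r - 1 / 2)))) ^ 2) with
        (N * N * (exp (N * (Re z - (r - 1/2))) * exp (N * (Re z - (r - 1/2))))) by ring.
      rewrite <- exp_plus. replace (N * (N * exp (N * (1 - delta))) * 1) with (N * N * exp (N * (1 - delta))) by ring.
      apply Rmult_le_compat_l; [nra|]. apply exp_le. nra.
    - replace (chi z) with 0; [rewrite Rmult_0_r; apply pow2_ge_0|].
      unfold chi. rewrite Rabs_left; [ring|]. unfold bump.
      assert ((delta / 2) * (2 / delta) < (r - Re z) * (2 / delta)).
      + apply Rmult_lt_compat_r; auto. unfold Rdiv; lra.
      + replace ((delta / 2) * (2 / delta)) with 1 in H0 by (field; lra). lra. }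
  set (A := L (dens g)).
  assert (cd : cont (dens g)) by (intros z; unfold dens; cts). 
  assert (HA : (N * c / 2 - S2) * y <= A).
  { apply Rle_trans with (L (fun z => N * y / 2 * chi z + - K ^ 2 * 1)).
    - rewrite (pf_plus _ _ PL), !(pf_scal _ _ PL); auto; try (intros z; unfold cont in cchi; cts).
      fold c LL. assert (S2 <= S2 * y) by nra. replace (- K ^ 2 * LL) with (- S2) by (unfold S2; ring). lra.
    - apply (pf_le _ _ PL); auto; [unfold cont in cchi; intros z; cts|].
      intros z H. specialize (Plow z H). specialize (Q2 z H). specialize (P0 z).
      assert (P z ^ 2 <= 2 * Cmod (dg2 g z) ^ 2 + 2 * K ^ 2).
      { apply Rle_trans with ((Cmod (dg2 g z) + K) ^ 2); [apply pow_incr; lra|].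
        generalize (pow2_ge_0 (Cmod (dg2 g z) - K)). nra. }
      unfold dens. generalize (pow2_ge_0 (Cmod (dg1 g z))). lra. }
  assert (HSA : S * y <= eps * A).
  { apply Rle_trans with (eps * ((N * c / 2 - S2) * y)); [|apply Rmult_le_compat_l; lra].
    rewrite <- Rmult_assoc. apply Rmult_le_compat_r; [lra|].
    assert (S / eps <= N * c / 2 - S2) by lra.
    apply Rmult_le_compat_l with (r := eps) in H; [|lra].
    replace (eps * (S / eps)) with S in H by (field; lra). exact H. }
  assert (A0 : 0 < A).
  { eapply Rlt_le_trans; [|exact HA]. apply Rmult_lt_0_compat; lra. }
  assert (y1 : S1 * y <= S * y) by (apply Rmult_le_compat_r; unfold S; lra).
  assert (y2 : S2 * y <= S * y) by (apply Rmult_le_compat_r; unfold S; lra).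
  assert (y3 : S3 * y <= S * y) by (apply Rmult_le_compat_r; unfold S; lra).
  assert (HeA : 0 < eps * A) by (apply Rmult_lt_0_compat; auto).
  split; [exact A0|]. fold A. split; [|split].
  - apply Rle_trans with (S1 * y); [|lra].
    apply Rle_trans with (l (fun z => (2 * K + y) * 1)).
    + apply (pf_le _ _ Pl); [intros z; unfold dens; cts|intros z; cts|].
      intros z H. destruct (Hz z H) as [_ [H2 _]]. specialize (Q1 z H).
      assert (P z <= y).
      { rewrite EP. unfold y. apply Rmult_le_compat_l; [lra|]. apply exp_le. specialize (Re_r z H). nra. }
      apply Rle_trans with (Cmod (dg1 g z) + Cmod (dg2 g z)); [|lra].
      assert (X1 := Cmod_ge_0 (dg1 g z)). assert (X2 := Cmod_ge_0 (dg2 g z)).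
      rewrite <- (sqrt_pow2 (Cmod (dg1 g z) + Cmod (dg2 g z))) by lra.
      apply sqrt_le_1_alt. unfold dens. nra.
    + rewrite (pf_scal _ _ Pl) by auto. fold ll. unfold S1.
      replace ((2 * K + 1) * ll * y) with ((2 * K * y + y) * ll) by ring.
      apply Rmult_le_compat_r; auto. nra.
  - apply Rle_trans with (S2 * y); [|lra]. apply Rle_trans with S2; [|nra].
    apply Rle_trans with (L (fun z => K ^ 2 * 1)).
    + apply (pf_le _ _ PL); [intros z; cts|intros z; cts|].
      intros z H. destruct (Hz z H) as [_ [H2 _]]. rewrite Rmult_1_r. apply pow_incr; split; auto. apply Cmod_ge_0.
    + rewrite (pf_scal _ _ PL) by auto. unfold S2, LL; lra.
  - set (E := 4 * K * r * (2 * (y * / delta) + 2 * K ^ 2)).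
    apply Rle_trans with (L (fun z => 2 * eps * dens g z + E * 1)).
    + apply (pf_le _ _ PL); [intros z; cts|unfold cont in cd; intros z; cts|].
      intros z H. destruct (Hz z H) as [H1 [H2 _]]. specialize (Q1 z H).
      assert (X1 := Cmod_ge_0 (dg1 g z)). assert (X2 := Cmod_ge_0 (dg2 g z)).
      assert (HE : 0 <= E).
      { unfold E. apply Rmult_le_pos; [|nra]. apply Rmult_le_pos; lra. }
      assert (Tr : Cmod (g1 g z - e)%C <= eps + 2 * K * Cmod (z - RtoC r)%C).
      { replace (g1 g z - e)%C with ((g1 g z - F z) + (F z - e))%C by ring.
        eapply Rle_trans; [apply Cmod_triangle|]. specialize (HF z H). lra. }
      assert (Zr := Cmod_sub_r_sqr z r H). assert (Z0 := Cmod_ge_0 (z - RtoC r)%C).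
      assert (QQ := pow2_ge_0 (Cmod (dg2 g z))). assert (PP := pow2_ge_0 (Cmod (dg1 g z))).
      (* Near [r] the first component is within [2 * eps] of [e]; elsewhere it is only bounded, but
         the exponential is small compared with its peak. *)
      destruct (Rle_lt_dec (r - Re z) delta) as [Hle|Hlt].
      * assert (Cmod (z - RtoC r)%C <= w).
        { apply Rsqr_incr_0_var; [|lra]. unfold Rsqr.
          assert (2 * r * (r - Re z) <= 2 * r * delta) by (apply Rmult_le_compat_l; lra). lra. }
        assert (2 * K * w <= eps).
        { unfold w. apply Rmult_le_reg_r with (2 * K + 1); [lra|].
          replace (2 * K * (eps / (2 * K + 1)) * (2 * K + 1)) with (2 * K * eps) by (field; lra). lra. }
        assert (Cmod (g1 g z - e)%C <= 2 * eps).
        { assert (2 * K * Cmod (z - RtoC r)%C <= 2 * K * w) by (apply Rmult_le_compat_l; lra). lra. }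
        assert (Cmod (g1 g z - e)%C * Cmod (dg2 g z) ^ 2 <= 2 * eps * Cmod (dg2 g z) ^ 2) by (now apply Rmult_le_compat_r).
        assert (0 <= 2 * eps * Cmod (dg1 g z) ^ 2) by (apply Rmult_le_pos; lra).
        unfold dens. lra.
      * assert (Zb : Cmod (z - RtoC r)%C <= 2 * r).
        { unfold Cminus. eapply Rle_trans; [apply Cmod_triangle|]. rewrite Cmod_opp, Cmod_R, Rabs_pos_eq by lra. lra. }
        assert (Pb : P z ^ 2 <= y * / delta).
        { rewrite EP. replace ((N * exp (N * (Re z - (r - 1 / 2)))) ^ 2) with
            (N * N * (exp (N * (Re z - (r - 1/2))) * exp (N * (Re z - (r - 1/2))))) by ring.
          rewrite <- exp_plus.
          apply Rle_trans with (N * N * (exp (N * (1 - delta)) * exp (- (N * delta)))).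
          - apply Rmult_le_compat_l; [nra|]. rewrite <- exp_plus. apply exp_le. nra.
          - replace (N * N * (exp (N * (1 - delta)) * exp (- (N * delta)))) with (y * (N * exp (- (N * delta)))) by (unfold y; ring).
            apply Rmult_le_compat_l; [lra|]. rewrite exp_Ropp.
            apply Rmult_le_reg_r with (exp (N * delta)); [apply exp_pos|].
            rewrite Rmult_assoc, Rinv_l by (apply Rgt_not_eq, exp_pos).
            generalize (exp_ineq1_le (N * delta)); intros.
            apply Rmult_le_reg_l with delta; auto.
            replace (delta * (/ delta * exp (N * delta))) with (exp (N * delta)) by (field; lra). lra. }
        assert (Db : Cmod (dg2 g z) ^ 2 <= 2 * (y * / delta) + 2 * K ^ 2).
        { apply Rle_trans with ((P z + K) ^ 2); [apply pow_incr; lra|].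
          generalize (pow2_ge_0 (P z - K)). nra. }
        assert (Cmod (g1 g z - e)%C * Cmod (dg2 g z) ^ 2 <= (eps + 4 * K * r) * Cmod (dg2 g z) ^ 2).
        { apply Rmult_le_compat_r; auto.
          assert (2 * K * Cmod (z - RtoC r)%C <= 2 * K * (2 * r)) by (apply Rmult_le_compat_l; lra). lra. }
        assert (4 * K * r * Cmod (dg2 g z) ^ 2 <= E).
        { unfold E. apply Rmult_le_compat_l; auto. apply Rmult_le_pos; lra. }
        assert (0 <= eps * Cmod (dg1 g z) ^ 2) by (apply Rmult_le_pos; lra).
        assert (0 <= eps * Cmod (dg2 g z) ^ 2) by (apply Rmult_le_pos; lra).
        unfold dens. lra.
    + rewrite (pf_plus _ _ PL), !(pf_scal _ _ PL); auto; try (unfold cont in cd; intros z; cts). fold A LL.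
      assert (E * LL <= S3 * y).
      { unfold E, S3. replace (4 * K * r * (2 / delta + 2 * K ^ 2) * LL * y) with
          (4 * K * r * (2 * (y * / delta) + 2 * K ^ 2 * y) * LL) by (unfold Rdiv; ring).
        apply Rmult_le_compat_r; auto. apply Rmult_le_compat_l; [apply Rmult_le_pos; lra|]. nra. }
      lra.
Qed.

(** The exponent [4] is the highest derivative order controlled; [exp x >= (x / 5) ^ 5] beats it by
    one power of [N]. *)
Lemma pow4_exp_small c k eps : 0 <= c -> 0 < k -> 0 < eps ->
  exists N0, 1 <= N0 /\ forall N, N0 <= N -> c * N ^ 4 * exp (- (k * N)) <= eps.
Proof.
  intros Hc Hk He. set (B := c * (5 / k) ^ 5).
  assert (H5 : 0 < 5 / k) by (apply Rdiv_lt_0_compat; lra).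
  assert (HB : 0 <= B) by (apply Rmult_le_pos; [auto|apply pow_le; lra]).
  exists (1 + B / eps). split.
  { assert (0 <= B / eps) by (apply Rmult_le_pos; [auto|apply Rlt_le, Rinv_0_lt_compat; auto]). lra. }
  intros N HN.
  assert (Hi : 0 <= B / eps) by (apply Rmult_le_pos; [auto|apply Rlt_le, Rinv_0_lt_compat; auto]).
  assert (N1 : 1 <= N) by lra.
  assert (X : (k * N / 5) ^ 5 <= exp (k * N)).
  { replace (k * N) with (k * N / 5 + k * N / 5 + k * N / 5 + k * N / 5 + k * N / 5) at 2 by field.
    rewrite !exp_plus. replace (exp (k * N / 5) * exp (k * N / 5) * exp (k * N / 5) * exp (k * N / 5) * exp (k * N / 5))
      with (exp (k * N / 5) ^ 5) by ring.
    apply pow_incr. split; [apply Rmult_le_pos; nra|]. generalize (exp_ineq1_le (k * N / 5)); lra. }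
  rewrite exp_Ropp. apply Rmult_le_reg_r with (exp (k * N)); [apply exp_pos|].
  rewrite Rmult_assoc, Rinv_l, Rmult_1_r by (apply Rgt_not_eq, exp_pos).
  apply Rle_trans with (eps * (k * N / 5) ^ 5); [|apply Rmult_le_compat_l; lra].
  assert (BN : B <= eps * N).
  { apply Rle_trans with (eps * (B / eps)); [right; field; lra|]. apply Rmult_le_compat_l; lra. }
  replace (c * N ^ 4) with (B * (N ^ 4 * (k / 5) ^ 5)) by (unfold B; field; lra).
  replace (eps * (k * N / 5) ^ 5) with (eps * N * (N ^ 4 * (k / 5) ^ 5)) by field.
  apply Rmult_le_compat_r; auto. apply Rmult_le_pos; apply pow_le; lra.
Qed.

(** The threshold lies at distance [k] to the right of the disc of radius [r - 1]. It is used with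
    [k = 1], threshold [r], and with [k = 1/2], threshold [r - 1/2]. *)
Lemma jexp_small v (k eps : R) r : 0 < k -> 0 < eps ->
  exists N0, 1 <= N0 /\ forall N m z, N0 <= N -> (m <= 4)%nat -> Cmod z <= r - 1 ->
    Cmod (jexp v N (r - 1 + k) m z) <= eps.
Proof.
  intros Hk He. destruct (pow4_exp_small (Cmod v) k eps (Cmod_ge_0 v) Hk He) as [N0 [H0 HN]].
  exists N0; split; auto. intros N m z H Hm Hz. rewrite Cmod_jexp by lra.
  eapply Rle_trans; [|apply (HN N H)].
  assert (Re z <= r - 1) by (generalize (Rabs_Re z) (Rle_abs (Re z)); lra).
  apply Rmult_le_compat.
  - apply Rmult_le_pos; [apply Cmod_ge_0|apply pow_le; lra].
  - apply Rlt_le, exp_pos.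
  - apply Rmult_le_compat_l; [apply Cmod_ge_0|]. apply Rle_pow; auto; lra.
  - apply exp_le. nra.
Qed.

Definition both_concentrated (r : R) (g : curve) (e : C) (eps : R) : Prop :=
  concentrated (fun h => rdisc h r) (fun h => rcirc h r) g e eps /\
  concentrated (fun h => rdisc_log h r) (fun h => rcirc_log h r) g e eps.

(** The tolerance on [g] is small for values of the first component but only bounded for
    derivatives: a bounded perturbation is invisible next to the huge exponential. Quantifying over
    [g] makes the conclusion stable under later steps. *)
Lemma concentration_step (G1 G2 : jet) r e eta eps : isjet G1 -> isjet G2 -> 0 < r -> 0 < eta -> 0 < eps ->
  exists F1 F2 : jet, isjet F1 /\ isjet F2 /\
    (forall m z, (m <= 4)%nat -> Cmod z <= r - 1 ->
       Cmod (F1 m z - G1 m z)%C <= eta /\ Cmod (F2 m z - G2 m z)%C <= eta) /\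
    forall g, twice_diff g ->
      (forall z, Cmod z <= r -> Cmod (g1 g z - F1 0%nat z)%C <= eps /\
         Cmod (dg1 g z - F1 1%nat z)%C <= 2 /\ Cmod (dg2 g z - F2 1%nat z)%C <= 2) ->
      both_concentrated r g e (3 * eps).
Proof.
  intros J1 J2 Hr Heta Heps.
  set (v := (e - G1 0%nat (RtoC r))%C).
  destruct (jexp_small v 1 eta r Rlt_0_1 Heta) as [N1 [HN1 S1]].
  replace (r - 1 + 1) with r in S1 by ring.
  set (F1 := jadd G1 (jexp v N1 r)).
  assert (JF1 : isjet F1) by (apply isjet_add; [auto|apply isjet_exp]).
  assert (E1 : F1 0%nat (RtoC r) = e).
  { unfold F1, jadd, jexp. replace (RtoC N1 * (RtoC r - RtoC r))%C with (RtoC 0) by ring.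
    rewrite cexp_0. simpl. unfold v. ring. }
  destruct (continuous_bounded_disc (F1 1%nat) r) as [K1 [K10 B1]]; auto.
  { intros z; eapply Cder_cont, (JF1 1%nat). }
  destruct (continuous_bounded_disc (G2 1%nat) r) as [K2 [K20 B2]]; auto.
  { intros z; eapply Cder_cont, (J2 1%nat). }
  (* A single constant, fixed before [N], for the slope of [F1], the derivative of [g1], and all of
     the derivative of [g2] except the exponential; the [2] absorbs the tolerance on [g]. *)
  set (K := K1 + K2 + 2).
  assert (HF : forall z, Cmod z <= r -> Cmod (F1 0%nat z - e)%C <= 2 * K * Cmod (z - RtoC r)%C).
  { intros z Hz. rewrite <- E1. apply (Cmod_mvt (F1 0%nat) (F1 1%nat)); [apply JF1|].
    intros t Ht. apply Rle_trans with K1; [|unfold K; lra]. apply B1. apply Cmod_segment; auto.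
    rewrite Cmod_R, Rabs_pos_eq; lra. }
  destruct (exp_concentrated r _ _ (F1 0%nat) e eps K Hr (area_length_ahlfors r Hr) Heps) as [Na Ha]; auto; [unfold K; lra|].
  destruct (exp_concentrated r _ _ (F1 0%nat) e eps K Hr (area_length_nevanlinna r Hr) Heps) as [Nb Hb]; auto; [unfold K; lra|].
  assert (H12 : 0 < 1/2) by lra.
  destruct (jexp_small 1%C (1/2) eta r H12 Heta) as [N2 [HN2 S2]].
  replace (r - 1 + 1/2) with (r - 1/2) in S2 by field.
  set (N := Rmax N2 (Rmax Na Nb)).
  assert (M2 : N2 <= N) by apply Rmax_l.
  assert (Ma : Na <= N) by (eapply Rle_trans; [apply Rmax_l|apply Rmax_r]).
  assert (Mb : Nb <= N) by (eapply Rle_trans; [apply Rmax_r|apply Rmax_r]).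
  set (F2 := jadd G2 (jexp 1%C N (r - 1/2))).
  exists F1, F2. split; auto. split; [apply isjet_add; [auto|apply isjet_exp]|]. split.
  - intros m z Hm Hz. unfold F1, F2, jadd. split.
    + replace (G1 m z + jexp v N1 r m z - G1 m z)%C with (jexp v N1 r m z) by ring. apply S1; auto; lra.
    + replace (G2 m z + jexp 1 N (r - 1/2) m z - G2 m z)%C with (jexp 1%C N (r - 1/2) m z) by ring. apply S2; auto.
  - intros g Hg Hz.
    assert (Hz' : forall z, Cmod z <= r -> Cmod (g1 g z - F1 0%nat z)%C <= eps /\ Cmod (dg1 g z) <= K /\
       Cmod (dg2 g z - jexp 1%C N (r - 1/2) 1%nat z)%C <= K).
    { intros z H. destruct (Hz z H) as [H1 [H2 H3]]. specialize (B1 z H). specialize (B2 z H). split; auto. split.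
      - replace (dg1 g z) with ((dg1 g z - F1 1%nat z) + F1 1%nat z)%C by ring.
        eapply Rle_trans; [apply Cmod_triangle|]. unfold K; lra.
      - replace (dg2 g z - jexp 1 N (r - 1/2) 1%nat z)%C with ((dg2 g z - F2 1%nat z) + G2 1%nat z)%C by (unfold F2, jadd; ring).
        eapply Rle_trans; [apply Cmod_triangle|]. unfold K; lra. }
    split; [now apply (Ha N)|now apply (Hb N)].
Qed.

(** * Construction of the curve *)

Lemma half_pow_le k n : (k <= n)%nat -> (1/2) ^ n <= (1/2) ^ k.
Proof.
  intros H. replace n with (k + (n - k))%nat by lia. rewrite pow_add.
  assert (0 <= (1/2) ^ (n - k) <= 1).
  { split; [apply Rlt_le, half_pow_pos|]. assert (Hp := pow_incr (1/2) 1 (n - k)). rewrite pow1 in Hp. apply Hp; lra. }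
  generalize (half_pow_pos k). nra.
Qed.
Lemma half_pow_lim : is_lim_seq (fun k => (1/2)^k) 0.
Proof. apply is_lim_seq_geom; rewrite Rabs_pos_eq; lra. Qed.
Lemma half_pow_small e : 0 < e -> exists p, (1/2)^p <= e.
Proof.
  intros He. assert (Z := half_pow_lim). apply is_lim_seq_spec in Z. destruct (Z (mkposreal e He)) as [N HN].
  exists N. specialize (HN N (le_n N)). simpl in HN. rewrite Rminus_0_r in HN.
  rewrite Rabs_pos_eq in HN by (apply Rlt_le, half_pow_pos). lra.
Qed.

(** An enumeration of the dyadic rationals: Cantor pairing encodes the exponent [p] and an integer
    written as a difference of two naturals. *)
Definition dyadic (i : nat) : R :=
  let (p, t) := Cantor.of_nat i in let (u, v) := Cantor.of_nat t in (INR u - INR v) * (1/2) ^ p.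

Lemma dyadic_dense x e : 0 < e -> exists i, Rabs (dyadic i - x) <= e.
Proof.
  intros He. destruct (half_pow_small e He) as [p Hp].
  set (k := Int_part (x * 2 ^ p)).
  exists (Cantor.to_nat (p, Cantor.to_nat (Z.to_nat k, Z.to_nat (- k)))).
  unfold dyadic. rewrite !Cantor.cancel_of_to.
  assert (E : INR (Z.to_nat k) - INR (Z.to_nat (- k)) = IZR k).
  { rewrite !INR_IZR_INZ, <- minus_IZR. f_equal. lia. }
  rewrite E. assert (B := base_Int_part (x * 2 ^ p)). fold k in B.
  assert (Q : 2 ^ p * (1/2) ^ p = 1).
  { rewrite <- Rpow_mult_distr. replace (2 * (1/2)) with 1 by field. apply pow1. }
  replace (IZR k * (1/2)^p - x) with ((IZR k - x * 2 ^ p) * (1/2)^p).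
  - rewrite Rabs_mult, (Rabs_pos_eq ((1/2)^p)) by (apply Rlt_le, half_pow_pos).
    assert (Rabs (IZR k - x * 2 ^ p) <= 1) by (apply Rabs_le; lra).
    generalize (half_pow_pos p) (Rabs_pos (IZR k - x * 2 ^ p)). nra.
  - replace x with (x * (2 ^ p * (1/2)^p)) at 2 by (rewrite Q; ring). ring.
Qed.

(* Every pair (component, dyadic point) is visited infinitely often. *)
Definition target (n : nat) : bool * C :=
  let (i, _) := Cantor.of_nat n in let (b, t) := Cantor.of_nat i in let (x, y) := Cantor.of_nat t in
  (Nat.eqb b 0, (dyadic x, dyadic y)).

Lemma target_dense b (e : C) eps k : 0 < eps ->
  exists n, (k <= n)%nat /\ fst (target n) = b /\ Cmod (snd (target n) - e)%C <= eps.
Proof.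
  intros He. destruct (dyadic_dense (Re e) (eps/2)) as [x Hx]; [lra|].
  destruct (dyadic_dense (Im e) (eps/2)) as [y Hy]; [lra|].
  (* [target] ignores the last component of the code, so [k] can be placed there to make the code at
     least [k]. *)
  exists (Cantor.to_nat (Cantor.to_nat ((if b then 0 else 1)%nat, Cantor.to_nat (x, y)), k)).
  split; [|split].
  - eapply Nat.le_trans; [|apply Cantor.to_nat_non_decreasing]. lia.
  - unfold target. rewrite !Cantor.cancel_of_to. now destruct b.
  - unfold target. rewrite !Cantor.cancel_of_to. simpl snd.
    eapply Rle_trans; [apply Cmod_le_ReIm|].
    change (Rabs (dyadic x - Re e) + Rabs (dyadic y - Im e) <= eps). lra.
Qed.

(** The proofs travel with the data, because the existence of the next step, and hence the
    recursion, depends on them. *)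
Definition jet2 : Type := {p : jet * jet | isjet (fst p) /\ isjet (snd p)}.
Definition jfst (s : jet2) : jet := fst (proj1_sig s).
Definition jsnd (s : jet2) : jet := snd (proj1_sig s).

Definition orient (b : bool) (g : curve) : curve := if b then g else swap_curve g.

(* [2 * (1/2)^n] bounds the sum of all corrections after step [n] on the disc of radius [n + 1]. *)
Definition good_step (n : nat) (s s' : jet2) : Prop :=
  (forall m z, (m <= 4)%nat -> Cmod z <= INR n ->
     Cmod (jfst s' m z - jfst s m z)%C <= (1/2)^n /\ Cmod (jsnd s' m z - jsnd s m z)%C <= (1/2)^n) /\
  forall g, twice_diff g ->
    (forall z, Cmod z <= INR (S n) ->
       Cmod (g1 g z - jfst s' 0%nat z)%C <= 2 * (1/2)^n /\ Cmod (g2 g z - jsnd s' 0%nat z)%C <= 2 * (1/2)^n /\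
       Cmod (dg1 g z - jfst s' 1%nat z)%C <= 2 /\ Cmod (dg2 g z - jsnd s' 1%nat z)%C <= 2) ->
    both_concentrated (INR (S n)) (orient (fst (target n)) g) (snd (target n)) (6 * (1/2)^n).

Lemma good_step_exists n s : exists s', good_step n s s'.
Proof.
  destruct s as [[G1 G2] [J1 J2]]. simpl in J1, J2.
  assert (Hr : 0 < INR (S n)) by (apply lt_0_INR; lia).
  assert (Hp := half_pow_pos n). assert (Hp2 : 0 < 2 * (1/2)^n) by lra.
  assert (En : INR (S n) - 1 = INR n) by (rewrite S_INR; ring).
  unfold good_step. destruct (fst (target n)); unfold orient.
  - destruct (concentration_step G1 G2 _ (snd (target n)) _ _ J1 J2 Hr Hp Hp2) as [F1 [F2 [K1 [K2 [HS HC]]]]].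
    exists (exist (fun p : jet * jet => isjet (fst p) /\ isjet (snd p)) (F1, F2) (conj K1 K2)).
    unfold jfst, jsnd; simpl proj1_sig; simpl fst; simpl snd. split.
    + intros m z Hm Hz. apply HS; auto. now rewrite En.
    (* The tolerance [2 * (1/2)^n] on the values is multiplied by the [3] of the concentration
       step. *)
    + intros g Hg Hz. replace (6 * (1/2)^n) with (3 * (2 * (1/2)^n)) by ring. apply HC; auto.
      intros z H. specialize (Hz z H). tauto.
  - destruct (concentration_step G2 G1 _ (snd (target n)) _ _ J2 J1 Hr Hp Hp2) as [F2 [F1 [K2 [K1 [HS HC]]]]].
    exists (exist (fun p : jet * jet => isjet (fst p) /\ isjet (snd p)) (F1, F2) (conj K1 K2)).
    unfold jfst, jsnd; simpl proj1_sig; simpl fst; simpl snd. split.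
    + intros m z Hm Hz. apply and_comm. apply HS; auto. now rewrite En.
    + intros g Hg Hz. replace (6 * (1/2)^n) with (3 * (2 * (1/2)^n)) by ring. apply HC.
      * now apply twice_diff_swap.
      * intros z H. specialize (Hz z H). simpl. tauto.
Qed.

Definition next_jet2 (n : nat) (s : jet2) : jet2 :=
  proj1_sig (constructive_indefinite_description _ (good_step_exists n s)).
Fixpoint jet_seq (n : nat) : jet2 :=
  match n with
  | O => exist (fun p : jet * jet => isjet (fst p) /\ isjet (snd p)) (jzero, jzero) (conj isjet_zero isjet_zero)
  | S n => next_jet2 n (jet_seq n)
  end.

Lemma jet_seq_good n : good_step n (jet_seq n) (jet_seq (S n)).
Proof. simpl. unfold next_jet2. now destruct (constructive_indefinite_description _ (good_step_exists n (jet_seq n))). Qed.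

Lemma isjet_jfst s : isjet (jfst s).
Proof. exact (proj1 (proj2_sig s)). Qed.
Lemma isjet_jsnd s : isjet (jsnd s).
Proof. exact (proj2 (proj2_sig s)). Qed.

(** Two derivatives of the limit and the continuity of the second are wanted; as each passage to the
    limit consumes two further orders, this uses the orders [0] to [4]. *)
Lemma jet_limit (f : nat -> jet) : (forall n, isjet (f n)) ->
  (forall n m z, (m <= 4)%nat -> Cmod z <= INR n -> Cmod (f (S n) m z - f n m z)%C <= (1/2)^n) ->
  exists F0 F1 F2 : C -> C, disc_limit (fun n => f n 0%nat) F0 /\ disc_limit (fun n => f n 1%nat) F1 /\
    (forall z, Cder F0 z (F1 z)) /\ (forall z, Cder F1 z (F2 z)) /\ (forall z, continuous F2 z).
Proof.
  intros J H.
  assert (X : forall m, (m <= 4)%nat -> exists F, disc_limit (fun n => f n m) F).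
  { intros m Hm. apply disc_limit_exists. intros; now apply H. }
  destruct (X 0%nat) as [F0 L0]; [lia|]. destruct (X 1%nat) as [F1 L1]; [lia|].
  destruct (X 2%nat) as [F2 L2]; [lia|]. destruct (X 3%nat) as [F3 L3]; [lia|]. destruct (X 4%nat) as [F4 L4]; [lia|].
  exists F0, F1, F2. split; auto. split; auto. split; [|split].
  - apply (disc_limit_Cder _ _ _ F0 F1 F2 (fun k => J k 0%nat) (fun k => J k 1%nat)); auto.
  - apply (disc_limit_Cder _ _ _ F1 F2 F3 (fun k => J k 1%nat) (fun k => J k 2%nat)); auto.
  - intros z. apply (Cder_cont _ _ (F3 z)).
    apply (disc_limit_Cder _ _ _ F2 F3 F4 (fun k => J k 2%nat) (fun k => J k 3%nat)); auto.
Qed.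

Lemma universal_curve : exists g, twice_diff g /\
  forall n, both_concentrated (INR (S n)) (orient (fst (target n)) g) (snd (target n)) (6 * (1/2)^n).
Proof.
  destruct (jet_limit (fun n => jfst (jet_seq n))) as [F0 [F1 [F2 [LF0 [LF1 [DF0 [DF1 CF]]]]]]].
  - intros n; apply isjet_jfst.
  - intros n m z Hm Hz. apply (jet_seq_good n); auto.
  - destruct (jet_limit (fun n => jsnd (jet_seq n))) as [G0 [G1 [G2 [LG0 [LG1 [DG0 [DG1 CG]]]]]]].
    + intros n; apply isjet_jsnd.
    + intros n m z Hm Hz. apply (jet_seq_good n); auto.
    + exists (Curve F0 G0 F1 G1).
      assert (T : twice_diff (Curve F0 G0 F1 G1)).
      { split; [exact DF0|]. split; [exact DG0|]. split; [exists F2|exists G2]; auto. }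
      split; auto. intros n. apply (jet_seq_good n); auto.
      intros z Hz.
      (* The rate of [disc_limit] at stage [S n] is exactly the tolerance allowed by [good_step n],
         on the same disc of radius [n + 1]. *)
      assert (E : 4 * (1/2)^(S n) = 2 * (1/2)^n) by (simpl; field).
      assert (B : 2 * (1/2)^n <= 2) by (generalize (half_pow_le 0 n (Nat.le_0_l n)); simpl; lra).
      simpl g1; simpl g2; simpl dg1; simpl dg2.
      rewrite (Cmod_sub_sym (F0 z)), (Cmod_sub_sym (G0 z)), (Cmod_sub_sym (F1 z)), (Cmod_sub_sym (G1 z)).
      generalize (LF0 (S n) z Hz) (LG0 (S n) z Hz) (LF1 (S n) z Hz) (LG1 (S n) z Hz). rewrite E.
      cbv beta. intros. repeat split; lra.
Qed.

(** The offset [3] gives [6 * (1/2)^(N l) <= 6/8], within the bound [1] on [eps] required by the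
    criterion; growth at least linear sends both radii and errors to their limits. *)
Lemma target_subsequence b e : exists N : nat -> nat, forall l,
  (l + 3 <= N l)%nat /\ (N l < N (S l))%nat /\ fst (target (N l)) = b /\ Cmod (snd (target (N l)) - e)%C <= (1/2)^l.
Proof.
  pose (pick := fun k l => proj1_sig (constructive_indefinite_description _ (target_dense b e _ k (half_pow_pos l)))).
  assert (Hp : forall k l, (k <= pick k l)%nat /\ fst (target (pick k l)) = b /\ Cmod (snd (target (pick k l)) - e)%C <= (1/2)^l).
  { intros k l. unfold pick. now destruct (constructive_indefinite_description _ (target_dense b e _ k (half_pow_pos l))). }
  pose (N := fix N l := match l with O => pick 3%nat O | S l' => pick (S (N l')) (S l') end).
  assert (HN : forall l, (l + 3 <= N l)%nat /\ (N l < N (S l))%nat).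
  { assert (G : forall l, (N l < N (S l))%nat) by (intros l; destruct (Hp (S (N l)) (S l)) as [H _]; simpl; lia).
    induction l as [|l IH].
    - split; auto. destruct (Hp 3%nat O) as [H _]; simpl; lia.
    - split; auto. specialize (G l). lia. }
  exists N. intros l. split; [apply HN|]. split; [apply HN|].
  destruct l; simpl; apply Hp.
Qed.

Lemma fiber1_from_concentration a1 b1 a2 b2 g e (N : nat -> nat) :
  nondeg a1 b1 -> nondeg a2 b2 -> twice_diff g ->
  (forall l, (l + 3 <= N l)%nat /\ (N l < N (S l))%nat /\ Cmod (snd (target (N l)) - e)%C <= (1/2)^l) ->
  (forall l, both_concentrated (INR (S (N l))) g (snd (target (N l))) (6 * (1/2)^(N l))) ->
  radii (fun l => INR (S (N l))) /\
  produces_nevanlinna g (fun l => INR (S (N l))) /\ produces_ahlfors g (fun l => INR (S (N l))) /\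
  (forall T, nevanlinna_current a1 b1 a2 b2 g (fun l => INR (S (N l))) T ->
     positive_multiple a1 b1 a2 b2 T (fiber1_current a2 b2 e)) /\
  (forall T, ahlfors_current a1 b1 a2 b2 g (fun l => INR (S (N l))) T ->
     positive_multiple a1 b1 a2 b2 T (fiber1_current a2 b2 e)).
Proof.
  intros h1 h2 Hg HN HC. split.
  - split.
    + intros l. split; [apply lt_0_INR; lia|]. apply lt_INR. destruct (HN l) as [_ [H _]]. lia.
    + apply (is_lim_seq_le_p_loc INR); [|apply is_lim_seq_INR].
      exists 0%nat. intros l _. apply le_INR. destruct (HN l) as [H _]. lia.
  - apply (fiber1_criterion a1 b1 a2 b2 h1 h2 g _ (fun l => 6 * (1/2)^(N l)) (fun l => snd (target (N l)))); auto.
    + intros l; apply lt_0_INR; lia.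
    + intros l. destruct (HN l) as [H _]. generalize (half_pow_pos (N l)) (half_pow_le 3 (N l) ltac:(lia)). simpl. lra.
    + apply (is_lim_seq_dominated _ (fun l => 6 * (1/2)^l)).
      * intros l. rewrite Rabs_pos_eq by (generalize (half_pow_pos (N l)); lra).
        destruct (HN l) as [H _]. generalize (half_pow_le l (N l) ltac:(lia)). lra.
      * replace (Finite 0) with (Rbar_mult 6 0) by (simpl; now rewrite Rmult_0_r).
        apply is_lim_seq_scal_l, half_pow_lim.
    + apply (is_lim_seq_dominated _ (fun l => (1/2)^l)); [|apply half_pow_lim].
      intros l. rewrite Rabs_pos_eq by apply Cmod_ge_0. apply HN.
    + intros l; apply (HC l).
    + intros l; apply (HC l).
Qed.

Theorem theoremB (a1 b1 a2 b2 : C) (h1 : nondeg a1 b1) (h2 : nondeg a2 b2) :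
  exists g : curve, entire g /\
  (forall e1 : C, exists r : nat -> R, radii r /\
     produces_nevanlinna g r /\ produces_ahlfors g r /\
     (forall T, nevanlinna_current a1 b1 a2 b2 g r T ->
        positive_multiple a1 b1 a2 b2 T (fiber1_current a2 b2 e1)) /\
     (forall T, ahlfors_current a1 b1 a2 b2 g r T ->
        positive_multiple a1 b1 a2 b2 T (fiber1_current a2 b2 e1))) /\
  (forall e2 : C, exists r : nat -> R, radii r /\
     produces_nevanlinna g r /\ produces_ahlfors g r /\
     (forall T, nevanlinna_current a1 b1 a2 b2 g r T ->
        positive_multiple a1 b1 a2 b2 T (fiber2_current a1 b1 e2)) /\
     (forall T, ahlfors_current a1 b1 a2 b2 g r T ->
        positive_multiple a1 b1 a2 b2 T (fiber2_current a1 b1 e2))).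
Proof.
  destruct universal_curve as [g [Hg HC]].
  exists g. split; [|split].
  - destruct Hg as [D1 [D2 _]]. split; intros z; now apply Cder_is_derive.
  - intros e1. destruct (target_subsequence true e1) as [N HN].
    exists (fun l => INR (S (N l))).
    apply (fiber1_from_concentration a1 b1 a2 b2 g e1 N); auto.
    + intros l. destruct (HN l) as [H1 [H2 [_ H3]]]. auto.
    + intros l. destruct (HN l) as [_ [_ [H3 _]]]. generalize (HC (N l)). now rewrite H3.
  - intros e2. destruct (target_subsequence false e2) as [N HN].
    exists (fun l => INR (S (N l))).
    assert (HN' : forall l, (l + 3 <= N l)%nat /\ (N l < N (S l))%nat /\ Cmod (snd (target (N l)) - e2)%C <= (1/2)^l).
    { intros l. destruct (HN l) as [H1 [H2 [_ H3]]]. auto. }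
    assert (HC' : forall l, both_concentrated (INR (S (N l))) (swap_curve g) (snd (target (N l))) (6 * (1/2)^(N l))).
    { intros l. destruct (HN l) as [_ [_ [H3 _]]]. generalize (HC (N l)). now rewrite H3. }
    (* The steps with second-factor targets concentrate the exchanged curve, so the first-factor
       criterion is applied on the exchanged torus and transported back. *)
    destruct (fiber1_from_concentration a2 b2 a1 b1 (swap_curve g) e2 N h2 h1 (twice_diff_swap g Hg) HN' HC')
      as [R1 [R2 [R3 [R4 R5]]]].
    split; [exact R1|]. split; [exact (produces_nevanlinna_swap _ _ R2)|].
    split; [exact (produces_ahlfors_swap _ _ R3)|]. split.
    + intros T HT. exact (positive_multiple_swap _ _ _ _ _ _ (R4 _ (nevanlinna_current_swap _ _ _ _ _ _ _ HT))).
    + intros T HT. exact (positive_multiple_swap _ _ _ _ _ _ (R5 _ (ahlfors_current_swap _ _ _ _ _ _ _ HT))).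
Qed.
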